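(* Let $0<s<1$, $p\in(1,\infty)$ with $sp>1$, and let $\Omega$ be any proper open set in $\mathbb{R}^n$. Let $1\le q\le p^*_s:=\frac{np}{n-sp}$ if $sp<n$, and $1\le q<\infty$ if $sp\ge n$. Then $\mathbb{R}^n\setminus\Omega$ is a uniformly $(s,p)$-fat set with a constant $\gamma$ if and only if for any $z\in\mathbb{R}^n\setminus\Omega$ and $r>0$, $$\left(\frac{1}{|B_r(z)|}\int_{B_r(z)}|u(x)|^{q}\,dx\right)^{\frac1q}\le C\,\gamma^{-\frac1p}\,r^{s-\frac np}\left(\int_{B_r(z)}\int_{B_r(z)}\frac{|u(x)-u(y)|^p}{|x-y|^{n+sp}}\,dx\,dy\right)^{\frac1p}\quad\text{for all }u\in C_c^\infty(\Omega),$$ where $C=C(n,s,p,q)$ is a constant.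
   Context: $B_r(z)$ is the open ball of center $z$ and radius $r$, $2B_r(x)=B_{2r}(x)$, and $|\cdot|$ applied to a set is Lebesgue measure. Functions $u\in C_c^\infty(\Omega)$ are extended by zero to $\mathbb{R}^n$. For an open set $U\subseteq\mathbb{R}^n$ and a compact set $K\subset U$, the variational $(s,p)$-Sobolev capacity is $$\mathrm{Cap}_{s,p}(K,U)=\inf\left\{\int_U\int_U\frac{|v(x)-v(y)|^p}{|x-y|^{n+sp}}\,dx\,dy:\ v\in C_c^\infty(U),\ v\ge1\text{ on }K\right\}.$$ A closed set $E\subset\mathbb{R}^n$ is uniformly $(s,p)$-fat with a constant $\gamma>0$ if $\mathrm{Cap}_{s,p}(E\cap\overline{B_r(x)},2B_r(x))\ge\gamma\,\mathrm{Cap}_{s,p}(\overline{B_r(x)},2B_r(x))$ for all $x\in E$ and $r>0$.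
   Formalization: The constant C may differ between the two implications (each depends only on n, s, p, q, with the same γ); for Ω = ∅ the converse assumes γ ≤ 1, since the inequality is then trivial for every γ while R^n is uniformly fat only for γ ≤ 1. *)

(* Defs.v *)
From HB Require Import structures.
From mathcomp Require Import all_boot all_order all_algebra.
From mathcomp Require Import all_classical all_reals all_analysis.

Set Implicit Arguments.
Unset Strict Implicit.
Unset Printing Implicit Defensive.

Import Order.TTheory GRing.Theory Num.Theory.
Import numFieldNormedType.Exports.

Local Open Scope classical_set_scope.
Local Open Scope ring_scope.

(* R^n is ['rV[R]_n]. The topology and the differential structure are those of
   the library, but the library norm on ['rV[R]_n] is the sup norm, so the
   Euclidean length and balls are defined separately. *)

Definition rV_display : measure_display.
Proof. exact. Qed.

Section measurable_rV.
Context {R : realType} {n : nat}.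

Let coord (i : 'I_n) (x : 'rV[R]_n) : measurableTypeR R := x ord0 i.

Let rV_set0 : g_sigma_preimage coord set0.
Proof. exact: sigma_algebra0. Qed.

Let rV_setC A : g_sigma_preimage coord A -> g_sigma_preimage coord (~` A).
Proof. exact: sigma_algebraC. Qed.

Let rV_bigcup (F : (set 'rV[R]_n)^nat) :
  (forall i, g_sigma_preimage coord (F i)) ->
  g_sigma_preimage coord (\bigcup_i (F i)).
Proof. exact: sigma_algebra_bigcup. Qed.

(* The product sigma-algebra, i.e. the Borel sets of R^n; same construction as
   the instance for [n.-tuple T] in the library. *)
HB.instance Definition _ := @isMeasurable.Build rV_display 'rV[R]_n
  (g_sigma_preimage coord) rV_set0 rV_setC rV_bigcup.

End measurable_rV.

Section lebesgue_measure_rV.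
Context {R : realType}.

Definition rV_snoc n (u : 'rV[R]_n * measurableTypeR R) : 'rV[R]_n.+1 :=
  \row_i oapp (fun j => u.1 ord0 j) u.2 (unlift ord_max i).

Lemma measurable_rV_coord n (i : 'I_n) :
  measurable_fun [set: 'rV[R]_n]
    (fun x : 'rV[R]_n => x ord0 i : measurableTypeR R).
Proof.
move=> _ Y mY; rewrite setTI; apply: sub_sigma_algebra => /=.
rewrite -bigcup_seq/=; exists i => /=; first by rewrite mem_index_enum.
by exists Y => //; rewrite setTI.
Qed.

Lemma measurable_rV_snoc n : measurable_fun setT (@rV_snoc n).
Proof.
move=> _; apply: (@measurability _ _ _ _ setT (@rV_snoc n)
  (\big[setU/set0]_(i < n.+1) preimage_set_system setT
    (fun x : 'rV[R]_n.+1 => x ord0 i : measurableTypeR R) measurable)) => //.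
move=> _ [A + <-].
rewrite -bigcup_seq => -[i /= _ [B mB <-]].
rewrite !setTI.
have [j ij|iE] := unliftP ord_max i.
  have -> : (@rV_snoc n) @^-1` ((fun x : 'rV[R]_n.+1 => x ord0 i) @^-1` B) =
      (fun u : 'rV[R]_n * measurableTypeR R => u.1 ord0 j) @^-1` B.
    by apply/seteqP; split => u /=; rewrite mxE ij liftK.
  rewrite -[X in measurable X]setTI.
  exact: (measurableT_comp (measurable_rV_coord j) measurable_fst).
have -> : (@rV_snoc n) @^-1` ((fun x : 'rV[R]_n.+1 => x ord0 i) @^-1` B) =
    snd @^-1` B.
  by apply/seteqP; split => u /=; rewrite mxE iE unlift_none.
by rewrite -[X in measurable X]setTI; exact: measurable_snd.
Qed.

Definition product_snoc n (m : {measure set 'rV[R]_n -> \bar R}) :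
    set 'rV[R]_n.+1 -> \bar R :=
  pushforward (m \x (@lebesgue_measure R))%E (@rV_snoc n).

Section product_snoc_measure.
Local Open Scope ereal_scope.
Variables (n : nat) (m : {measure set 'rV[R]_n -> \bar R}).

Let product_snoc_preimage A : measurable A -> measurable (@rV_snoc n @^-1` A).
Proof.
by move=> mA; rewrite -[X in measurable X]setTI; exact: measurable_rV_snoc.
Qed.

Let product_snoc0 : product_snoc m set0 = 0.
Proof. by rewrite /product_snoc /pushforward preimage_set0 measure0. Qed.

Let product_snoc_ge0 A : 0 <= product_snoc m A.
Proof. by rewrite /product_snoc /pushforward measure_ge0. Qed.

Let product_snoc_sigma_additive : semi_sigma_additive (product_snoc m).
Proof.
move=> F mF tF mUF; rewrite /product_snoc /pushforward preimage_bigcup.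
apply: measure_semi_sigma_additive.
- by move=> i; exact: product_snoc_preimage.
- apply/trivIsetP => /= i j _ _ ij; rewrite -preimage_setI.
  by move/trivIsetP : tF => /(_ _ _ _ _ ij) ->//; rewrite preimage_set0.
- by rewrite -preimage_bigcup; exact: product_snoc_preimage.
Qed.

HB.instance Definition _ := isMeasure.Build _ _ _ (product_snoc m)
  product_snoc0 product_snoc_ge0 product_snoc_sigma_additive.

End product_snoc_measure.

(* n-dimensional Lebesgue measure on the Borel sets: the n-fold product of the
   one-dimensional [lebesgue_measure]. *)
Fixpoint lebesgue_rV n : {measure set 'rV[R]_n -> \bar R} :=
  match n with
  | 0 => dirac (0 : 'rV[R]_0)
  | m.+1 => product_snoc (lebesgue_rV m)
  end.

End lebesgue_measure_rV.

Section euclidean.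
Context {R : realType} {n : nat}.

Definition enorm (x : 'rV[R]_n) : R := Num.sqrt (\sum_(i < n) x ord0 i ^+ 2).

Definition eball (z : 'rV[R]_n) (r : R) : set 'rV[R]_n :=
  [set x | enorm (x - z) < r].

End euclidean.

Section test_functions.
Context {R : realType} {n : nat}.
Implicit Types u : 'rV[R]_n -> R.

Fixpoint Ck (k : nat) u : Prop :=
  match k with
  | 0 => continuous u
  | j.+1 => continuous u /\ forall i : 'I_n,
      (forall x, derivable u x (delta_mx ord0 i)) /\
      Ck j (fun x => 'D_(delta_mx ord0 i) u x)
  end.

Definition smooth u : Prop := forall k, Ck k u.

Definition supp u : set 'rV[R]_n := closure [set x | u x != 0].

(* C_c^oo(U), each function being identified with its extension by zero. *)
Definition test_function (U : set 'rV[R]_n) : set ('rV[R]_n -> R) :=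
  [set u | [/\ smooth u, compact (supp u) & supp u `<=` U]].

End test_functions.

Section capacity.
Context {R : realType} {n : nat}.
Variables s p : R.
Local Open Scope ereal_scope.

(* On the diagonal the integrand is [0 / 0 = 0]; the diagonal is a null set. *)
Definition gagliardo (U : set 'rV[R]_n) (v : 'rV[R]_n -> R) : \bar R :=
  \int[@lebesgue_rV R n]_(x in U) \int[@lebesgue_rV R n]_(y in U)
    ((`|v x - v y| `^ p) / (enorm (x - y) `^ (n%:R + s * p)))%R%:E.

Definition Cap (K U : set 'rV[R]_n) : \bar R :=
  ereal_inf [set gagliardo U v | v in
    [set v | test_function U v /\ forall x, K x -> (1 <= v x)%R]].

Definition uniformly_fat (E : set 'rV[R]_n) (gamma : R) : Prop :=
  [/\ closed E, (0 < gamma)%R &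
    forall x r, E x -> (0 < r)%R ->
      gamma%:E * Cap (closure (eball x r)) (eball x (2 * r)) <=
      Cap (E `&` closure (eball x r)) (eball x (2 * r))].

Definition local_poincare (Omega : set 'rV[R]_n) (q A : R) : Prop :=
  forall z r, ~ Omega z -> (0 < r)%R ->
  forall u, test_function Omega u ->
    ((\int[@lebesgue_rV R n]_(x in eball z r) (`|u x| `^ q)%R%:E)
      / lebesgue_rV n (eball z r)) `^ q^-1
    <= (A * r `^ (s - n%:R / p))%R%:E * (gagliardo (eball z r) u) `^ p^-1.

End capacity.

(* Main.v *)
Require Import Defs.
From HB Require Import structures.
From mathcomp Require Import all_boot all_order all_algebra.
From mathcomp Require Import all_classical all_reals all_analysis.
From mathcomp Require Import measurable_realfun ring lra.

(** Everything takes place in a ball [B] of radius [r] on which the energy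
[gagliardo s p B u] is at most [M].  Write [g x] for the inner integral
[gint B u x], so that the integral of [g] over [B] is at most [M].  Both
implications follow from two estimates on [B]:

- a Sobolev inequality ([sobolev_ball]): for a suitable point [y0] of [B], the integral
  of [`|u - u y0| `^ q] over [B] is at most [C r^n (r^(s - n/p) M^(1/p))^q];
- a Hardy inequality ([hardy_ball]): if [u] is a test function of [B], the
  integral of [`|u| `^ p] over [B] is at most [C r^(s p) M].

Both come from one device.  Mean values of [u] are replaced by values at good
points, which are points chosen with Chebyshev's inequality so that [g] and the
kernel towards a previous good point are small there.  Thus only integrals of
nonnegative functions occur.  Given a point [x0] of the closed ball, let [B_k] be
the image of [B] under the homothety of centre [x0] and ratio [2^-k].  These balls
are nested, stay in [B] and shrink to [x0].  If the integral of [g] over [B_k] is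
at most [A k], there are good points [y_k] in [B_k] with
[`|u y_k - u y_(k+1)| <= jump k], of order [(A k (2^-k r)^(s p - n))^(1/p)]
([chain_points]).

For the Sobolev inequality [x0 = x] is an arbitrary point and [A k = M].  The jumps
then grow at most like [2^(k tau)], while the last step from [y_k] to [x] costs
[(2^-k r)^s (g x)^(1/p)].  Stopping at the scale where the two are balanced, as in
Hedberg's inequality, bounds [`|u x - u y0| `^ q] by an affine function of [g x],
which is then integrated.  The upper bound on [q] is exactly what allows a suitable
[tau] ([exponent_choice]).

For the Hardy inequality [x0] is a point of the sphere, near which [u] vanishes.
Let [x0] range over a piece of the sphere, which has dimension [n - 1].  By Tonelli
the average of the integral of [g] over [B_k] is at most [C 2^(-k(n-1)) M], so one
[x0] is good for all [k] at once, up to a factor [2^(k del)] with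
[del = (s p - 1) / 2] ([good_direction]).  The jumps now decay like [2^(-k del/p)]:
this is where [s p > 1] enters.  Summing them bounds [u y0] ([hardy_point]).
Applied to a competitor of the capacity, the Hardy inequality gives
[Cap (closure B_r) B_2r >= c r^(n - s p)] ([cap_lower]); a cutoff function gives the
matching upper bound ([cap_upper]).

From fatness to the Poincaré inequality: if [u] is a test function of [Omega] and
[y0] a good point with [u y0 != 0], then a cutoff times [1 - u / u y0] equals 1 on
the part of the half ball outside [Omega], and its energy is at most
[C M / `|u y0| `^ p].  Fatness and the lower capacity bound therefore yield
[gamma `|u y0| `^ p <= C M r^(s p - n)] ([level_bound]).  Together with the Sobolev
inequality for [u - u y0] this is the claim.

From the Poincaré inequality to fatness: let [v] be a competitor for the part of
[closure B_r] outside [Omega].  If [v >= 1/4] on a fixed proportion of the half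
ball, the Hardy inequality bounds its energy below by [c r^(n - s p)].  Otherwise a
cutoff times [step \o v], where [step] goes smoothly from 1 on [t <= 1/4] to 0 on
[3/4 <= t], is a test function of [Omega] that equals 1 on half of the half ball, and
the Poincaré inequality bounds the energy of [v] below by [c A^(-p) r^(n - s p)],
where [A] is the Poincaré constant ([competitor_bound]).  The first bound is comparable with [gamma] as well, because
[A] cannot be too small: a bump supported in [Omega] near its boundary shows this
([poincare_lowerP]), unless [Omega] is empty.  In that case both capacities in the
definition of fatness coincide and the condition reads [gamma <= 1]. *)

Set Implicit Arguments.
Unset Strict Implicit.
Unset Printing Implicit Defensive.

Import Order.TTheory GRing.Theory Num.Theory.
Import numFieldNormedType.Exports.

Local Open Scope classical_set_scope.
Local Open Scope ring_scope.

(** * Euclidean norm, balls and Lebesgue measure *)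

Section measure_rV.
Context {R : realType}.

Definition box n (a b : 'rV[R]_n) : set 'rV[R]_n :=
  [set x | forall i, a ord0 i < x ord0 i < b ord0 i].

Lemma measurable_box n (a b : 'rV[R]_n) : measurable (box a b).
Proof.
rewrite (_ : box a b =
  \bigcap_(i in [set: 'I_n]) ((fun x : 'rV[R]_n => x ord0 i : measurableTypeR R) @^-1`
     `]a ord0 i, b ord0 i[%classic)); last first.
  apply/seteqP; split => x /= H i; first by move=> _ /=; rewrite in_itv /=.
  by have := H i I; rewrite /= in_itv.
apply: fin_bigcap_measurable => // i _; rewrite -[X in measurable X]setTI.
by apply: measurable_rV_coord => //; exact: measurable_itv.
Qed.

(** The sigma-algebra is generated by the coordinates, whereas the topology is that of
the sup norm: an open set is the union of the countably many boxes with rational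
corners that it contains. *)
Lemma open_measurable_rV n (U : set 'rV[R]_n) : open U -> measurable U.
Proof.
move=> oU.
rewrite (_ : U = \bigcup_(ab in [set ab : 'rV[rat]_n * 'rV[rat]_n |
   box (map_mx ratr ab.1) (map_mx ratr ab.2) `<=` U])
   box (map_mx ratr ab.1) (map_mx ratr ab.2)); last first.
  apply/seteqP; split => [x Ux|x [ab abU]]; last exact: abU.
  have [e /= e0 eU] : nbhs_ball x U by apply/nbhs_ballP; exact: open_nbhs_nbhs.
  have rI (y : R) : {q : rat | y < ratr q < y + e}.
    have lt : y < y + e by rewrite ltrDl.
    by apply: cid; have [q] := @rat_in_itvoo R _ _ lt; rewrite in_itv /=; exists q.
  exists (\row_i sval (rI (x ord0 i - e)), \row_i sval (rI (x ord0 i))).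
    move=> y /= yb; apply: eU; split=> // i j; rewrite ord1.
    have := yb j; rewrite !mxE => /andP[ay yb'].
    rewrite /ball /= ltr_norml.
    have /andP[h1 _] := svalP (rI (x ord0 j - e)).
    have /andP[_ h2] := svalP (rI (x ord0 j)).
    by move: (lt_trans h1 ay) (lt_trans yb' h2) => ? ?; apply/andP; split; lra.
  move=> i; rewrite !mxE.
  have /andP[_ h1] := svalP (rI (x ord0 i - e)).
  have /andP[h2 _] := svalP (rI (x ord0 i)).
  by rewrite h2 andbT -[ltRHS](subrK e).
rewrite bigcup_mkcond; apply: countable_bigcupT_measurable => [|ab].
  exact: countableP.
by case: ifPn => // _; exact: measurable_box.
Qed.

Lemma measurable_rVP d (T : measurableType d) n (D : set T) (f : T -> 'rV[R]_n) :
  (forall i, measurable_fun D (fun t => f t ord0 i : measurableTypeR R)) ->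
  measurable_fun D f.
Proof.
move=> mf mD; apply: (@measurability _ _ _ _ D f
  (\big[setU/set0]_(i < n) preimage_set_system setT
    (fun x : 'rV[R]_n => x ord0 i : measurableTypeR R) measurable)) => //.
move=> _ [A + <-].
rewrite -bigcup_seq => -[i /= _ [B mB <-]].
rewrite setTI; exact: (mf i mD B mB).
Qed.

Lemma measurable_cont n (f : 'rV[R]_n -> R) :
  continuous f -> measurable_fun [set: 'rV[R]_n] f.
Proof.
move=> /continuousP cf.
apply: (measurability _ (measurable_realfun.RGenOpens.measurableE R)).
move=> _ [_ [a [b ->] <-]]; rewrite setTI; apply: open_measurable_rV.
exact/cf/interval_open.
Qed.

Lemma lebesgue_box n (a b : 'rV[R]_n) (l : R) : 0 <= l ->
  (forall i, b ord0 i = a ord0 i + l) ->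
  lebesgue_rV n (box a b) = (l ^+ n)%:E.
Proof.
move=> l0; elim: n a b => [|n IH] a b ab.
  by rewrite expr0 /= diracE mem_set // => -[].
rewrite /= /product_snoc /pushforward.
have -> : @rV_snoc R n @^-1` box a b =
  box (\row_j a ord0 (lift ord_max j)) (\row_j b ord0 (lift ord_max j))
    `*` `]a ord0 ord_max, b ord0 ord_max[%classic.
  apply/seteqP; split => -[x y] /=.
    move=> H; split.
      by move=> j; have := H (lift ord_max j); rewrite !mxE (liftK ord_max j).
    by rewrite in_itv /=; have := H ord_max; rewrite mxE unlift_none.
  move=> [H]; rewrite in_itv /= => H' i; rewrite mxE.
  have [j ->|->] := unliftP ord_max i; last by rewrite ?unlift_none.
  by have := H j; rewrite !mxE.
set A := box _ _; set B := `]_, _[%classic.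
transitivity (lebesgue_rV n A * lebesgue_measure B)%E.
  exact: (@product_measure1E _ _ _ _ R (lebesgue_rV n) (@lebesgue_measure R) A B
    (measurable_box _ _) (measurable_itv _)).
rewrite /A /B.
rewrite IH; last by move=> j; rewrite !mxE ab.
rewrite lebesgue_measure_itv /= lte_fin ab ltrDl.
case: ltP => [_|l0'].
  by rewrite -EFinD addrAC subrr add0r -EFinM -exprSr.
have -> : l = 0 by apply/eqP; rewrite eq_le l0 l0'.
by rewrite mule0 exprS mul0r.
Qed.
End measure_rV.

Lemma closure_sub_closed (T : topologicalType) (A B : set T) :
  closed B -> A `<=` B -> closure A `<=` B.
Proof. by move=> /closure_id BE /closureS; rewrite -BE. Qed.

Section euclidean_norm.
Context {R : realType} {n : nat}.
Implicit Types x y z : 'rV[R]_n.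

Lemma enorm_ge0 x : 0 <= enorm x. Proof. exact: sqrtr_ge0. Qed.

Lemma sqr_enorm x : enorm x ^+ 2 = \sum_(i < n) x ord0 i ^+ 2.
Proof. by rewrite sqr_sqrtr // sumr_ge0 // => i _; rewrite sqr_ge0. Qed.

Lemma enorm0 : enorm (0 : 'rV[R]_n) = 0.
Proof. by rewrite /enorm big1 ?sqrtr0 // => i _; rewrite mxE expr0n. Qed.

Lemma enormZ (c : R) x : enorm (c *: x) = `|c| * enorm x.
Proof.
rewrite /enorm (eq_bigr (fun i => c ^+ 2 * x ord0 i ^+ 2)).
  by rewrite -mulr_sumr sqrtrM ?sqr_ge0 // sqrtr_sqr.
by move=> i _; rewrite mxE exprMn.
Qed.

Lemma enormN x : enorm (- x) = enorm x.
Proof. by rewrite -scaleN1r enormZ normrN1 mul1r. Qed.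

Lemma enormBC x y : enorm (x - y) = enorm (y - x).
Proof. by rewrite -enormN opprB. Qed.

Lemma dot_le_enorm x y : \sum_(i < n) x ord0 i * y ord0 i <= enorm x * enorm y.
Proof.
have [y0|yn0] := eqVneq (enorm y) 0.
  have /eqP := sqr_enorm y; rewrite y0 expr0n /= eq_sym psumr_eq0; last first.
    by move=> i _; rewrite sqr_ge0.
  move=> /allP yi0; rewrite mulr0 big1 // => i _.
  have /implyP /(_ isT) := yi0 i (mem_index_enum i).
  by rewrite sqrf_eq0 => /eqP ->; rewrite mulr0.
set C := \sum_(i < n) _; set A := enorm x; set B := enorm y.
have B0 : 0 < B by rewrite lt_neqAle eq_sym yn0 enorm_ge0.
(* The squared length of [|y|^2 x - (x . y) y]. *)
have : 0 <= \sum_(i < n) (x ord0 i * B ^+ 2 - y ord0 i * C) ^+ 2.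
  by rewrite sumr_ge0 // => i _; rewrite sqr_ge0.
have -> : \sum_(i < n) (x ord0 i * B ^+ 2 - y ord0 i * C) ^+ 2 =
    B ^+ 4 * A ^+ 2 - 2 * B ^+ 2 * C * C + C ^+ 2 * B ^+ 2.
  rewrite (eq_bigr (fun i => B ^+ 4 * x ord0 i ^+ 2 +
      (- (2 * B ^+ 2 * C) * (x ord0 i * y ord0 i)) + C ^+ 2 * y ord0 i ^+ 2)).
    by rewrite !big_split /= -!mulr_sumr -!sqr_enorm -/A -/B -/C mulNr.
  by move=> i _; ring.
have -> : B ^+ 4 * A ^+ 2 - 2 * B ^+ 2 * C * C + C ^+ 2 * B ^+ 2 =
   B ^+ 2 * ((A * B) ^+ 2 - C ^+ 2) by ring.
rewrite pmulr_rge0 ?exprn_gt0 // subr_ge0 => CAB.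
have AB0 : 0 <= A * B by rewrite mulr_ge0 ?enorm_ge0.
rewrite -(ger0_norm AB0); apply: le_trans (ler_norm _) _.
by rewrite -ler_sqr ?nnegrE ?normr_ge0 // !real_normK ?num_real.
Qed.

Lemma enormD x y : enorm (x + y) <= enorm x + enorm y.
Proof.
rewrite -ler_sqr ?nnegrE ?addr_ge0 ?enorm_ge0 // sqrrD !sqr_enorm.
rewrite (eq_bigr (fun i => x ord0 i ^+ 2 + (x ord0 i * y ord0 i) *+ 2 + y ord0 i ^+ 2)).
  rewrite !big_split /= lerD2r lerD2l.
  by rewrite mulr2n lerD // dot_le_enorm.
by move=> i _; rewrite mxE sqrrD.
Qed.

Lemma enormB_le x y z : enorm (x - z) <= enorm (x - y) + enorm (y - z).
Proof. by have := enormD (x - y) (y - z); rewrite addrA subrK. Qed.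

Lemma coord_le_enorm x i : `|x ord0 i| <= enorm x.
Proof.
rewrite -ler_sqr ?nnegrE ?enorm_ge0 // sqr_enorm real_normK ?num_real //.
by rewrite (bigD1 i) //= lerDl sumr_ge0 // => j _; rewrite sqr_ge0.
Qed.

Lemma enorm_le_coord x (c : R) : 0 <= c -> (forall i, `|x ord0 i| <= c) ->
  enorm x ^+ 2 <= n%:R * c ^+ 2.
Proof.
move=> c0 xc; rewrite sqr_enorm -[n in n%:R]card_ord -sum1_card natr_sum mulr_suml.
apply: ler_sum => i _; rewrite mul1r -[leLHS]real_normK ?num_real //.
by rewrite ler_sqr ?nnegrE.
Qed.

Lemma enorm_continuous : continuous (@enorm R n).
Proof.
move=> x; apply: (@continuous_comp _ _ _ (fun x : 'rV[R]_n => \sum_(i < n) x ord0 i ^+ 2) Num.sqrt).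
  apply: (@continuous_big R _ +%R 0 xpredT _ _ _ (fun i (x : 'rV[R]_n) => x ord0 i ^+ 2)) => [|i _ y]; first exact: add_continuous.
  exact: (continuous_comp (@coord_continuous R 1 n ord0 i y) (@exprn_continuous R 2 _)).
exact: sqrt_continuous.
Qed.

Lemma enormB_continuous y : continuous (fun x => enorm (x - y)).
Proof.
move=> x; apply: (@continuous_comp _ _ _ (fun x => x - y) (@enorm R n)).
  by apply: (@continuousB R _ _ id (cst y) x); [exact: cvg_id|exact: cst_continuous].
exact: enorm_continuous.
Qed.

Lemma eball_open z r : open (eball z r : set 'rV[R]_n).
Proof.
rewrite (_ : eball z r = (fun x => enorm (x - z)) @^-1` [set t | t < r]) //.
by apply: open_comp => [x _|]; [exact: enormB_continuous|exact: open_lt].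
Qed.

Lemma measurable_eball z r : measurable (eball z r : set 'rV[R]_n).
Proof. by apply: open_measurable_rV; exact: eball_open. Qed.

Lemma closure_eball_le z r x : closure (eball z r) x -> enorm (x - z) <= r.
Proof.
suff : closure (eball z r) `<=` [set x | enorm (x - z) <= r] by move=> h /h.
apply: (@closure_sub_closed _ _ [set x | enorm (x - z) <= r]).
  by apply: (@preimage_closed _ _ (fun x => enorm (x - z)) [set t | t <= r]);
    [move=> y _; exact: enormB_continuous|exact: closed_le].
by move=> y /= /ltW.
Qed.

Lemma sub_eball z z' r r' : enorm (z - z') + r <= r' -> eball z r `<=` eball z' r'.
Proof.
by rewrite /eball => h x /= xz; have := enormB_le x z z'; lra.
Qed.

(** Bounds of order [r^n], by a circumscribed and an inscribed cube, stand in for the exact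
volume of balls. *)
Lemma lebesgue_eball_le z r : 0 <= r ->
  (lebesgue_rV n (eball z r) <= ((2 * r) ^+ n)%:E)%E.
Proof.
move=> r0.
rewrite -(@lebesgue_box _ _ (\row_i (z ord0 i - r)) (\row_i (z ord0 i + r)));
  [|by rewrite mulr_ge0|by move=> i; rewrite !mxE; ring].
apply: le_measure; rewrite ?inE; [exact: measurable_eball|exact: measurable_box|].
move=> x /= xz i; rewrite !mxE.
have := le_lt_trans (coord_le_enorm (x - z) i) xz; rewrite !mxE ltr_norml.
by move=> /andP[? ?]; apply/andP; split; lra.
Qed.

Lemma lebesgue_eball_ge z r : (0 < n)%N -> 0 < r ->
  (((r / n%:R) ^+ n)%:E <= lebesgue_rV n (eball z r))%E.
Proof.
move=> n0 r0; have nR : 0 < n%:R :> R by rewrite ltr0n.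
pose h := r / (2 * n%:R); have h0 : 0 < h by rewrite divr_gt0 ?mulr_gt0.
rewrite (_ : r / n%:R = 2 * h); last by rewrite /h; field; rewrite gt_eqF.
rewrite -(@lebesgue_box _ _ (\row_i (z ord0 i - h)) (\row_i (z ord0 i + h)));
  [|by rewrite mulr_ge0 // ltW|by move=> i; rewrite !mxE; ring].
apply: le_measure; rewrite ?inE; [exact: measurable_box|exact: measurable_eball|].
move=> x /= xz; rewrite /eball /= -ltr_sqr ?nnegrE ?enorm_ge0 ?(ltW r0) //.
apply: (@le_lt_trans _ _ (n%:R * h ^+ 2)).
  apply: enorm_le_coord; [exact: ltW|move=> i; have := xz i; rewrite !mxE ler_norml].
  by move=> /andP[? ?]; apply/andP; split; lra.
have n1 : 1 <= n%:R :> R by rewrite ler1n.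
have -> : r = 2 * n%:R * h by rewrite /h; field; rewrite gt_eqF.
rewrite !exprMn ltr_pM2r ?exprn_gt0 //.
have : n%:R <= n%:R ^+ 2 :> R by rewrite expr2 ler_peMr // ltW.
  lra.
by rewrite -exprMn exprn_gt0.
Qed.

Lemma bounded_closed_compact_enorm (A : set 'rV[R]_n) z r :
  closed A -> (forall x, A x -> enorm (x - z) <= r) -> compact A.
Proof.
move=> cA bA; apply: bounded_closed_compact => //.
have h i x : A x -> `|x ord0 i| <= `|z ord0 i| + r.
  move=> /bA xr; have := le_trans (coord_le_enorm (x - z) i) xr; rewrite !mxE => h.
  by rewrite -[x ord0 i](subrK (z ord0 i)) addrC (le_trans (ler_normD _ _)) // lerD2l.
exists (enorm z + r); split; first exact: num_real.
move=> M hM x Ax; rewrite /= /Num.norm /= mx_normrE; apply/bigmax_leP; split.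
  have := bA x Ax; have := enorm_ge0 z; have := enorm_ge0 (x - z); lra.
move=> [i j] _ /=; rewrite ord1; apply: le_trans (h j x Ax) _.
have := coord_le_enorm z j; lra.
Qed.
End euclidean_norm.

Section tonelli_rV.
Context {R : realType}.
Local Open Scope ereal_scope.

Lemma sigma_finite_rV n : (0 < n)%N -> sigma_finite setT (@lebesgue_rV R n).
Proof.
move=> n0; exists (fun k => eball 0 k%:R).
  apply/seteqP; split => // x _; exists (Num.truncn (enorm x)).+1 => //=.
  by rewrite /eball /= subr0; exact: truncnS_gt.
move=> k; split; first exact: measurable_eball.
by apply: le_lt_trans (lebesgue_eball_le _ _) _; rewrite ?ltry.
Qed.

Lemma sigma_finite_rV0 : sigma_finite setT (@lebesgue_rV R 0).
Proof.
exists (fun=> setT); first by rewrite bigcup_const.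
by move=> k; split => //=; rewrite /= diracT ltry.
Qed.

Lemma sigma_finite_lebesgue_rV n : sigma_finite setT (@lebesgue_rV R n).
Proof. by case: n => [|n]; [exact: sigma_finite_rV0|exact: sigma_finite_rV]. Qed.

(** A copy of [lebesgue_rV] that carries the sigma-finite structure required by the
Tonelli theorem. *)
Definition lebesgue_rV_sf n : set 'rV[R]_n -> \bar R := lebesgue_rV n.
HB.instance Definition _ n := Measure.on (@lebesgue_rV_sf n).
HB.instance Definition _ n := Measure_isSigmaFinite.Build _ _ _ (@lebesgue_rV_sf n)
  (sigma_finite_lebesgue_rV n).

Lemma integral_lebesgue_rV_sf n (D : set 'rV[R]_n) (f : 'rV[R]_n -> \bar R) :
  \int[lebesgue_rV n]_(x in D) f x = \int[@lebesgue_rV_sf n]_(x in D) f x.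
Proof. exact: eq_measure_integral. Qed.

Lemma measurable_int_rV d (T : measurableType d) n (f : T * 'rV[R]_n -> \bar R) :
  measurable_fun setT f -> (forall x, 0 <= f x) ->
  measurable_fun setT (fun x => \int[lebesgue_rV n]_y f (x, y)).
Proof.
move=> mf f0; under eq_fun do rewrite integral_lebesgue_rV_sf.
exact: (@measurable_fun_fubini_tonelli_F _ _ _ _ _ (@lebesgue_rV_sf n) f mf f0).
Qed.

Lemma tonelli_rV m n (f : 'rV[R]_m * 'rV[R]_n -> \bar R) :
  measurable_fun setT f -> (forall x, 0 <= f x) ->
  \int[lebesgue_rV m]_x \int[lebesgue_rV n]_y f (x, y) =
  \int[lebesgue_rV n]_y \int[lebesgue_rV m]_x f (x, y).
Proof.
move=> mf f0; rewrite !integral_lebesgue_rV_sf.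
under eq_integral do rewrite integral_lebesgue_rV_sf.
under [RHS]eq_integral do rewrite integral_lebesgue_rV_sf.
exact: (@fubini_tonelli _ _ _ _ _ (@lebesgue_rV_sf m) (@lebesgue_rV_sf n) f mf f0).
Qed.
End tonelli_rV.

(** * Smooth functions *)

Section smooth_functions.
Context {R : realType} {n : nat}.
Implicit Types u w : 'rV[R]_n -> R.

Lemma derive_line u x v : 'D_v u x = 'D_1 (fun h : R => u (h *: v + x)) 0.
Proof.
rewrite /derive; set g1 := fun h => h^-1 *: _; set g2 := fun h => h^-1 *: _.
suff -> : g1 = g2 by [].
by rewrite funeqE /g1 /g2 => h /=; rewrite addr0 scale0r add0r [_%:A]mulr1.
Qed.

(** Derivatives along a line are derivatives of real functions, and the chain rule for
these involves the derivative along that line only. *)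
Lemma is_derive_lineP u x v d :
  is_derive x v u d <-> is_derive (0 : R) (1 : R) (fun h : R => u (h *: v + x)) d.
Proof.
split=> -[du dE].
  apply: DeriveDef; last by rewrite -derive_line.
  exact: (derivable1P u x v).1.
apply: DeriveDef; last by rewrite derive_line.
exact: (derivable1P u x v).2.
Qed.

Lemma is_derive_comp_real (f : R -> R) u x v a b :
  is_derive (u x) 1 f a -> is_derive x v u b -> is_derive x v (f \o u) (a * b).
Proof.
move=> fa /is_derive_lineP ub; apply/is_derive_lineP.
apply: (@is_derive1_comp _ f (fun h : R => u (h *: v + x))) => //.
by rewrite scale0r add0r.
Qed.

Lemma CkS k u : Ck k.+1 u -> Ck k u.
Proof.
elim: k u => [|k IH] u; first by case.
move=> [cu du]; split=> // i; have [di Di] := du i; split=> //; exact: IH.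
Qed.

Lemma eq_Ck k u w : u =1 w -> Ck k u -> Ck k w.
Proof. by move=> /funext ->. Qed.

Lemma smooth_continuous u : smooth u -> continuous u.
Proof. by move=> /(_ 0%N). Qed.

Lemma Ck_D k u w : Ck k u -> Ck k w -> Ck k (u \+ w).
Proof.
elim: k u w => [|k IH] u w.
  by move=> cu cw x; exact: (continuousD (cu x) (cw x)).
move=> [cu du] [cw dw]; split.
  by move=> x; exact: (continuousD (cu x) (cw x)).
move=> i; have [di Di] := du i; have [di' Di'] := dw i; split.
  by move=> x; exact: derivableD.
apply: eq_Ck (IH _ _ Di Di') => x /=.
by rewrite -(deriveD (di x) (di' x)).
Qed.

Lemma Ck_cst k (c : R) : Ck k (fun _ : 'rV[R]_n => c).
Proof.
elim: k c => [|k IH] c; first exact: cst_continuous.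
split; first exact: cst_continuous.
move=> i; split=> [x|]; first exact: derivable_cst.
by apply: eq_Ck (IH 0) => x; rewrite (derive_cst c).
Qed.

Lemma Ck_M k u w : Ck k u -> Ck k w -> Ck k (u \* w).
Proof.
elim: k u w => [|k IH] u w.
  by move=> cu cw x; exact: (continuousM (cu x) (cw x)).
move=> uS wS; have [cu du] := uS; have [cw dw] := wS; split.
  by move=> x; exact: (continuousM (cu x) (cw x)).
move=> i; have [di Di] := du i; have [di' Di'] := dw i; split.
  by move=> x; exact: derivableM.
apply: eq_Ck (Ck_D (IH _ _ (CkS uS) Di') (IH _ _ (CkS wS) Di)) => x /=.
by rewrite (deriveM (di x) (di' x)).
Qed.

Lemma smooth_D u w : smooth u -> smooth w -> smooth (u \+ w).
Proof. by move=> su sw k; exact: Ck_D. Qed.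
Lemma smooth_cst c : smooth (fun _ : 'rV[R]_n => c).
Proof. by move=> k; exact: Ck_cst. Qed.
Lemma smooth_M u w : smooth u -> smooth w -> smooth (u \* w).
Proof. by move=> su sw k; exact: Ck_M. Qed.

Lemma smooth_coord i : smooth (fun x : 'rV[R]_n => x ord0 i).
Proof.
have dE (x v : 'rV[R]_n) : is_derive x v (fun x : 'rV[R]_n => x ord0 i) (v ord0 i).
  apply/is_derive_lineP.
  rewrite (_ : (fun h : R => _) = (v ord0 i \*: (id : R -> R)) + cst (x ord0 i)); last first.
    by apply/funext => h; rewrite !mxE mulrC.
  by apply: is_derive_eq; rewrite addr0 [_%:A]mulr1.
case=> [|k]; first exact: coord_continuous.
split; first exact: coord_continuous.
move=> j; split=> [x|].
  by have [] := dE x (delta_mx ord0 j).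
apply: eq_Ck (Ck_cst k ((delta_mx ord0 j : 'rV[R]_n) ord0 i)) => x.
by have [_ ->] := dE x (delta_mx ord0 j).
Qed.

Lemma smooth_sum (I : Type) (r : seq I) (F : I -> 'rV[R]_n -> R) :
  (forall i, smooth (F i)) -> smooth (fun x => \sum_(i <- r) F i x).
Proof.
move=> sF; elim: r => [|i r IH].
  by move=> k; apply: eq_Ck (Ck_cst k 0) => x; rewrite big_nil.
move=> k; apply: eq_Ck (smooth_D (sF i) IH k) => x; by rewrite big_cons.
Qed.

Lemma smooth_sqr_enorm z : smooth (fun x : 'rV[R]_n => enorm (x - z) ^+ 2).
Proof.
move=> k; have s i : smooth (fun x : 'rV[R]_n => (x ord0 i - z ord0 i) ^+ 2).
  have h := smooth_D (smooth_coord i) (smooth_cst (- z ord0 i)).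
  by move=> j; apply: eq_Ck (smooth_M h h j) => x /=; rewrite expr2.
apply: eq_Ck (smooth_sum (index_enum 'I_n) s k) => x.
by rewrite sqr_enorm; apply: eq_bigr => i _; rewrite !mxE.
Qed.

End smooth_functions.

(** * A smooth step and radial cutoffs *)

Section flat_function.
Context {R : realType}.
Implicit Types t : R.

(** The functions [t^-j e^(-1/t)], extended by 0, form a family closed under
differentiation up to linear combinations ([is_derive_flat]).  Smoothness of all
compositions [flat j \o u] can thus be proved by one induction on the order, for all
[j] at once. *)
Definition flat j t : R := if 0 < t then t^-1 ^+ j * expR (- t^-1) else 0.

Lemma flat_ge0 j t : 0 <= flat j t.
Proof.
rewrite /flat; case: ifP => // t0.
by rewrite mulr_ge0 ?expR_ge0 // exprn_ge0 // invr_ge0 ltW.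
Qed.

(** [e^x >= x^j / j!] at [x = 1/t]. *)
Lemma flat_le j t : flat j t <= j`!%:R.
Proof.
rewrite /flat; case: ifP => // t0.
rewrite expRN ler_pdivrMr ?expR_gt0 //.
have ti : 0 <= t^-1 by rewrite invr_ge0 ltW.
case: j => [|j]; first by rewrite fact0 mul1r expr0 -expR0 ler_expR.
have := expR_ge1Dxn j ti; have f0 : 0 < (j.+1)`!%:R :> R by rewrite ltr0n fact_gt0.
move=> h; rewrite mulrC -ler_pdivrMr //; apply: le_trans h; lra.
Qed.

Lemma flat_mulr j t : flat j t = flat j.+1 t * t.
Proof.
rewrite /flat; case: ifP => t0; last by rewrite mul0r.
by rewrite exprS; field; rewrite gt_eqF.
Qed.

Lemma flat_le_norm j t : flat j t <= j.+1`!%:R * `|t|.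
Proof.
have [t0|t0] := ltP 0 t.
  by rewrite gtr0_norm // flat_mulr ler_pM2r // flat_le.
by rewrite {1}/flat ltNge t0 mulr_ge0.
Qed.

Lemma flat_cont0 j : {for 0, continuous (flat j)}.
Proof.
have E : flat j 0 = 0 by rewrite /flat ltxx.
apply/cvgrPdist_lt => /= e e0; rewrite E.
near=> t; rewrite sub0r normrN ger0_norm ?flat_ge0 //.
apply: le_lt_trans (flat_le_norm j t) _.
have f0 : 0 < (j.+1)`!%:R :> R by rewrite ltr0n fact_gt0.
rewrite mulrC -ltr_pdivlMr //.
near: t; apply/nbhs_ballP; exists (e / (j.+1)`!%:R) => /=; first exact: divr_gt0.
by move=> y; rewrite /ball /= sub0r normrN.
Unshelve. all: by end_near. Qed.

(** At 0 the difference quotient of [flat j] is [flat j.+1], which tends to 0. *)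
Lemma is_derive_flat j t : is_derive t 1 (flat j) (flat j.+2 t - j%:R * flat j.+1 t).
Proof.
have [t0|t0|<-] := ltgtP 0 t; last 2 first.
- rewrite (_ : _ - _ = 0); last by rewrite /flat ltNge (ltW t0) /= mulr0 subr0.
  apply: (@near_eq_is_derive _ _ _ (cst 0)).
  near=> y; rewrite /flat ifF //; apply/negbTE; rewrite -leNgt ltW //.
  near: y; exact: lt_nbhsl.
- apply/is_derive1_caratheodory; exists (flat j.+1); split.
  + by move=> z; rewrite subr0 -flat_mulr [X in _ - X]/flat ltxx subr0.
  + exact: flat_cont0.
  + by rewrite /flat ltxx mulr0 subr0.
have tn0 : t != 0 by rewrite gt_eqF.
have dV : is_derive t (1 : R) (fun y : R => y^-1) (- t ^- 2).
  by have := @is_deriveV R id t 1 1 tn0 (is_derive_id _ _); rewrite [_%:A]mulr1; exact.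
have dN : is_derive t (1 : R) (fun y : R => - y^-1) (t ^- 2).
  by have := is_deriveN dV; rewrite opprK; exact.
have dE : is_derive t (1 : R) (fun y : R => expR (- y^-1)) (expR (- t^-1) * (t ^- 2)).
  exact: (@is_derive1_comp _ expR (fun y : R => - y^-1) t _ _ (is_derive_expR (- t^-1)) dN).
have dX := @is_deriveX _ _ (fun y : R => y^-1) j t 1 _ dV.
have dF : is_derive t (1 : R) (fun y : R => (y^-1) ^+ j * expR (- y^-1))
    (flat j.+2 t - j%:R * flat j.+1 t); last first.
  apply: (near_eq_is_derive _ dF).
  near=> y; rewrite /flat ifT //; near: y; exact: lt_nbhsr.
rewrite (_ : (fun y => _) = (fun y : R => y^-1) ^+ j * (fun y => expR (- y^-1)));
  last by apply/funext => y; rewrite !fctE.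
apply: (is_derive_eq (is_deriveM dX dE)) => {dX}.
rewrite /flat t0 /GRing.scale /= !fctE.
rewrite -!exprVn; move: (expR (- t^-1)) (t^-1) => e r.
case: j => [|j] /=; last by rewrite !exprS; ring.
by rewrite !mul0r !mulr0 subr0 addr0 expr0 mul1r mulrC.
Unshelve. all: by end_near. Qed.
End flat_function.

Section step.
Context {R : realType}.
Implicit Types t : R.

Lemma flat_continuous j : continuous (@flat R j).
Proof.
move=> t; apply/differentiable_continuous/derivable1_diffP.
by have [] := is_derive_flat j t.
Qed.

(** The derivative of [flat 0] is [flat 2], which takes its values between 0 and 2. *)
Lemma flat0_MVT (a b : R) : a <= b -> 0 <= flat 0 b - flat 0 a <= 2 * (b - a).
Proof.
move=> ab.
have [c _ ->] : exists2 c, c \in `[a, b]%R & flat 0 b - flat 0 a = flat 2 c * (b - a).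
  apply: MVT_segment => // [x _|].
    by apply: (is_derive_eq (is_derive_flat 0 x)); rewrite mul0r subr0.
  exact/continuous_subspaceT/flat_continuous.
have ba : 0 <= b - a by rewrite subr_ge0.
by rewrite mulr_ge0 ?flat_ge0 //= ler_wpM2r // (flat_le 2 c).
Qed.

Lemma flat0_homo (a b : R) : a <= b -> flat 0 a <= flat 0 b.
Proof. by move=> /flat0_MVT /andP[]; rewrite subr_ge0. Qed.

Lemma flat0_lip (a b : R) : `|flat 0 a - flat 0 b| <= 2 * `|a - b|.
Proof.
wlog ab : a b / a <= b.
  move=> h; have [/h //|/ltW/h] := leP a b.
  by rewrite distrC [`|b - a|]distrC.
have /andP[h1 h2] := flat0_MVT ab.
by rewrite distrC ger0_norm // distrC ger0_norm // subr_ge0.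
Qed.

Lemma flat0_gt0 t : 0 < t -> 0 < flat 0 t.
Proof. by move=> t0; rewrite /flat t0 expr0 mul1r expR_gt0. Qed.

Lemma flat0_eq0 t : t <= 0 -> flat 0 t = 0.
Proof. by rewrite /flat ltNge => ->. Qed.

Definition step_max : R := flat 0 (flat 0 2^-1).

Lemma step_max_gt0 : 0 < step_max.
Proof. by rewrite /step_max flat0_gt0 // flat0_gt0 // invr_gt0. Qed.

(** A smooth nonincreasing step from 1 on [t <= 1/4] to 0 on [3/4 <= t], obtained from
[flat 0] alone: the inner difference is maximal exactly for [t <= 1/4] and is
nonpositive exactly for [3/4 <= t]. *)
Definition step t : R := step_max^-1 * flat 0 (flat 0 2^-1 - flat 0 (t - 4^-1)).

Lemma step_ge0 t : 0 <= step t.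
Proof. by rewrite /step mulr_ge0 ?flat_ge0 // invr_ge0 ltW // step_max_gt0. Qed.

Lemma step_le1 t : step t <= 1.
Proof.
rewrite /step mulrC ler_pdivrMr ?step_max_gt0 // mul1r /step_max.
by apply: flat0_homo; rewrite gerBl flat_ge0.
Qed.

Lemma step_eq1 t : t <= 4^-1 -> step t = 1.
Proof.
move=> t4; rewrite /step (@flat0_eq0 (t - _)) ?subr_le0 // subr0.
by rewrite mulVf // gt_eqF // step_max_gt0.
Qed.

Lemma step_eq0 t : 3 / 4 <= t -> step t = 0.
Proof.
move=> t4; rewrite /step flat0_eq0 ?mulr0 // subr_le0; apply: flat0_homo; lra.
Qed.

Definition step_lip : R := 4 / step_max.

Lemma step_lip_gt0 : 0 < step_lip.
Proof. by rewrite divr_gt0 // step_max_gt0. Qed.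

Lemma step_lipP (a b : R) : `|step a - step b| <= step_lip * `|a - b|.
Proof.
rewrite /step -mulrBr normrM gtr0_norm ?invr_gt0 ?step_max_gt0 // /step_lip.
rewrite [4 / _]mulrC -mulrA ler_pM2l ?invr_gt0 ?step_max_gt0 //.
apply: le_trans (flat0_lip _ _) _.
have -> : flat 0 2^-1 - flat 0 (a - 4^-1) - (flat 0 2^-1 - flat 0 (b - 4^-1)) = flat 0 (b - 4^-1) - flat 0 (a - 4^-1) by ring.
rewrite [4](_ : _ = 2 * 2); last by ring.
rewrite -mulrA ler_pM2l //; apply: le_trans (flat0_lip _ _) _.
by rewrite opprB addrA subrK distrC.
Qed.

End step.

Section cutoff.
Context {R : realType} {n : nat}.
Implicit Types u : 'rV[R]_n -> R.

Lemma smooth_flat j u : smooth u -> smooth (flat j \o u).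
Proof.
move=> su k; elim: k j => [|k IH] j.
  by move=> x; apply: continuous_comp; [exact: (su 0%N)|exact: flat_continuous].
have [cu du] := su k.+1; split.
  by move=> x; apply: continuous_comp; [exact: cu|exact: flat_continuous].
move=> i; have [di Di] := du i.
have dE x : is_derive x (delta_mx ord0 i) (flat j \o u)
    ((flat j.+2 (u x) - j%:R * flat j.+1 (u x)) * 'D_(delta_mx ord0 i) u x).
  by apply: is_derive_comp_real (is_derive_flat j (u x)) (derivableP (di x)).
split=> [x|]; first by have [] := dE x.
apply: eq_Ck (Ck_M (Ck_D (IH j.+2) (Ck_M (Ck_cst k (- j%:R)) (IH j.+1))) Di) => x.
by have [_ ->] := dE x; rewrite /= mulNr.
Qed.

Lemma smooth_step u : smooth u -> smooth (step \o u).
Proof.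
move=> su.
have h : smooth (fun x => u x - 4^-1) by exact: smooth_D su (smooth_cst _).
have h' : smooth (fun x => flat 0 2^-1 + (- 1) * flat 0 (u x - 4^-1)).
  exact: smooth_D (smooth_cst _) (smooth_M (smooth_cst _) (smooth_flat 0 h)).
have h3 := smooth_M (smooth_cst step_max^-1) (smooth_flat 0 h').
by move=> k; apply: eq_Ck (h3 k) => x /=; rewrite mulN1r.
Qed.

(** Built on the squared distance, which is smooth at the centre. *)
Definition cutoff (w : 'rV[R]_n) (d : R) (x : 'rV[R]_n) : R :=
  step ((d ^+ 2)^-1 * enorm (x - w) ^+ 2).

Lemma smooth_cutoff w d : smooth (cutoff w d).
Proof.
have := smooth_step (smooth_M (smooth_cst (d ^+ 2)^-1) (smooth_sqr_enorm w)).
by [].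
Qed.

Lemma cutoff_ge0 w d x : 0 <= cutoff w d x. Proof. exact: step_ge0. Qed.
Lemma cutoff_le1 w d x : cutoff w d x <= 1. Proof. exact: step_le1. Qed.

Lemma cutoff_eq1 w d x : 0 < d -> enorm (x - w) <= d / 2 -> cutoff w d x = 1.
Proof.
move=> d0 xw; apply: step_eq1; rewrite mulrC ler_pdivrMr ?exprn_gt0 //.
have := enorm_ge0 (x - w); nra.
Qed.

(** [(9/10)^2 > 3/4]; the margin keeps the support inside the open ball. *)
Lemma cutoff_eq0 w d x : 0 < d -> 9 / 10 * d <= enorm (x - w) -> cutoff w d x = 0.
Proof.
move=> d0 xw; apply: step_eq0; rewrite [leRHS]mulrC ler_pdivlMr ?exprn_gt0 //.
have := enorm_ge0 (x - w); nra.
Qed.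

Lemma supp_cutoff w d (x : 'rV[R]_n) : 0 < d -> supp (cutoff w d) x -> enorm (x - w) <= 9 / 10 * d.
Proof.
move=> d0 sx; apply: closure_eball_le.
move: x sx; apply: closureS => x /= bx; rewrite /eball /= ltNge; apply/negP => h.
by move: bx; rewrite cutoff_eq0 // eqxx.
Qed.

Lemma sqr_enormB (x y : 'rV[R]_n) :
  `|enorm x ^+ 2 - enorm y ^+ 2| <= enorm (x - y) * (enorm x + enorm y).
Proof.
have hx : enorm x <= enorm (x - y) + enorm y by have := enormD (x - y) y; rewrite subrK.
have hy : enorm y <= enorm (x - y) + enorm x.
  by have := enormD (y - x) x; rewrite subrK enormBC.
rewrite subr_sqr normrM (ger0_norm (addr_ge0 (enorm_ge0 x) (enorm_ge0 y))).
rewrite ler_wpM2r ?addr_ge0 ?enorm_ge0 // ler_norml; apply/andP; split; lra.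
Qed.

(** Differences of squared lengths factor.  The bound is of order [1/d] when [x] and [y]
are at a distance of order [d] from the centre. *)
Lemma cutoff_lip w d x y : 0 < d ->
  `|cutoff w d x - cutoff w d y| <=
  step_lip * (d ^+ 2)^-1 * (enorm (x - w) + enorm (y - w)) * enorm (x - y).
Proof.
move=> d0; apply: le_trans (step_lipP _ _) _.
rewrite -mulrBr normrM ger0_norm ?invr_ge0 ?exprn_ge0 ?(ltW d0) //.
have h := sqr_enormB (x - w) (y - w).
have E : x - w - (y - w) = x - y by rewrite opprB addrA subrK.
rewrite {}E in h.
have d2 : 0 <= (d ^+ 2)^-1 by rewrite invr_ge0 exprn_ge0 // ltW.
apply: le_trans (ler_wpM2l (ltW step_lip_gt0) (ler_wpM2l d2 h)) _.
by rewrite le_eqVlt; apply/orP; left; apply/eqP; ring.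
Qed.

Lemma test_cutoff_mul w d u (U : set 'rV[R]_n) : 0 < d -> smooth u ->
  supp (cutoff w d \* u) `<=` U -> test_function U (cutoff w d \* u).
Proof.
move=> d0 su sU; split => //; first exact: smooth_M (smooth_cutoff w d) su.
apply: (@bounded_closed_compact_enorm _ _ _ w (9 / 10 * d)); first exact: closed_closure.
move=> x sx; apply: (supp_cutoff d0); move: x sx; apply: closureS => x /=.
by apply: contra => /eqP ->; rewrite mul0r.
Qed.

Lemma supp_cutoff_mul w d u : 0 < d -> supp (cutoff w d \* u) `<=` eball w d.
Proof.
move=> d0 x sx; rewrite /eball /=.
apply: (@le_lt_trans _ _ (9 / 10 * d)); last by lra.
apply: (supp_cutoff d0); move: x sx; apply: closureS => x /=.
by apply: contra => /eqP ->; rewrite mul0r.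
Qed.
End cutoff.

(** * Integrals, powers and the Gagliardo kernel *)

Section integral_tools.
Local Open Scope ereal_scope.
Context d (T : measurableType d) (R : realType) (mu : {measure set T -> \bar R}).

(** The integral of a nonnegative function is a supremum over the simple functions below
it, whence its monotonicity for arbitrary functions. *)
Lemma ge0_le_integralW (D : set T) (f1 f2 : T -> \bar R) :
  (forall x, D x -> 0 <= f1 x) -> (forall x, D x -> f1 x <= f2 x) ->
  \int[mu]_(x in D) f1 x <= \int[mu]_(x in D) f2 x.
Proof.
move=> f10 f12; rewrite !(integral_mkcond D) !ge0_integralTE; last 2 first.
- by move=> x; apply: erestrict_ge0 => y Dy; apply: le_trans (f12 _ Dy); exact: f10.
- by move=> x; apply: erestrict_ge0.
apply: le_ereal_sup => _ [h hf <-]; exists h => // x.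
by apply: le_trans (hf x) _; exact: lee_restrict.
Qed.

Lemma ge0_subset_integralW (A B : set T) (f : T -> \bar R) :
  A `<=` B -> (forall x, B x -> 0 <= f x) ->
  \int[mu]_(x in A) f x <= \int[mu]_(x in B) f x.
Proof.
move=> AB f0; rewrite !(integral_mkcond _ f).
apply: ge0_le_integralW => x _.
  by apply: erestrict_ge0 => y Ay; exact/f0/AB.
rewrite /patch; case: ifPn => [/[!inE] /AB Bx|_]; first by rewrite mem_set.
by case: ifPn => // /[!inE] /f0.
Qed.

Lemma integral_le_cst (A : set T) (f : T -> \bar R) (c : R) :
  measurable A -> (forall x, A x -> 0 <= f x) ->
  (forall x, A x -> f x <= c%:E) -> \int[mu]_(x in A) f x <= c%:E * mu A.
Proof.
move=> mA f0 fc; rewrite -integral_cst //.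
exact: ge0_le_integralW.
Qed.

Lemma integral_ge_cst (A : set T) (f : T -> \bar R) (c : R) : (0 <= c)%R ->
  measurable A -> (forall x, A x -> c%:E <= f x) -> c%:E * mu A <= \int[mu]_(x in A) f x.
Proof.
move=> c0 mA fc; rewrite -integral_cst //.
exact: ge0_le_integralW.
Qed.

End integral_tools.

Section geometric.
Context {R : realType}.
Lemma geometric_partial (z : R) k : 0 <= z < 1 -> \sum_(0 <= i < k) z ^+ i <= (1 - z)^-1.
Proof.
move=> /andP[z0 z1]; have z1' : 0 < 1 - z by rewrite subr_gt0.
rewrite -[leRHS]mul1r ler_pdivlMr //.
have -> : (\sum_(0 <= i < k) z ^+ i) * (1 - z) = 1 - z ^+ k.
  elim: k => [|k IH]; first by rewrite big_geq // mul0r expr0 subrr.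
  by rewrite big_nat_recr //= mulrDl IH exprS; ring.
by rewrite gerBl exprn_ge0.
Qed.

Lemma geometric_nneseries (C z : R) : 0 <= C -> 0 <= z < 1 ->
  (\sum_(0 <= i <oo) (C * z ^+ i)%:E <= (C / (1 - z))%:E)%E.
Proof.
move=> C0 z01; have /andP[z0 z1] := z01; apply: lime_le.
  by apply: is_cvg_nneseries => i _ _; rewrite lee_fin mulr_ge0 // exprn_ge0.
apply: nearW => k; rewrite sumEFin lee_fin -mulr_sumr ler_wpM2l //.
exact: geometric_partial.
Qed.
End geometric.

Section powR_tools.
Context {R : realType}.
Implicit Types a b p : R.

Lemma powR_add_le a b p : 0 <= a -> 0 <= b -> 0 <= p ->
  (a + b) `^ p <= 2 `^ p * (a `^ p + b `^ p).
Proof.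
wlog ab : a b / a <= b.
  move=> h a0 b0 p0; have [/h|/ltW/h] := leP a b; first exact.
  by rewrite addrC [a `^ p + _]addrC; exact.
move=> a0 b0 p0; apply: (@le_trans _ _ ((2 * b) `^ p)).
  by apply: ge0_ler_powR; rewrite ?nnegrE ?addr_ge0 ?mulr_ge0 //; lra.
by rewrite powRM // ler_wpM2l ?powR_ge0 // lerDr powR_ge0.
Qed.

Lemma powR_le a b p : 0 <= p -> 0 <= a -> a <= b -> a `^ p <= b `^ p.
Proof. by move=> p0 a0 ab; apply: ge0_ler_powR; rewrite ?nnegrE // (le_trans a0). Qed.

Lemma powRK a p : 0 <= a -> p != 0 -> (a `^ p) `^ p^-1 = a.
Proof. by move=> a0 p0; rewrite -powRrM mulfV // powRr1. Qed.

Lemma powRVK a p : 0 <= a -> p != 0 -> (a `^ p^-1) `^ p = a.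
Proof. by move=> a0 p0; rewrite -powRrM mulVf // powRr1. Qed.

Lemma powR_half_lt1 a : 0 < a -> 0 < (2^-1 : R) `^ a < 1.
Proof.
move=> a0; rewrite powR_gt0 ?invr_gt0 //=.
have h : (2^-1 : R) < 1 by lra.
have := gt0_ltr_powR a0 _ _ h; rewrite powR1 !nnegrE; apply; lra.
Qed.
End powR_tools.

Section kernel.
Context {R : realType} {n : nat}.
Variables (s p : R).
Hypotheses (n_gt0 : (0 < n)%N) (s_gt0 : 0 < s) (s_lt1 : s < 1) (p_gt1 : 1 < p).
Implicit Types (u v w : 'rV[R]_n -> R) (x y z : 'rV[R]_n).
Local Notation mu := (@lebesgue_rV R n).

Let a : R := n%:R + s * p.
Let p_gt0 : 0 < p. Proof. by apply: lt_trans p_gt1. Qed.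
Let p_ge0 : 0 <= p. Proof. exact: ltW. Qed.
Let sp_gt0 : 0 < s * p. Proof. exact: mulr_gt0. Qed.
Let a_gt0 : 0 < a. Proof. by rewrite ltr_wpDl. Qed.

Definition gker u x y : R := `|u x - u y| `^ p / enorm (x - y) `^ (n%:R + s * p).

Lemma gagliardoE (U : set 'rV[R]_n) u : gagliardo s p U u =
  (\int[mu]_(x in U) \int[mu]_(y in U) (gker u x y)%:E)%E.
Proof. by []. Qed.

Lemma gker_ge0 u x y : 0 <= gker u x y.
Proof. by rewrite divr_ge0 ?powR_ge0. Qed.

Lemma gagliardo_ge0 U u : (0 <= gagliardo s p U u)%E.
Proof.
apply: integral_ge0 => x _; apply: integral_ge0 => y _.
by rewrite lee_fin; exact: gker_ge0.
Qed.

Lemma measurable_gker u : continuous u ->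
  measurable_fun setT (fun xy : 'rV[R]_n * 'rV[R]_n => gker u xy.1 xy.2).
Proof.
move=> cu; rewrite /gker; under eq_fun do rewrite -powRN.
have mu1 : measurable_fun setT (fun xy : 'rV[R]_n * 'rV[R]_n => u xy.1).
  exact: (measurableT_comp (measurable_cont cu) measurable_fst).
have mu2 : measurable_fun setT (fun xy : 'rV[R]_n * 'rV[R]_n => u xy.2).
  exact: (measurableT_comp (measurable_cont cu) measurable_snd).
apply: measurable_funM.
  apply: (measurableT_comp (@measurable_powR R p)).
  apply: (measurableT_comp (@normr_measurable R setT)).
  exact: measurable_funB.
apply: (measurableT_comp (@measurable_powR R _)).
apply: (measurableT_comp (measurable_cont (@enorm_continuous R n))).
apply: measurable_rVP => i; under eq_fun do rewrite !mxE.
apply: measurable_funB.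
  exact: (measurableT_comp (measurable_rV_coord i) measurable_fst).
exact: (measurableT_comp (measurable_rV_coord i) measurable_snd).
Qed.

Definition gint (B : set 'rV[R]_n) u x : \bar R := (\int[mu]_(y in B) (gker u x y)%:E)%E.

Lemma gint_ge0 B u x : (0 <= gint B u x)%E.
Proof. by apply: integral_ge0 => y _; rewrite lee_fin gker_ge0. Qed.

Lemma measurable_gint B u : measurable B -> continuous u ->
  measurable_fun setT (gint B u).
Proof.
move=> mB cu; rewrite /gint; under eq_fun do rewrite integral_mkcond.
pose f := (fun xy : 'rV[R]_n * 'rV[R]_n => (gker u xy.1 xy.2)%:E) \_ (setT `*` B).
rewrite (_ : (fun x => _) = (fun x => \int[mu]_y f (x, y))%E); last first.
  apply/funext => x; apply: eq_integral => y _; rewrite /f /patch.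
  by congr (if _ then _ else _); apply/idP/idP; rewrite !inE //= => -[].
apply: measurable_int_rV.
  apply/(measurable_restrictT _ (measurableX measurableT mB)).
  apply: measurable_funTS; apply/measurable_EFinP; exact: measurable_gker.
by move=> xy; apply: erestrict_ge0 => ? _; rewrite lee_fin gker_ge0.
Qed.

Lemma measurable_gker_r u x : continuous u -> measurable_fun setT (fun y => gker u x y).
Proof.
move=> cu; exact: (measurableT_comp (measurable_gker cu) (pair1_measurable x)).
Qed.

Let alpha : R := p - s * p.
Let alpha_gt0 : 0 < alpha.
Proof. by rewrite /alpha -{1}[p]mul1r -mulrBl mulr_gt0 // subr_gt0. Qed.

Definition ker_const : R := 2 `^ (n%:R + s * p) * 2 ^+ n / (1 - 2^-1 `^ (p - s * p)).

Lemma ker_const_gt0 : 0 < ker_const.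
Proof.
have /andP[_ h] := powR_half_lt1 alpha_gt0.
by rewrite divr_gt0 ?mulr_gt0 ?powR_gt0 ?exprn_gt0 // subr_gt0.
Qed.

(** The integrand is [|x - y|^(p - s p - n)], integrable at [x] since [s < 1].  On the
annulus of radii [2^-(k+1) rho] and [2^-k rho] it is at most a constant times
[(2^-k rho)^(p - s p - n)], and the ball of radius [2^-k rho] has volume at most
[(2^-k 2 rho)^n]: a geometric series of ratio [2^(s p - p)] remains. *)
Lemma kernel_integral x (rho : R) : 0 < rho ->
  (\int[mu]_(y in eball x rho) (enorm (x - y) `^ p / enorm (x - y) `^ (n%:R + s * p))%:E
   <= (ker_const * rho `^ (p - s * p))%:E)%E.
Proof.
move=> rho0.
pose r k : R := 2^-1 ^+ k * rho.
have r0 k : 0 < r k by rewrite mulr_gt0 // exprn_gt0 // invr_gt0.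
pose c k := r k `^ p / (r k / 2) `^ a.
have c0 k : 0 <= c k by rewrite divr_ge0 ?powR_ge0.
pose f k y : \bar R := (c k * \1_(eball x (r k)) y)%:E.
have f0 k y : (0 <= f k y)%E by rewrite lee_fin mulr_ge0 // indicE.
have mf k : measurable_fun setT (f k).
  apply/measurable_EFinP; apply: measurable_funM; first exact: measurable_cst.
  by apply: measurable_indic; exact: measurable_eball.
(* Each [f k] dominates the integrand on the [k]-th annulus. *)
apply: (@le_trans _ _ (\int[mu]_y \sum_(0 <= k <oo) f k y)%E).
  rewrite integral_mkcond; apply: ge0_le_integralW => y _.
    by apply: erestrict_ge0 => z _; rewrite lee_fin divr_ge0 ?powR_ge0.
  rewrite /patch; case: ifPn => [|_]; last by apply: nneseries_ge0.
  rewrite inE /eball /= => yx; set e := enorm (x - y).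
  have e_lt : e < rho by rewrite /e enormBC.
  have [e0|en0] := eqVneq e 0.
    by rewrite e0 powR0 ?gt_eqF // mul0r; apply: nneseries_ge0.
  have e0 : 0 < e by rewrite lt_neqAle eq_sym en0 enorm_ge0.
  (* The dyadic annulus that contains [y]. *)
  have [k /andP[ek ke]] : exists k, r k / 2 <= e < r k.
    have h : exists k, r k <= e.
      exists (Num.truncn (rho / e)).+1; rewrite /r exprVn mulrC ler_pdivrMr ?exprn_gt0 //.
      rewrite mulrC -ler_pdivrMr //; apply: ltW; apply: (lt_trans (truncnS_gt _)).
      by rewrite -natrX ltr_nat ltn_expl.
    case: (ex_minnP h) => -[|k] hk hmin.
      by move: hk; rewrite /r expr0 mul1r leNgt e_lt.
    exists k; apply/andP; split.
      by apply: le_trans hk; rewrite /r exprS; lra.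
    by rewrite ltNge; apply/negP => /hmin; rewrite ltnn.
  apply: (@le_trans _ _ (f k y)).
    rewrite /f indicE mem_set; last by rewrite /eball /= enormBC.
    rewrite mulr1 lee_fin /c ler_pM ?invr_ge0 ?powR_ge0 //.
      by apply: powR_le => //; [exact: enorm_ge0|exact: ltW].
    rewrite lef_pV2 ?posrE ?powR_gt0 ?divr_gt0 //.
    by apply: powR_le => //; [exact: ltW|rewrite divr_ge0 // ltW].
  apply: le_trans (nneseries_lim_ge k.+1 _); last by [].
  rewrite big_nat_recr //=; apply: leeDr; exact: sume_ge0.
rewrite integral_nneseries //.
apply: (@le_trans _ _ (\sum_(0 <= k <oo)
   (2 `^ a * 2 ^+ n * rho `^ alpha * (2^-1 `^ alpha) ^+ k)%:E)%E).
  apply: lee_nneseries => [k _ _|k _]; first by apply: integral_ge0.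
  rewrite /f; under eq_integral do rewrite EFinM.
  rewrite ge0_integralZl ?lee_fin //; last first.
    by apply/measurable_EFinP; apply: measurable_indic; exact: measurable_eball.
  rewrite integral_indic ?setIT; [|exact: measurableT|exact: measurable_eball].
  apply: (@le_trans _ _ ((c k)%:E * ((2 * r k) ^+ n)%:E)%E).
    by rewrite lee_wpmul2l ?lee_fin // lebesgue_eball_le // ltW.
  rewrite -EFinM lee_fin le_eqVlt; apply/orP; left; apply/eqP.
  have rk0 : 0 <= r k by exact: ltW.
  have E1 : (r k / 2) `^ a = r k `^ a / 2 `^ a.
    rewrite powRM ?invr_ge0 //; congr (_ * _).
    by rewrite -(powR_inv1 (ler0n R 2)) powRAC powR_inv1 // powR_ge0.
  have E2 : r k `^ p * r k ^+ n = r k `^ alpha * r k `^ a.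
    rewrite -(powR_mulrn n rk0) -!powRD ?(gt_eqF (r0 k)) ?implybT //.
    by congr (_ `^ _); rewrite /alpha /a; ring.
  have E3 : r k `^ alpha = rho `^ alpha * (2^-1 `^ alpha) ^+ k.
    rewrite /r powRM ?exprn_ge0 ?invr_ge0 ?(ltW rho0) // mulrC; congr (_ * _).
    have half0 : 0 <= 2^-1 :> R by rewrite invr_ge0.
    by rewrite -(powR_mulrn k half0) powRAC powR_mulrn // powR_ge0.
  rewrite /c E1 exprMn invf_div.
  transitivity (2 `^ a * 2 ^+ n * (r k `^ p * r k ^+ n) / r k `^ a); first by ring.
  rewrite E2 E3; field; rewrite gt_eqF // powR_gt0 //.
rewrite /ker_const -/a -/alpha.
have /andP[h1 h2] := powR_half_lt1 alpha_gt0.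
apply: le_trans (geometric_nneseries _ _) _.
- by rewrite !mulr_ge0 ?powR_ge0 ?exprn_ge0.
- by rewrite (ltW h1).
rewrite lee_fin le_eqVlt; apply/orP; left; apply/eqP; ring.
Qed.
End kernel.

(** * The seminorm of composed and truncated functions *)

Section seminorm.
Context {R : realType} {n : nat}.
Variables (s p : R).
Hypotheses (n_gt0 : (0 < n)%N) (s_gt0 : 0 < s) (s_lt1 : s < 1) (p_gt1 : 1 < p).
Implicit Types (u v w eta : 'rV[R]_n -> R) (x y z : 'rV[R]_n).
Local Notation mu := (@lebesgue_rV R n).
Local Notation gker := (gker s p).
Local Notation gint := (gint s p).

Let a : R := n%:R + s * p.
Let p_gt0 : 0 < p. Proof. by apply: lt_trans p_gt1. Qed.
Let p_ge0 : 0 <= p. Proof. exact: ltW. Qed.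

Lemma gagliardo_sub (A B : set 'rV[R]_n) u :
  A `<=` B -> (gagliardo s p A u <= gagliardo s p B u)%E.
Proof.
move=> AB; rewrite !gagliardoE.
apply: (@le_trans _ _ (\int[mu]_(x in B) \int[mu]_(y in A) (gker u x y)%:E)%E).
  by apply: ge0_subset_integralW => // x _; exact: gint_ge0.
apply: ge0_le_integralW => x _; first exact: gint_ge0.
by apply: ge0_subset_integralW => // y _; rewrite lee_fin gker_ge0.
Qed.

Lemma eq_gagliardo (B : set 'rV[R]_n) u v :
  (forall x, B x -> u x = v x) -> gagliardo s p B u = gagliardo s p B v.
Proof.
move=> uv; rewrite !gagliardoE; apply: eq_integral => x /[!inE] Bx.
by apply: eq_integral => y /[!inE] By; rewrite /gker !uv.
Qed.

Lemma gagliardo_comp (phi : R -> R) (L : R) (B : set 'rV[R]_n) u :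
  measurable B -> continuous u -> 0 <= L ->
  (forall t t', `|phi t - phi t'| <= L * `|t - t'|) ->
  (gagliardo s p B (phi \o u) <= (L `^ p)%:E * gagliardo s p B u)%E.
Proof.
move=> mB cu L0 phiL; rewrite !gagliardoE -ge0_integralZl ?lee_fin ?powR_ge0 //; last first.
- by move=> x _; exact: gint_ge0.
- by apply: measurable_funTS; exact: measurable_gint.
apply: ge0_le_integralW => x _; first exact: gint_ge0.
rewrite -ge0_integralZl ?lee_fin ?powR_ge0 //; last first.
- by move=> y _; rewrite lee_fin gker_ge0.
- by apply: measurable_funTS; apply/measurable_EFinP; exact: measurable_gker_r.
apply: ge0_le_integralW => y _; first by rewrite lee_fin gker_ge0.
rewrite -EFinM lee_fin /gker mulrA ler_wpM2r ?invr_ge0 ?powR_ge0 //.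
by rewrite -powRM //; apply: powR_le => //; exact: phiL.
Qed.

Lemma measurable_enorm_sub x : measurable_fun setT (fun y : 'rV[R]_n => enorm (x - y)).
Proof.
rewrite (_ : (fun y => _) = (fun y => enorm (y - x))); last first.
  by apply/funext => y; rewrite enormBC.
by apply: measurable_cont; exact: enormB_continuous.
Qed.

(** Against a Lipschitz function the kernel is bounded by the one of [kernel_integral],
on the ball of radius [2 r] centred at [x]. *)
Lemma gint_lip z r L eta x : 0 < r -> 0 <= L -> eball z r x ->
  (forall y, eball z r y -> `|eta x - eta y| <= L * enorm (x - y)) ->
  (gint (eball z r) eta x <= (L `^ p * (ker_const (n := n) s p * (2 * r) `^ (p - s * p)))%:E)%E.
Proof.
move=> r0 L0 Bx hL.
rewrite EFinM; apply: le_trans (lee_wpmul2l _ (kernel_integral s_gt0 s_lt1 p_gt1 x _));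
  rewrite ?lee_fin ?powR_ge0 ?mulr_gt0 //.
rewrite -ge0_integralZl ?lee_fin ?powR_ge0 //; last 3 first.
- exact: measurable_eball.
- apply: measurable_funTS; apply/measurable_EFinP; under eq_fun do rewrite -powRN.
  by apply: measurable_funM; apply: (measurableT_comp (@measurable_powR R _));
    exact: measurable_enorm_sub.
- by move=> y _; rewrite lee_fin divr_ge0 ?powR_ge0.
apply: (@le_trans _ _ (\int[mu]_(y in eball z r) ((L `^ p)%:E *
    (enorm (x - y) `^ p / enorm (x - y) `^ (n%:R + s * p))%:E))%E); last first.
  apply: ge0_subset_integralW.
    by apply: sub_eball; move: Bx; rewrite /eball /= [enorm (z - x)]enormBC => Bx; lra.
  by move=> y _; rewrite -EFinM lee_fin mulr_ge0 ?divr_ge0 ?powR_ge0.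
apply: ge0_le_integralW => y By; first by rewrite lee_fin gker_ge0.
rewrite -EFinM lee_fin /gker mulrA ler_wpM2r ?invr_ge0 ?powR_ge0 //.
by rewrite -powRM ?enorm_ge0 //; apply: powR_le => //; exact: hL.
Qed.

Lemma gagliardo_lip z r L eta : 0 < r -> 0 <= L ->
  (forall x y, eball z r x -> eball z r y -> `|eta x - eta y| <= L * enorm (x - y)) ->
  (gagliardo s p (eball z r) eta <=
   (L `^ p * (ker_const (n := n) s p * (2 * r) `^ (p - s * p)) * (2 * r) ^+ n)%:E)%E.
Proof.
move=> r0 L0 hL; rewrite gagliardoE EFinM; set C := L `^ p * _.
have C0 : 0 <= C by rewrite mulr_ge0 ?powR_ge0 // mulr_ge0 ?powR_ge0 // ltW // ker_const_gt0.
apply: (@le_trans _ _ (C%:E * mu (eball z r))%E); last first.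
  by rewrite lee_wpmul2l ?lebesgue_eball_le ?(ltW r0) // lee_fin.
apply: (@integral_le_cst _ _ _ mu _ (gint (eball z r) eta)).
- exact: measurable_eball.
- by move=> x _; exact: gint_ge0.
- by move=> x Bx; apply: (gint_lip r0 L0 Bx) => y By; exact: hL.
Qed.

(** [eta x w x - eta y w y = (w x - w y) eta y + w x (eta x - eta y)]. *)
Lemma gker_mul eta w x y : `|eta y| <= 1 ->
  gker (eta \* w) x y <= 2 `^ p * (gker w x y + `|w x| `^ p * gker eta x y).
Proof.
move=> e1; rewrite /gker /= [`|w x| `^ p * _]mulrA -mulrDl mulrA.
rewrite ler_wpM2r ?invr_ge0 ?powR_ge0 //.
apply: (@le_trans _ _ ((`|w x - w y| + `|w x| * `|eta x - eta y|) `^ p)).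
  apply: powR_le => //.
  have -> : eta x * w x - eta y * w y = (w x - w y) * eta y + w x * (eta x - eta y) by ring.
  apply: le_trans (ler_normD _ _) _; rewrite !normrM lerD2r ler_piMr //.
by apply: le_trans (powR_add_le _ _ _) _; rewrite ?mulr_ge0 // powRM.
Qed.

Lemma gagliardo_mul z r L eta w : 0 < r -> 0 <= L -> continuous eta -> continuous w ->
  (forall x, `|eta x| <= 1) ->
  (forall x y, eball z r x -> eball z r y -> `|eta x - eta y| <= L * enorm (x - y)) ->
  (gagliardo s p (eball z r) (eta \* w)%R <= (2 `^ p)%:E *
   (gagliardo s p (eball z r) w + (L `^ p * (ker_const (n := n) s p * (2 * r) `^ (p - s * p)))%:E *
     \int[mu]_(x in eball z r) (`|w x| `^ p)%:E))%E.
Proof.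
move=> r0 L0 ce cw e1 hL; set B := eball z r; set C := L `^ p * _.
have C0 : 0 <= C by rewrite mulr_ge0 ?powR_ge0 // mulr_ge0 ?powR_ge0 // ltW // ker_const_gt0.
have mB : measurable B by exact: measurable_eball.
have mw : measurable_fun B (fun x => (`|w x| `^ p)%:E).
  apply: measurable_funTS; apply/measurable_EFinP.
  apply: (measurableT_comp (@measurable_powR R _)).
  exact: (measurableT_comp (@normr_measurable R setT) (measurable_cont cw)).
have mwC : measurable_fun B (fun x => C%:E * (`|w x| `^ p)%:E)%E.
  exact: measurable_funeM.
have mg : measurable_fun B (gint B w) by apply: measurable_funTS; exact: measurable_gint.
rewrite !gagliardoE -ge0_integralZl ?lee_fin //.
rewrite -ge0_integralD //; last 2 first.
- by move=> x _; exact: gint_ge0.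
- by move=> x _; rewrite -EFinM lee_fin mulr_ge0 ?powR_ge0.
rewrite -ge0_integralZl ?lee_fin ?powR_ge0 //; last 2 first.
- exact: emeasurable_funD.
- by move=> x _; rewrite adde_ge0 ?gint_ge0 // -EFinM lee_fin mulr_ge0 ?powR_ge0.
apply: ge0_le_integralW => x Bx; first exact: gint_ge0.
have mk u : continuous u -> measurable_fun B (fun y => (gker u x y)%:E).
  by move=> cu; apply: measurable_funTS; apply/measurable_EFinP; exact: measurable_gker_r.
apply: (@le_trans _ _ ((2 `^ p)%:E * (gint B w x + (`|w x| `^ p)%:E * gint B eta x))%E); last first.
  rewrite lee_wpmul2l ?lee_fin ?powR_ge0 // leeD2l // muleC lee_wpmul2r ?lee_fin ?powR_ge0 //.
  by apply: (gint_lip r0 L0 Bx) => y By; exact: hL.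
rewrite /gint -ge0_integralZl ?lee_fin ?powR_ge0 //; last 2 first.
- exact: mk.
- by move=> y _; rewrite lee_fin gker_ge0.
rewrite -ge0_integralD //; last 4 first.
- by move=> y _; rewrite lee_fin gker_ge0.
- exact: mk.
- by move=> y _; rewrite -EFinM lee_fin mulr_ge0 ?powR_ge0 ?gker_ge0.
- apply: measurable_funeM; exact: mk.
rewrite -ge0_integralZl ?lee_fin ?powR_ge0 //; last 2 first.
- by apply: emeasurable_funD; [exact: mk|apply: measurable_funeM; exact: mk].
  by move=> y _; rewrite -EFinM -EFinD lee_fin addr_ge0 ?gker_ge0 // mulr_ge0 ?powR_ge0 ?gker_ge0.
apply: ge0_le_integralW => y By; first by rewrite lee_fin gker_ge0.
by rewrite -EFinM lee_fin; exact: gker_mul.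
Qed.

End seminorm.

(** * Good points *)

Section good_points.
Local Open Scope ereal_scope.
Context d (T : measurableType d) (R : realType) (mu : {measure set T -> \bar R}).

(** Chebyshev's inequality for three functions at once: if the claim failed everywhere,
the sum of the [f_i / a_i] would be at least [4 / m] on [A], and its integral would
exceed 3. *)
Lemma good_point3 (A : set T) (m a1 a2 a3 : R) (f1 f2 f3 : T -> \bar R) :
  measurable A -> (0 < m)%R -> m%:E <= mu A ->
  (0 < a1)%R -> (0 < a2)%R -> (0 < a3)%R ->
  measurable_fun A f1 -> measurable_fun A f2 -> measurable_fun A f3 ->
  (forall x, 0 <= f1 x) -> (forall x, 0 <= f2 x) -> (forall x, 0 <= f3 x) ->
  \int[mu]_(x in A) f1 x <= a1%:E -> \int[mu]_(x in A) f2 x <= a2%:E ->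
  \int[mu]_(x in A) f3 x <= a3%:E ->
  exists2 y, A y & [/\ f1 y <= (4 * a1 / m)%:E, f2 y <= (4 * a2 / m)%:E
    & f3 y <= (4 * a3 / m)%:E].
Proof.
move=> mA m0 mmu a10 a20 a30 mf1 mf2 mf3 f10 f20 f30 I1 I2 I3.
apply: contrapT => H.
pose F x := (a1^-1)%:E * f1 x + ((a2^-1)%:E * f2 x + (a3^-1)%:E * f3 x).
have sc (b : R) (f : T -> \bar R) (b0 : (0 < b)%R) (f0 : forall x, 0 <= f x) x :
    0 <= (b^-1)%:E * f x by rewrite mule_ge0 // lee_fin invr_ge0 ltW.
have big (b : R) (f : T -> \bar R) x : (0 < b)%R -> ~~ (f x <= (4 * b / m)%:E) ->
    (4 / m)%:E <= (b^-1)%:E * f x.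
  move=> b0; rewrite -ltNge => h.
  have -> : (4 / m)%:E = (b^-1)%:E * (4 * b / m)%:E.
    by rewrite -EFinM; congr EFin; field; rewrite !gt_eqF.
  by rewrite lee_wpmul2l ?lee_fin ?invr_ge0 1?ltW.
have FA x : A x -> (4 / m)%:E <= F x.
  move=> Ax; rewrite leNgt; apply/negP => Fx; apply: H; exists x => //.
  split; rewrite leNgt; apply/negP => h; move: Fx; rewrite ltNge => /negP; apply.
  - by apply: le_trans (big a1 f1 x a10 _) _; rewrite -?ltNge // leeDl // adde_ge0 ?sc.
  - apply: le_trans (big a2 f2 x a20 _) _; rewrite -?ltNge //.
    apply: (@le_trans _ _ ((a2^-1)%:E * f2 x + (a3^-1)%:E * f3 x)).
      by rewrite leeDl ?sc.
    by rewrite /F leeDr ?sc.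
  - apply: le_trans (big a3 f3 x a30 _) _; rewrite -?ltNge //.
    apply: (@le_trans _ _ ((a2^-1)%:E * f2 x + (a3^-1)%:E * f3 x)).
      by rewrite leeDr ?sc.
    by rewrite /F leeDr ?sc.
have I (b : R) (f : T -> \bar R) : (0 < b)%R -> (forall x, 0 <= f x) -> measurable_fun A f ->
    \int[mu]_(x in A) f x <= b%:E -> \int[mu]_(x in A) ((b^-1)%:E * f x) <= 1.
  move=> b0 f0 mf If; rewrite ge0_integralZl ?lee_fin ?invr_ge0 ?(ltW b0) //.
  apply: le_trans (lee_wpmul2l _ If) _; first by rewrite lee_fin invr_ge0 ltW.
  by rewrite -EFinM mulVf // gt_eqF.
have : \int[mu]_(x in A) F x <= 3%:E.
  rewrite ge0_integralD //; last 4 first.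
  - by move=> x _; exact: sc.
  - exact: measurable_funeM.
  - by move=> x _; rewrite adde_ge0 ?sc.
  - by apply: emeasurable_funD; exact: measurable_funeM.
  rewrite ge0_integralD //; last 4 first.
  - by move=> x _; exact: sc.
  - exact: measurable_funeM.
  - by move=> x _; exact: sc.
  - exact: measurable_funeM.
  have -> : 3%:E = 1 + (1 + 1) :> \bar R by rewrite -!EFinD; congr EFin; ring.
  by rewrite leeD ?leeD ?I.
have : (4 / m)%:E * mu A <= \int[mu]_(x in A) F x.
  by apply: integral_ge_cst => //; rewrite divr_ge0 // ltW.
move=> h1 h2; have := le_trans h1 h2.
have : (4 / m)%:E * m%:E <= (4 / m)%:E * mu A.
  by rewrite lee_wpmul2l // lee_fin divr_ge0 // ltW.
move=> h3 h4; have := le_trans h3 h4.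
by rewrite -EFinM lee_fin divfK ?gt_eqF // => ?; lra.
Qed.

End good_points.

Section good_point_seq.
Local Open Scope ereal_scope.
Context d (T : measurableType d) (R : realType) (mu : {measure set T -> \bar R}).

(** Chebyshev's inequality for countably many functions at once: the weights [z^k] make
the sum of the normalised functions integrable, at the price of a loss [z^-k]. *)
Lemma good_point_seq (A : set T) (m z : R) (a : nat -> R) (f : nat -> T -> \bar R) :
  measurable A -> (0 < m)%R -> m%:E <= mu A -> (0 < z < 1)%R ->
  (forall k, 0 < a k)%R -> (forall k, measurable_fun A (f k)) ->
  (forall k x, 0 <= f k x) -> (forall k, \int[mu]_(x in A) f k x <= (a k)%:E) ->
  exists2 y, A y & forall k, f k y <= (2 * a k / ((1 - z) * z ^+ k * m))%:E.
Proof.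
move=> mA m0 mmu /andP[z0 z1] a0 mf f0 If; apply: contrapT => H.
pose c k : R := (z ^+ k / a k)%R.
have c0 k : (0 <= c k)%R by rewrite divr_ge0 ?exprn_ge0 ?ltW.
pose F x := \sum_(0 <= k <oo) (c k)%:E * f k x.
have cf0 k x : 0 <= (c k)%:E * f k x by rewrite mule_ge0 // lee_fin.
have z1' : (0 < 1 - z)%R by rewrite subr_gt0.
have FA x : A x -> (2 / ((1 - z) * m))%:E <= F x.
  move=> Ax; have [k hk] : exists k, ~ (f k x <= (2 * a k / ((1 - z) * z ^+ k * m))%:E).
    by apply: contrapT => h; apply: H; exists x => // k; apply: contrapT => h'; apply: h; exists k.
  have {hk} : (2 * a k / ((1 - z) * z ^+ k * m))%:E <= f k x.
    by rewrite leNgt; apply/negP => h; apply: hk; exact: ltW.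
  move=> hk; apply: (@le_trans _ _ ((c k)%:E * f k x)).
    apply: le_trans (lee_wpmul2l _ hk); last by rewrite lee_fin.
    rewrite -EFinM lee_fin le_eqVlt; apply/orP; left; apply/eqP.
    have zk : (z ^+ k != 0)%R by rewrite expf_neq0 // gt_eqF.
    by rewrite /c; field; rewrite zk !gt_eqF.
  apply: le_trans (nneseries_lim_ge k.+1 _); last by [].
  by rewrite big_nat_recr //= leeDr // sume_ge0.
have : \int[mu]_(x in A) F x <= ((1 - z)^-1)%:E.
  rewrite integral_nneseries //; last first.
    by move=> k; exact: measurable_funeM.
  rewrite -[(1 - z)^-1%R]mul1r.
  apply: le_trans (geometric_nneseries ler01 _); last by rewrite (ltW z0).
  apply: lee_nneseries => [k _ _|k _]; first by apply: integral_ge0.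
  rewrite ge0_integralZl ?lee_fin // mul1r.
  apply: le_trans (lee_wpmul2l _ (If k)) _; first by rewrite lee_fin.
  by rewrite -EFinM lee_fin divfK // gt_eqF.
have : (2 / ((1 - z) * m))%:E * mu A <= \int[mu]_(x in A) F x.
  by apply: integral_ge_cst => //; rewrite divr_ge0 // ltW // mulr_gt0.
move=> h1 h2; have := le_trans h1 h2.
have : (2 / ((1 - z) * m))%:E * m%:E <= (2 / ((1 - z) * m))%:E * mu A.
  by rewrite lee_wpmul2l // lee_fin divr_ge0 // ltW // mulr_gt0.
move=> h3 h4; have := le_trans h3 h4.
rewrite -EFinM lee_fin (_ : 2 / ((1 - z) * m) * m = 2 / (1 - z))%R; last first.
  by field; rewrite !gt_eqF.
have := invr_gt0 (1 - z)%R; rewrite z1' => h5 h6; lra.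
Qed.
End good_point_seq.

(** * Chains of good points *)

Section chain.
Context {R : realType} {n : nat}.
Variables (s p : R).
Hypotheses (n_gt0 : (0 < n)%N) (s_gt0 : 0 < s) (s_lt1 : s < 1) (p_gt1 : 1 < p).
Implicit Types (u v w eta : 'rV[R]_n -> R) (x y z : 'rV[R]_n).
Local Notation mu := (@lebesgue_rV R n).
Local Notation gker := (gker s p).
Local Notation gint := (gint s p).

Let a : R := n%:R + s * p.
Let p_gt0 : 0 < p. Proof. by apply: lt_trans p_gt1. Qed.
Let p_ge0 : 0 <= p. Proof. exact: ltW. Qed.
Let a_gt0 : 0 < a. Proof. by rewrite ltr_wpDl // mulr_gt0. Qed.
Let nR : 0 < n%:R :> R. Proof. by rewrite ltr0n. Qed.

(** The image of the ball [eball z r] under the homothety of centre [x] and ratio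
[2^-k]. *)
Definition hball z (r : R) x k : set 'rV[R]_n :=
  eball (x + 2^-1 ^+ k *: (z - x)) (2^-1 ^+ k * r).

Lemma hball0 z r x : hball z r x 0 = eball z r.
Proof. by rewrite /hball expr0 scale1r mul1r addrC subrK. Qed.

Lemma hball_sub z r x k : enorm (x - z) <= r -> hball z r x k `<=` eball z r.
Proof.
move=> xz; apply: sub_eball.
have q0 : 0 <= (2^-1 : R) ^+ k by rewrite exprn_ge0.
have q1 : (2^-1 : R) ^+ k <= 1 by apply: exprn_ile1; lra.
have -> : x + 2^-1 ^+ k *: (z - x) - z = (1 - 2^-1 ^+ k) *: (x - z).
  by apply/rowP => i; rewrite !mxE; ring.
rewrite enormZ ger0_norm ?subr_ge0 //.
have : (1 - 2^-1 ^+ k) * enorm (x - z) <= (1 - 2^-1 ^+ k) * r.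
  by rewrite ler_wpM2l // subr_ge0.
set q := 2^-1 ^+ k; lra.
Qed.

Lemma hball_dist z r x k y : enorm (x - z) <= r -> hball z r x k y ->
  enorm (x - y) <= 2 * (2^-1 ^+ k * r).
Proof.
move=> xz; rewrite /hball /eball /= => hy.
have q0 : 0 <= (2^-1 : R) ^+ k by rewrite exprn_ge0.
have := enormB_le y (x + 2^-1 ^+ k *: (z - x)) x; rewrite [in enorm (y - x)]enormBC.
have -> : x + 2^-1 ^+ k *: (z - x) - x = 2^-1 ^+ k *: (z - x) by rewrite addrAC subrr add0r.
rewrite enormZ ger0_norm // [enorm (z - x)]enormBC.
have := ler_wpM2l q0 xz; lra.
Qed.

Lemma hball_dist2 z r x k j y y' : enorm (x - z) <= r -> (k <= j)%N -> hball z r x k y ->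
  hball z r x j y' -> enorm (y - y') <= 4 * (2^-1 ^+ k * r).
Proof.
move=> xz kj /(hball_dist xz) h1 /(hball_dist xz) h2.
have r0 : 0 <= r by apply: le_trans xz; exact: enorm_ge0.
have := enormB_le y x y'; rewrite [enorm (y - x)]enormBC.
have : 2^-1 ^+ j * r <= 2^-1 ^+ k * r.
  by rewrite ler_wpM2r // ler_wiXn2l //; lra.
lra.
Qed.

Lemma hball_measure z r x k : 0 < r ->
  (((2^-1 ^+ k * r / n%:R) ^+ n)%:E <= mu (hball z r x k))%E.
Proof. by move=> r0; apply: lebesgue_eball_ge => //; rewrite mulr_gt0 // exprn_gt0 // invr_gt0. Qed.

(** A small kernel at two close points means close values. *)
Lemma gker_diff u x y (c rho : R) : 0 <= c -> gker u x y <= c ->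
  enorm (x - y) <= rho -> `|u x - u y| `^ p <= c * rho `^ a.
Proof.
move=> c0 hk hr; have [e0|en0] := eqVneq (enorm (x - y)) 0.
  have -> : x = y.
    apply/rowP => i; apply/eqP; rewrite -subr_eq0 -normr_le0 -e0.
    by have := coord_le_enorm (x - y) i; rewrite !mxE.
  by rewrite subrr normr0 powR0 ?gt_eqF // mulr_ge0 // powR_ge0.
have e0 : 0 < enorm (x - y) by rewrite lt_neqAle eq_sym en0 enorm_ge0.
move: hk; rewrite /gker ler_pdivrMr ?powR_gt0 // => h; apply: le_trans h _.
by rewrite ler_wpM2l //; apply: powR_le => //; [exact: ltW|exact: enorm_ge0].
Qed.

(** The constant that turns two applications of Chebyshev's inequality into a bound on
one jump; see [chain_arith]. *)
Definition chain_const : R := 16 * n%:R ^+ (2 * n) * 2 ^+ n * 4 `^ (n%:R + s * p).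

Lemma chain_const_gt0 : 0 < chain_const.
Proof. by rewrite !mulr_gt0 ?powR_gt0 ?exprn_gt0. Qed.

(** Here [rho] is the radius of the [k]-th ball; [rho / n] and [rho / 2 / n] give the lower
bounds for the volumes of the [k]-th and of the next ball. *)
Lemma chain_arith (rho c : R) : 0 < rho -> 0 <= c ->
  4 * (4 * c / (rho / n%:R) ^+ n) / (rho / 2 / n%:R) ^+ n * (4 * rho) `^ a =
  chain_const * c * rho `^ (s * p - n%:R).
Proof.
move=> r0 c0.
have -> : (4 * rho) `^ a = 4 `^ a * (rho ^+ n * rho `^ (s * p)).
  rewrite powRM ?(ltW r0) //; congr (_ * _).
  by rewrite /a powRD ?(gt_eqF r0) ?implybT // powR_mulrn // ltW.
have -> : rho `^ (s * p - n%:R) = rho `^ (s * p) / rho ^+ n.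
  by rewrite powRB ?(gt_eqF r0) ?implybT // powR_mulrn // ltW.
rewrite /chain_const -/a mulnC exprM !expr_div_n.
have := expf_neq0 n (lt0r_neq0 nR); have := expf_neq0 n (lt0r_neq0 r0).
have : (2 : R) ^+ n != 0 by rewrite expf_neq0.
move: (2 ^+ n) (n%:R ^+ n) (rho ^+ n) => T N P T0 P0 N0.
by field; rewrite T0 P0 N0.
Qed.

Section one_ball.
Variables (u : 'rV[R]_n -> R) (z : 'rV[R]_n) (r M : R).
Hypotheses (cu : continuous u) (r_gt0 : 0 < r) (M_gt0 : 0 < M).
Local Notation B := (eball z r).
Hypothesis uM : (gagliardo s p B u <= M%:E)%E.
Local Notation g := (gint B u).
Let mg D : measurable_fun D g.
Proof. by apply: measurable_funTS; apply: measurable_gint => //; exact: measurable_eball. Qed.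
Let mk D x : measurable_fun D (fun y => (gker u x y)%:E).
Proof. by apply: measurable_funTS; apply/measurable_EFinP; exact: measurable_gker_r. Qed.
Let g0 x : (0 <= g x)%E := gint_ge0 _ _ _ _ x.
Let k0 x y : (0 <= (gker u x y)%:E)%E. Proof. by rewrite lee_fin gker_ge0. Qed.

(** A lower bound for the volume of the [k]-th ball of a chain. *)
Definition vol k : R := (2^-1 ^+ k * r / n%:R) ^+ n.

Lemma vol_gt0 k : 0 < vol k.
Proof. by rewrite exprn_gt0 // divr_gt0 // mulr_gt0 // exprn_gt0 // invr_gt0. Qed.

(** The starting point of every chain. *)
Lemma base_point : exists2 y, B y & (g y <= (4 * M / vol 0)%:E)%E.
Proof.
have mv : ((vol 0)%:E <= mu B)%E by rewrite -(hball0 z r z); exact: hball_measure.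
have [y By [h _ _]] := @good_point3 _ _ _ mu B (vol 0) M M M g g g
  (measurable_eball z r) (vol_gt0 0) mv M_gt0 M_gt0 M_gt0
  (@mg B) (@mg B) (@mg B) g0 g0 g0 uM uM uM.
by exists y.
Qed.

Lemma gint_sub (A : set 'rV[R]_n) x (c : R) : A `<=` B -> (g x <= c%:E)%E ->
  (\int[mu]_(y in A) (gker u x y)%:E <= c%:E)%E.
Proof.
move=> AB; apply: le_trans; apply: ge0_subset_integralW => // y _; exact: k0.
Qed.

(** A Poincaré inequality with the value at a good point in place of the mean value: it
is the bound on [g y0] itself, since [|x - y0| < 2 r] in the ball. *)
Lemma poincare_point y0 : B y0 -> (g y0 <= (4 * M / vol 0)%:E)%E ->
  (\int[mu]_(x in B) (`|u x - u y0| `^ p)%:E <= (4 * M / vol 0 * (2 * r) `^ a)%:E)%E.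
Proof.
move=> By0 gy0.
apply: (@le_trans _ _ (\int[mu]_(x in B) (((2 * r) `^ a)%:E * (gker u y0 x)%:E))%E).
  apply: ge0_le_integralW => x Bx; first by rewrite lee_fin powR_ge0.
  rewrite -EFinM lee_fin distrC mulrC; apply: gker_diff => //; first exact: gker_ge0.
  have := enormB_le y0 z x; rewrite [enorm (z - x)]enormBC.
  move: Bx By0; rewrite /eball /=; lra.
rewrite ge0_integralZl ?lee_fin ?powR_ge0 //; last exact: measurable_eball.
by rewrite [(4 * _ / _ * _)]mulrC EFinM lee_wpmul2l // lee_fin powR_ge0.
Qed.

Variables (x0 : 'rV[R]_n) (A : nat -> R).
Hypotheses (x0z : enorm (x0 - z) <= r) (A_gt0 : forall k, 0 < A k).
Hypothesis intA : forall k, (\int[mu]_(y in hball z r x0 k) g y <= (A k)%:E)%E.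

Definition jump k : R :=
  (chain_const * A k * (2^-1 ^+ k * r) `^ (s * p - n%:R)) `^ p^-1.

Let rho_gt0 k : 0 < 2^-1 ^+ k * r.
Proof. by rewrite mulr_gt0 // exprn_gt0 // invr_gt0. Qed.

(** Both radii occur: [j = k.+1] for consecutive points of a chain, [j = k] for its last
step, to a point compared with the centre. *)
Lemma jump_le y y' k j : (k <= j <= k.+1)%N -> hball z r x0 k y -> hball z r x0 j y' ->
  gker u y y' <= 4 * (4 * A k / vol k) / vol j -> `|u y - u y'| <= jump k.
Proof.
move=> /andP[kj jk] hy hy' hk.
rewrite -[leLHS](powRK _ (lt0r_neq0 p_gt0)) //.
apply: powR_le; rewrite ?invr_ge0 ?powR_ge0 //.
have cv i : 0 <= 4 * (4 * A k / vol k) / vol i.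
  by rewrite !mulr_ge0 ?invr_ge0 ?(ltW (vol_gt0 _)) ?(ltW (A_gt0 _)).
apply: le_trans (gker_diff (cv j) hk (hball_dist2 x0z kj hy hy')) _.
rewrite -chain_arith ?(ltW (A_gt0 _)) //.
rewrite ler_wpM2r ?powR_ge0 // ler_wpM2l //.
  by rewrite !mulr_ge0 ?invr_ge0 ?(ltW (vol_gt0 _)) ?(ltW (A_gt0 _)).
rewrite lef_pV2 ?posrE ?vol_gt0 ?exprn_gt0 ?divr_gt0 //.
rewrite /vol lerXn2r ?nnegrE ?divr_ge0 ?(ltW (rho_gt0 _)) ?(ltW nR) //.
rewrite ler_pM2r ?invr_gt0 // [leLHS](_ : _ = 2^-1 ^+ k.+1 * r); last by rewrite exprS; ring.
by rewrite ler_pM2r // ler_wiXn2l //; lra.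
Qed.

(** The next point is chosen in the smaller ball with both [g] and the kernel towards the
current point small; the latter is possible because [g] is small at the current
point. *)
Lemma chain_points y0 k : hball z r x0 0 y0 -> (g y0 <= (4 * A 0%N / vol 0)%:E)%E ->
  exists2 y, hball z r x0 k y & (g y <= (4 * A k / vol k)%:E)%E /\
    `|u y - u y0| <= \sum_(0 <= j < k) jump j.
Proof.
move=> hy0 gy0; elim: k => [|k [y hy [gy uy]]].
  by exists y0 => //; rewrite gy0 big_geq // subrr normr0.
have b0 : 0 < 4 * A k / vol k by rewrite divr_gt0 ?vol_gt0 // mulr_gt0.
have mH : measurable (hball z r x0 k.+1) by exact: measurable_eball.
have [y' hy' [gy' ky' _]] := @good_point3 _ _ _ mu (hball z r x0 k.+1) (vol k.+1)
  (A k.+1) (4 * A k / vol k) (A k.+1) g (fun y' => (gker u y y')%:E) g mH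
  (vol_gt0 _) (hball_measure _ _ _ r_gt0) (A_gt0 _) b0 (A_gt0 _) (@mg _) (@mk _ y) (@mg _)
  g0 (k0 y) g0 (intA _) (gint_sub (hball_sub x0z) gy) (intA _).
exists y' => //; split=> //.
rewrite big_nat_recr //= (le_trans (ler_distD (u y) _ _)) // addrC lerD //.
rewrite distrC; apply: (jump_le (j := k.+1) _ hy hy'); first by rewrite leqnSn leqnn.
by move: ky'; rewrite lee_fin.
Qed.

(** The last good point and the centre [x0] of the homothety are compared through a third
point, towards which both kernels are small. *)
Lemma chain_centre y0 k G : 0 < G -> (g x0 <= G%:E)%E ->
  hball z r x0 0 y0 -> (g y0 <= (4 * A 0%N / vol 0)%:E)%E ->
  `|u x0 - u y0| <= \sum_(0 <= j < k.+1) jump j +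
    (4 * G / vol k * (2 * (2^-1 ^+ k * r)) `^ a) `^ p^-1.
Proof.
move=> G0 gG hy0 gy0; have [y hy [gy uy]] := chain_points k hy0 gy0.
have b0 : 0 < 4 * A k / vol k by rewrite divr_gt0 ?vol_gt0 // mulr_gt0.
have mH : measurable (hball z r x0 k) by exact: measurable_eball.
have [y' hy' [ky' kx' _]] := @good_point3 _ _ _ mu (hball z r x0 k) (vol k)
  (4 * A k / vol k) G (A k) (fun y' => (gker u y y')%:E) (fun y' => (gker u x0 y')%:E) g mH
  (vol_gt0 _) (hball_measure _ _ _ r_gt0) b0 G0 (A_gt0 _) (@mk _ y) (@mk _ x0) (@mg _)
  (k0 y) (k0 x0) g0 (gint_sub (hball_sub x0z) gy) (gint_sub (hball_sub x0z) gG) (intA _).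
have h1 : `|u x0 - u y'| <= (4 * G / vol k * (2 * (2^-1 ^+ k * r)) `^ a) `^ p^-1.
  rewrite -[leLHS](powRK _ (lt0r_neq0 p_gt0)) //.
  apply: powR_le; rewrite ?invr_ge0 ?powR_ge0 //.
  apply: gker_diff; [|by rewrite -lee_fin|exact: hball_dist hy'].
  by rewrite divr_ge0 ?(ltW (vol_gt0 _)) // mulr_ge0 // ltW.
have h2 : `|u y - u y'| <= jump k.
  by apply: (jump_le (j := k) _ hy hy'); [rewrite leqnn leqnSn|rewrite -lee_fin].
rewrite big_nat_recr //=.
have := ler_distD (u y') (u x0) (u y0); have := ler_distD (u y) (u y') (u y0).
rewrite [`|u y' - u y|]distrC; lra.
Qed.

End one_ball.
End chain.

(** * A Sobolev inequality on a ball *)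

Section sobolev.
Context {R : realType} {n : nat}.
Variables (s p q tau : R).
Hypotheses (n_gt0 : (0 < n)%N) (s_gt0 : 0 < s) (s_lt1 : s < 1) (p_gt1 : 1 < p).
Hypotheses (q_gt0 : 0 < q) (tau_gt0 : 0 < tau) (tau_ge : n%:R / p - s <= tau)
  (tau_q : q * tau <= p * (tau + s)).
Implicit Types (u v w eta : 'rV[R]_n -> R) (x y z : 'rV[R]_n).
Local Notation mu := (@lebesgue_rV R n).
Local Notation gker := (gker s p).
Local Notation gint := (gint s p).

Let a : R := n%:R + s * p.
Let p_gt0 : 0 < p. Proof. by apply: lt_trans p_gt1. Qed.
Let p_ge0 : 0 <= p. Proof. exact: ltW. Qed.
Let pn0 : p != 0. Proof. by rewrite gt_eqF. Qed.
Let nR : 0 < n%:R :> R. Proof. by rewrite ltr0n. Qed.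
Let two_gt1 : 1 < (2 : R) `^ tau.
Proof.
have h : (1 : R) < 2 by lra.
by have := gt0_ltr_powR tau_gt0 _ _ h; rewrite powR1 !nnegrE; apply; lra.
Qed.

Let L : R := 2 `^ tau.

Let half_gt0 k : 0 < (2^-1 : R) ^+ k. Proof. by rewrite exprn_gt0 // invr_gt0. Qed.

Lemma half_powR k (e : R) : (2^-1 ^+ k) `^ e = (2 `^ (- e)) ^+ k.
Proof.
have -> : (2^-1 : R) = 2 `^ (- 1) by rewrite powR_inv1.
rewrite -(powR_mulrn k (powR_ge0 2 (- 1))) -(powR_mulrn k (powR_ge0 2 (- e))).
by rewrite -!powRrM; congr (_ `^ _); ring.
Qed.

(** With [A k = M] the jumps are governed by [(2^-k)^(s - n/p)], hence grow at most like
[2^(k tau)]. *)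
Lemma jump_geometric (M r : R) k : 0 < M -> 0 < r ->
  jump (n := n) s p r (fun=> M) k <=
  (chain_const (n := n) s p * M) `^ p^-1 * r `^ (s - n%:R / p) * L ^+ k.
Proof.
move=> M0 r0; rewrite /jump powRM ?powR_ge0 //; last first.
  by rewrite mulr_ge0 ?(ltW M0) // ltW // chain_const_gt0.
rewrite -mulrA ler_wpM2l ?powR_ge0 // -powRrM.
have -> : (s * p - n%:R) / p = s - n%:R / p by field.
rewrite powRM ?(ltW r0) ?(ltW (half_gt0 k)) // mulrC ler_wpM2l ?powR_ge0 //.
rewrite half_powR lerXn2r ?nnegrE ?powR_ge0 //.
by apply: ler_powR; [lra|rewrite opprB].
Qed.

Lemma sum_jump_le (M r : R) k : 0 < M -> 0 < r ->
  \sum_(0 <= j < k.+1) jump (n := n) s p r (fun=> M) j <=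
  (chain_const (n := n) s p * M) `^ p^-1 * r `^ (s - n%:R / p) * (L / (L - 1)) * L ^+ k.
Proof.
move=> M0 r0; set W := _ * r `^ _.
have W0 : 0 <= W by rewrite mulr_ge0 ?powR_ge0.
have L1 : 0 < L - 1 by rewrite subr_gt0.
apply: (@le_trans _ _ (\sum_(0 <= j < k.+1) W * L ^+ j)).
  by apply: ler_sum => j _; exact: jump_geometric.
rewrite -mulr_sumr -[leRHS]mulrA ler_wpM2l //.
have -> : \sum_(0 <= j < k.+1) L ^+ j = (L ^+ k.+1 - 1) / (L - 1).
  elim: k => [|k IH]; first by rewrite big_nat1 expr0 expr1 divff ?gt_eqF.
  rewrite big_nat_recr //= IH [L ^+ k.+2]exprS; field; rewrite gt_eqF //.
rewrite mulrAC -exprS ler_wpM2r ?invr_ge0 ?(ltW L1) //; lra.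
Qed.

Lemma centre_term (G r : R) k : 0 < G -> 0 < r ->
  (4 * G / vol (n := n) r k * (2 * (2^-1 ^+ k * r)) `^ a) `^ p^-1 =
  (4 * n%:R ^+ n * 2 `^ a) `^ p^-1 * (r `^ s * G `^ p^-1) * (2 `^ (- s)) ^+ k.
Proof.
move=> G0 r0; set rho := 2^-1 ^+ k * r.
have rho0 : 0 < rho by rewrite mulr_gt0.
have -> : 4 * G / vol (n := n) r k * (2 * rho) `^ a =
    (4 * n%:R ^+ n * 2 `^ a) * (G * rho `^ (s * p)).
  rewrite powRM ?(ltW rho0) // [rho `^ a](_ : _ = rho ^+ n * rho `^ (s * p)); last first.
    by rewrite /a powRD ?(gt_eqF rho0) ?implybT // powR_mulrn // ltW.
  rewrite /vol -/rho expr_div_n.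
  have := expf_neq0 n (lt0r_neq0 nR); have := expf_neq0 n (lt0r_neq0 rho0).
  move: (n%:R ^+ n) (rho ^+ n) => N P P0 N0; field.
  by rewrite P0 N0.
rewrite powRM ?mulr_ge0 ?powR_ge0 ?exprn_ge0 ?(ltW G0) // -[RHS]mulrA; congr (_ * _).
rewrite powRM ?powR_ge0 ?(ltW G0) // -powRrM mulfK //.
rewrite /rho powRM ?(ltW r0) ?(ltW (half_gt0 k)) // half_powR; ring.
Qed.

(** The scale that balances the two parts of the chain estimate: the least [k] with
[H <= 2^(k (tau + s))].  If [k > 0], then [H > 1] and by minimality [2^(k tau)] is at
most [2^tau H^(tau / (tau + s))], whose [q]-th power is at most [2^(tau q) H^p] since
[q tau <= p (tau + s)]. *)
Lemma dyadic_choice (H : R) : 0 <= H ->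
  exists k, H * (2 `^ (- s)) ^+ k <= L ^+ k /\ (L ^+ k) `^ q <= L `^ q * (1 + H `^ p).
Proof.
move=> H0; pose T : R := 2 `^ (tau + s).
have T1 : 1 < T.
  have h : (1 : R) < 2 by lra.
  by have := gt0_ltr_powR (addr_gt0 tau_gt0 s_gt0) _ _ h; rewrite powR1 !nnegrE; apply; lra.
have T0 : 0 < T by lra.
have hex : exists k, H <= T ^+ k.
  (* Bernoulli's inequality. *)
  have ber k : 1 + (T - 1) * k%:R <= T ^+ k.
    elim: k => [|k IH]; first by rewrite expr0 mulr0 addr0.
    have := ler_wpM2l (ltW T0) IH; rewrite exprS -natr1.
    have : 0 <= (T - 1) ^+ 2 * k%:R by rewrite mulr_ge0 // sqr_ge0.
    lra.
  exists (Num.truncn (H / (T - 1))).+1; apply: le_trans (ber _).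
  have : H < (T - 1) * (Num.truncn (H / (T - 1))).+1%:R.
    by rewrite mulrC -ltr_pdivrMr ?subr_gt0 //; exact: truncnS_gt.
  lra.
have E k : L ^+ k = T ^+ k * (2 `^ (- s)) ^+ k.
  rewrite -exprMn /T -powRD; last by rewrite (_ : (2 : R) != 0) ?implybT.
  by rewrite addrK.
case: (ex_minnP hex) => k hk hmin; exists k; split.
  by rewrite E ler_wpM2r ?exprn_ge0 ?powR_ge0.
case: k hk hmin => [|k] hk hmin.
  rewrite expr0 powR1; apply: (@le_trans _ _ (L `^ q)).
    have := ler_powR (ltW two_gt1) (ltW q_gt0); rewrite powRr0; exact.
  by rewrite ler_peMr ?powR_ge0 // lerDl powR_ge0.
have hk' : T ^+ k < H by rewrite ltNge; apply/negP => /hmin; rewrite ltnn.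
rewrite exprS powRM ?exprn_ge0 ?powR_ge0 // ler_wpM2l ?powR_ge0 //.
apply: (@le_trans _ _ (H `^ p)); last by rewrite lerDr.
apply: (@le_trans _ _ ((T ^+ k) `^ p)); last by apply: powR_le => //; [rewrite exprn_ge0 // ltW|exact: ltW].
have F (e f : R) : ((2 `^ e) ^+ k) `^ f = (2 ^+ k) `^ (e * f).
  rewrite -(powR_mulrn k (powR_ge0 2 e)) -(powR_mulrn k (ler0n R 2)).
  by rewrite -!powRrM; congr (_ `^ _); ring.
rewrite /L /T !F; apply: ler_powR; first by rewrite exprn_ege1 //; lra.
by rewrite mulrC [leRHS]mulrC.
Qed.

(** The first term comes from the sum of the jumps, the second from the last step of the
chain, to its limit point. *)
Definition sob_const : R :=
  (chain_const (n := n) s p) `^ p^-1 * (L / (L - 1)) + (4 * n%:R ^+ n * 2 `^ a) `^ p^-1.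

Lemma sob_const_gt0 : 0 < sob_const.
Proof.
have L0 : 0 < L by apply: powR_gt0.
have L1 : 0 < L - 1 by rewrite subr_gt0.
apply: addr_gt0; last by rewrite powR_gt0 // !mulr_gt0 ?powR_gt0 ?exprn_gt0.
by rewrite mulr_gt0 ?(divr_gt0 L0 L1) // powR_gt0 // chain_const_gt0.
Qed.

Section one_ball.
Variables (u : 'rV[R]_n -> R) (z : 'rV[R]_n) (r M : R).
Hypotheses (cu : continuous u) (r_gt0 : 0 < r) (M_gt0 : 0 < M).
Local Notation B := (eball z r).
Hypothesis uM : (gagliardo s p B u <= M%:E)%E.
Variable y0 : 'rV[R]_n.
Hypotheses (By0 : B y0) (gy0 : (gint B u y0 <= (4 * M / vol (n := n) r 0)%:E)%E).

Lemma gint_sub_ball x k : enorm (x - z) <= r ->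
  (\int[mu]_(y in hball z r x k) gint B u y <= M%:E)%E.
Proof.
move=> xz; apply: le_trans uM; apply: ge0_subset_integralW.
  exact: hball_sub.
by move=> y _; exact: gint_ge0.
Qed.

Let scal : R := r `^ (s - n%:R / p) * M `^ p^-1.

(** A pointwise bound in the manner of Hedberg: the chain towards [x] is stopped at the
scale given by [dyadic_choice] for [H = (G r^n / M)^(1/p)], a quantity without
dimension. *)
Lemma sobolev_pointwise_fin x (G : R) : B x -> 0 < G -> (gint B u x <= G%:E)%E ->
  `|u x - u y0| `^ q <= (2 * sob_const * scal) `^ q * (L `^ q * (1 + G * r ^+ n / M)).
Proof.
move=> Bx G0 hG.
have xz : enorm (x - z) <= r by exact: ltW.
pose H := (G * r ^+ n / M) `^ p^-1.
have H0 : 0 <= H by exact: powR_ge0.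
have GrM : 0 <= G * r ^+ n / M by rewrite divr_ge0 ?mulr_ge0 ?exprn_ge0 ?ltW.
have [k [k1 k2]] := dyadic_choice H0.
have := chain_centre n_gt0 s_gt0 p_gt1 cu r_gt0 xz (fun=> M_gt0)
  (fun k => gint_sub_ball k xz) k G0 hG _ gy0.
rewrite hball0 => /(_ By0) h.
have {h} : `|u x - u y0| <= 2 * sob_const * scal * L ^+ k.
  apply: le_trans h _.
  have h1 := sum_jump_le k M_gt0 r_gt0.
  rewrite centre_term //.
  have E : r `^ s * G `^ p^-1 = scal * H.
    have rn : (r ^+ n) `^ p^-1 = r `^ (n%:R / p).
      by rewrite -(powR_mulrn n (ltW r_gt0)) -powRrM.
    have Mp : M^-1 `^ p^-1 = (M `^ p^-1)^-1.
      by rewrite -powR_inv1 ?(ltW M_gt0) // powRAC powR_inv1 // powR_ge0.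
    have GE : (G * r ^+ n / M) `^ p^-1 = G `^ p^-1 * r `^ (n%:R / p) / M `^ p^-1.
      rewrite powRM ?invr_ge0 ?(ltW M_gt0) //; last by rewrite mulr_ge0 ?exprn_ge0 // ltW.
      by rewrite powRM ?exprn_ge0 ?(ltW G0) ?(ltW r_gt0) // rn Mp.
    have rE : r `^ s = r `^ (s - n%:R / p) * r `^ (n%:R / p).
      by rewrite -powRD ?(gt_eqF r_gt0) ?implybT // subrK.
    rewrite /scal /H GE rE; field; rewrite gt_eqF // powR_gt0 //.
  rewrite {}E.
  set C1 := (4 * n%:R ^+ n * 2 `^ a) `^ p^-1.
  have C10 : 0 <= C1 by exact: powR_ge0.
  have scal0 : 0 <= scal by rewrite mulr_ge0 ?powR_ge0.
  have h2 : C1 * (scal * H) * (2 `^ (- s)) ^+ k <= C1 * scal * L ^+ k.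
    have -> : C1 * (scal * H) * (2 `^ (- s)) ^+ k = C1 * scal * (H * (2 `^ (- s)) ^+ k) by ring.
    by rewrite ler_wpM2l // mulr_ge0.
  move: h1; rewrite powRM ?(ltW M_gt0) //; last by rewrite ltW // chain_const_gt0.
  set C2 := (chain_const s p) `^ p^-1.
  have -> : C2 * M `^ p^-1 * r `^ (s - n%:R / p) * (L / (L - 1)) * L ^+ k =
    C2 * (L / (L - 1)) * scal * L ^+ k by rewrite /scal; ring.
  move=> h1; apply: le_trans (lerD h1 h2) _.
  have sc0 : 0 <= sob_const * scal * L ^+ k.
    by rewrite mulr_ge0 ?exprn_ge0 ?powR_ge0 // mulr_ge0 // ltW // sob_const_gt0.
  have -> : C2 * (L / (L - 1)) * scal * L ^+ k + C1 * scal * L ^+ k =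
    sob_const * scal * L ^+ k by rewrite /sob_const -/C1 -/C2; ring.
  lra.
move=> h; apply: (@le_trans _ _ ((2 * sob_const * scal * L ^+ k) `^ q)).
  by apply: powR_le => //; exact: ltW.
have S0 : 0 <= 2 * sob_const * scal.
  by rewrite mulr_ge0 ?mulr_ge0 ?powR_ge0 // ltW // sob_const_gt0.
rewrite powRM ?exprn_ge0 ?powR_ge0 // ler_wpM2l ?powR_ge0 //.
by move: k2; rewrite /H powRVK.
Qed.

(** The pointwise bound is affine in [g], and the integral of [g] is at most [M].  Where
[g] is infinite there is nothing to prove. *)
Lemma sobolev_ball :
  (\int[mu]_(x in B) (`|u x - u y0| `^ q)%:E <=
   ((2 * sob_const * scal) `^ q * L `^ q * (2 * 2 ^+ n + 1) * r ^+ n)%:E)%E.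
Proof.
set K := _ `^ q * L `^ q.
have K0 : 0 <= K by rewrite mulr_ge0 ?powR_ge0.
have c0 : 0 <= r ^+ n / M by rewrite divr_ge0 ?exprn_ge0 ?ltW.
have mB : measurable B by exact: measurable_eball.
have mg : measurable_fun B (gint B u) by apply: measurable_funTS; exact: measurable_gint.
apply: (@le_trans _ _ (\int[mu]_(x in B) (K%:E * (2%:E + (r ^+ n / M)%:E * gint B u x)))%E).
  apply: ge0_le_integralW => x Bx; first by rewrite lee_fin powR_ge0.
  have := gint_ge0 s p B u x; case E : (gint B u x) => [G| |] // G0; last first.
    have K0' : 0 < K.
      have S0 : 0 < 2 * sob_const * scal.
        by rewrite mulr_gt0 ?mulr_gt0 ?powR_gt0 // sob_const_gt0.
      by rewrite mulr_gt0 ?powR_gt0.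
    rewrite gt0_muley ?lte_fin ?divr_gt0 ?exprn_gt0 // addey // gt0_muley ?lte_fin ?leey //.
  have G1 : 0 < G + M / r ^+ n.
    by rewrite ltr_wpDl ?divr_gt0 ?exprn_gt0.
  have hG : (gint B u x <= (G + M / r ^+ n)%:E)%E.
    by rewrite E lee_fin lerDl divr_ge0 ?exprn_ge0 // ltW.
  rewrite -EFinM lee_fin.
  apply: le_trans (sobolev_pointwise_fin Bx G1 hG) _.
  rewrite mulrA ler_wpM2l // le_eqVlt; apply/orP; left; apply/eqP.
  field; rewrite expf_neq0 ?gt_eqF //.
rewrite ge0_integralZl ?lee_fin //; last 2 first.
- by apply: emeasurable_funD => //; exact: measurable_funeM.
- by move=> x _; rewrite adde_ge0 ?lee_fin // mule_ge0 ?lee_fin // gint_ge0.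
have -> : (K * (2 * 2 ^+ n + 1) * r ^+ n)%:E =
  (K%:E * ((2 * 2 ^+ n + 1) * r ^+ n)%:E)%E by rewrite -EFinM mulrA.
rewrite lee_wpmul2l ?lee_fin //.
rewrite ge0_integralD //; last 2 first.
- by move=> x _; rewrite mule_ge0 ?lee_fin // gint_ge0.
- exact: measurable_funeM.
rewrite ge0_integralZl ?lee_fin //; last by move=> x _; exact: gint_ge0.
have -> : ((2 * 2 ^+ n + 1) * r ^+ n)%:E = ((2 * 2 ^+ n * r ^+ n)%:E + (r ^+ n)%:E)%E.
  by rewrite -EFinD mulrDl mul1r.
apply: leeD.
  have -> : 2 * 2 ^+ n * r ^+ n = 2 * (2 * r) ^+ n by rewrite exprMn mulrA.
  rewrite (integral_cst mu mB 2%:E) EFinM lee_wpmul2l ?lee_fin //.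
  by apply: lebesgue_eball_le; exact: ltW.
apply: le_trans (lee_wpmul2l _ uM) _; first by rewrite lee_fin.
by rewrite -EFinM lee_fin divfK // gt_eqF.
Qed.

End one_ball.
End sobolev.

(** * A bound at good points for functions vanishing near the sphere *)

Section hardy.
Context {R : realType} {m : nat}.
Local Notation n := m.+1.
Variables (s p : R).
Hypotheses (s_gt0 : 0 < s) (s_lt1 : s < 1) (p_gt1 : 1 < p) (sp_gt1 : 1 < s * p).
Implicit Types (u v w : 'rV[R]_n -> R) (x y z : 'rV[R]_n).
Local Notation mu := (@lebesgue_rV R n).
Local Notation gker := (gker s p).
Local Notation gint := (gint s p).

Let p_gt0 : 0 < p. Proof. by apply: lt_trans p_gt1. Qed.
Let pn0 : p != 0. Proof. by rewrite gt_eqF. Qed.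
Let n_gt0 : (0 < n)%N. Proof. by []. Qed.

(** The support is compact in the open ball, hence at a positive distance from the
sphere. *)
Lemma test_vanish v z r : 0 < r -> test_function (eball z r) v ->
  exists N, forall x, r - 2 * (2^-1 ^+ N * r) <= enorm (x - z) -> v x = 0.
Proof.
move=> r0 [_ cs sB].
have [[x0 sx0]|s0] := pselect (supp v !=set0); last first.
  exists 0%N => x _; apply/eqP; apply: contrapT => /negP vx; apply: s0; exists x.
  exact: subset_closure.
have [c sc hc] : exists2 c, supp v c & forall x, supp v x -> enorm (x - z) <= enorm (c - z).
  have [||c sc hc] := @EVT_max_rV R _ (fun x => enorm (x - z)) (supp v) _ cs.
  - by exists x0.
  - by apply: continuous_subspaceT; exact: enormB_continuous.
  - by exists c; [exact: set_mem|move=> x sx; apply: hc; exact: mem_set].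
have cz : enorm (c - z) < r by exact: sB.
have [N hN] : exists N, 2 * (2^-1 ^+ N * r) < r - enorm (c - z).
  exists (Num.truncn (2 * r / (r - enorm (c - z)))).+1.
  rewrite exprVn mulrCA [ltLHS]mulrC ltr_pdivrMr ?exprn_gt0 //.
  rewrite -ltr_pdivrMl ?subr_gt0 // mulrC; apply: (lt_trans (truncnS_gt _)).
  by rewrite -natrX ltr_nat ltn_expl.
exists N => x hx; apply/eqP; apply: contrapT => /negP vx.
have /hc : supp v x by exact: subset_closure.
lra.
Qed.

(** A piece of the sphere is parametrised by the cube of [R^(n-1)] of half side [r / n],
over which the sphere is a graph.  No surface measure is involved. *)
Definition cap_base (r : R) : set 'rV[R]_m := box (const_mx (- (r / n%:R))) (const_mx (r / n%:R)).

Definition cap_point z (r : R) (t : 'rV[R]_m) : 'rV[R]_n :=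
  z + rV_snoc (t, Num.sqrt (r ^+ 2 - enorm t ^+ 2) : measurableTypeR R).

Lemma snoc_lift (t : 'rV[R]_m) (c : R) j :
  (rV_snoc (t, c : measurableTypeR R)) ord0 (lift ord_max j) = t ord0 j.
Proof. by rewrite mxE liftK. Qed.

Lemma snoc_max (t : 'rV[R]_m) (c : R) :
  (rV_snoc (t, c : measurableTypeR R)) ord0 ord_max = c.
Proof. by rewrite mxE unlift_none. Qed.

Lemma enorm_cap_point z r t : 0 < r -> cap_base r t -> enorm (cap_point z r t - z) = r.
Proof.
move=> r0 ht; rewrite /cap_point addrAC subrr add0r.
apply/eqP; rewrite -(eqrXn2 (n := 2)) ?enorm_ge0 ?(ltW r0) //; apply/eqP.
rewrite (sqr_enorm (rV_snoc _)) big_ord_recr /= snoc_max.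
have -> : \sum_(i < m) rV_snoc (t, Num.sqrt (r ^+ 2 - enorm t ^+ 2) : measurableTypeR R)
    ord0 (widen_ord (leqnSn m) i) ^+ 2 = enorm t ^+ 2.
  rewrite sqr_enorm.
  apply: eq_bigr => i _; have -> : widen_ord (leqnSn m) i = lift ord_max i.
    by apply: val_inj; rewrite /= /bump leqNgt ltn_ord.
  by rewrite snoc_lift.
rewrite [Num.sqrt (r ^+ 2 - _) ^+ 2]sqr_sqrtr ?subrKC // subr_ge0 sqr_enorm.
have h i : t ord0 i ^+ 2 <= (r / n%:R) ^+ 2.
  have := ht i; rewrite !mxE => /andP[h1 h2].
  rewrite -real_normK ?num_real // lerXn2r ?nnegrE ?divr_ge0 ?(ltW r0) //.
  by rewrite ler_norml !ltW.
apply: (@le_trans _ _ (\sum_(j < m) (r / n%:R) ^+ 2)); first by apply: ler_sum => i _.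
rewrite sumr_const card_ord -[leLHS]mulr_natl expr_div_n mulrA ler_pdivrMr ?exprn_gt0 //.
rewrite mulrC ler_wpM2l ?sqr_ge0 //.
have : (m%:R : R) <= n%:R by rewrite ler_nat.
have : 1 <= n%:R :> R by rewrite ler1n.
nra.
Qed.

Lemma measurable_cap_point z r : measurable_fun setT (cap_point z r).
Proof.
have ms : measurable_fun setT (fun t : 'rV[R]_m =>
    rV_snoc (t, Num.sqrt (r ^+ 2 - enorm t ^+ 2) : measurableTypeR R)).
  apply: (measurableT_comp (@measurable_rV_snoc R m)).
  apply: measurable_fun_pair; first exact: measurable_id.
  apply: (measurableT_comp (continuous_measurable_fun (@sqrt_continuous R))).
  apply: measurable_funB; first exact: measurable_cst.
  by apply: measurable_funX; apply: measurable_cont; exact: enorm_continuous.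
apply: measurable_rVP => i; under eq_fun do rewrite mxE.
apply: measurable_funD; first exact: measurable_cst.
exact: (measurableT_comp (measurable_rV_coord i) ms).
Qed.

Lemma measurable_cap_dist z r (c : R) : measurable_fun setT
  (fun tx : 'rV[R]_m * 'rV[R]_n =>
     enorm (tx.2 - (cap_point z r tx.1 + c *: (z - cap_point z r tx.1)))).
Proof.
apply: (measurableT_comp (measurable_cont (@enorm_continuous R n))).
have mc i : measurable_fun setT (fun tx : 'rV[R]_m * 'rV[R]_n => cap_point z r tx.1 ord0 i).
  apply: (measurableT_comp (measurable_rV_coord i)).
  exact: (measurableT_comp (measurable_cap_point z r) measurable_fst).
apply: measurable_rVP => i.
rewrite (_ : (fun tx => _) = (fun tx : 'rV[R]_m * 'rV[R]_n => tx.2 ord0 i -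
   (cap_point z r tx.1 ord0 i + c * (z ord0 i - cap_point z r tx.1 ord0 i)))); last first.
  by apply/funext => tx; rewrite !mxE.
apply: measurable_funB.
  exact: (measurableT_comp (measurable_rV_coord i) measurable_snd).
apply: measurable_funD; first exact: (mc i).
apply: measurable_funM; first exact: measurable_cst.
by apply: measurable_funB; [exact: measurable_cst|exact: (mc i)].
Qed.

Definition cap_rel z r k : set ('rV[R]_m * 'rV[R]_n) :=
  [set tx | hball z r (cap_point z r tx.1) k tx.2].

Lemma measurable_cap_rel z r k : measurable (cap_rel z r k).
Proof.
rewrite (_ : cap_rel z r k = (fun tx : 'rV[R]_m * 'rV[R]_n =>
  enorm (tx.2 - (cap_point z r tx.1 + 2^-1 ^+ k *: (z - cap_point z r tx.1))))
  @^-1` `]-oo, (2^-1 ^+ k * r)[%classic).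
  rewrite -[X in measurable X]setTI.
  exact: (measurable_cap_dist z r (2^-1 ^+ k) measurableT (measurable_itv _)).
by apply/seteqP; split => tx; rewrite /= in_itv.
Qed.

Lemma cap_base_measure r : 0 < r ->
  lebesgue_rV m (cap_base r) = ((2 * (r / n%:R)) ^+ m)%:E.
Proof.
move=> r0; apply: lebesgue_box; first by rewrite mulr_ge0 // divr_ge0 // (ltW r0).
by move=> i; rewrite !mxE; ring.
Qed.

(** The point [x] is within [2 rho] of [cap_point z r t] with [rho = 2^-k r], so that [t]
lies in a cube of half side [3 rho] around the projection of [x]. *)
Lemma cap_fiber z r k x : 0 < r ->
  (lebesgue_rV m (cap_base r `&` [set t | hball z r (cap_point z r t) k x]) <=
   ((6 * (2^-1 ^+ k * r)) ^+ m)%:E)%E.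
Proof.
move=> r0; set rho := 2^-1 ^+ k * r.
have rho0 : 0 < rho by rewrite mulr_gt0 // exprn_gt0 // invr_gt0.
pose c : 'rV[R]_m := \row_j (x - z) ord0 (lift ord_max j).
apply: (@le_trans _ _ (lebesgue_rV m (box (c - const_mx (3 * rho)) (c + const_mx (3 * rho))))); last first.
  rewrite (@lebesgue_box _ _ _ _ (6 * rho)) //; first by rewrite mulr_ge0 // ltW.
  by move=> i; rewrite !mxE; ring.
apply: le_measure; rewrite ?inE; [|exact: measurable_box|].
  apply: measurableI; first exact: measurable_box.
  rewrite (_ : [set t | _] = ysection (cap_rel z r k) x).
    by apply: measurable_ysection; exact: measurable_cap_rel.
  by apply/seteqP; split => t; rewrite /ysection /= inE.
move=> t [ht /= hx] j; rewrite !mxE.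
have xz : enorm (cap_point z r t - z) <= r by rewrite enorm_cap_point.
have := hball_dist xz hx.
move=> /(le_trans (coord_le_enorm (cap_point z r t - x) (lift ord_max j))).
rewrite !mxE liftK /= ler_norml -/rho => /andP[h1 h2].
by apply/andP; split; lra.
Qed.

(** By Tonelli the integral over the directions of the masses of the [k]-th balls is at
most the integral of [g] times the measure of [cap_fiber].  Divided by the measure
of [cap_base], this is a mean of order [2^(-k(n-1)) M].  By [good_point_seq] one
direction is good for all [k], up to the factor [th^-k]. *)
Lemma good_direction (g : 'rV[R]_n -> \bar R) z r M th : measurable_fun setT g ->
  (forall x, 0 <= g x)%E -> (\int[mu]_(x in eball z r) g x <= M%:E)%E ->
  0 < M -> 0 < r -> 0 < th < 1 ->
  exists2 t, cap_base r t & forall k,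
    (\int[mu]_(x in hball z r (cap_point z r t) k) g x <=
     (2 * ((6 * (2^-1 ^+ k * r)) ^+ m * M) / ((1 - th) * th ^+ k * (2 * (r / n%:R)) ^+ m))%:E)%E.
Proof.
move=> mg g0 gM M0 r0 th01.
set A := cap_base r; set B := eball z r.
have mA : measurable A by exact: measurable_box.
have mB : measurable B by exact: measurable_eball.
(* Cutting [g] off outside [S k] turns both iterated integrals into integrals over full spaces. *)
pose S k := cap_rel z r k `&` (A `*` B).
have mS k : measurable (S k).
  by apply: measurableI; [exact: measurable_cap_rel|exact: measurableX].
pose F k := (fun tx : 'rV[R]_m * 'rV[R]_n => g tx.2) \_ (S k).
have F0 k tx : (0 <= F k tx)%E by apply: erestrict_ge0.
have mF k : measurable_fun setT (F k).
  apply/(measurable_restrictT _ (mS k)); apply: measurable_funTS.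
  exact: (measurableT_comp mg measurable_snd).
pose f k t := (\int[mu]_x F k (t, x))%E.
have rho0 k : 0 < 2^-1 ^+ k * r by rewrite mulr_gt0 // exprn_gt0 // invr_gt0.
have fE k t : A t -> f k t = (\int[mu]_(x in hball z r (cap_point z r t) k) g x)%E.
  move=> At; rewrite /f [RHS]integral_mkcond; apply: eq_integral => x _.
  rewrite /F /patch; congr (if _ then _ else _); apply/idP/idP; rewrite !inE.
    by move=> [].
  move=> hx; split => //; split => //=.
  by apply: hball_sub hx; rewrite enorm_cap_point.
have If k : (\int[lebesgue_rV m]_(t in A) f k t <= ((6 * (2^-1 ^+ k * r)) ^+ m * M)%:E)%E.
  apply: (@le_trans _ _ (\int[lebesgue_rV m]_t f k t)%E).
    by apply: ge0_subset_integralW => // t _; apply: integral_ge0.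
  rewrite /f tonelli_rV //.
  set c := (6 * (2^-1 ^+ k * r)) ^+ m.
  have c0 : 0 <= c by rewrite exprn_ge0 // mulr_ge0 // ltW.
  apply: (@le_trans _ _ (\int[mu]_(x in B) (c%:E * g x))%E).
    rewrite [leRHS]integral_mkcond; apply: ge0_le_integralW => x _.
      by apply: integral_ge0.
    rewrite [leRHS]/patch; case: ifPn => [/set_mem Bx|nB]; last first.
      rewrite integral0_eq // => t _; rewrite /F /patch; case: ifPn => //.
      by move=> /set_mem [_ [_ /= Bx]]; move: nB; rewrite mem_set.
    pose D := A `&` [set t | hball z r (cap_point z r t) k x].
    have mD : measurable D.
      apply: measurableI => //.
      rewrite (_ : [set t | _] = ysection (cap_rel z r k) x).
        by apply: measurable_ysection; exact: measurable_cap_rel.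
      by apply/seteqP; split => t; rewrite /ysection /= inE.
    rewrite (_ : (\int[lebesgue_rV m]_t F k (t, x))%E = (g x * lebesgue_rV m D)%E).
      by rewrite muleC lee_wpmul2r //; exact: cap_fiber.
    rewrite -(integral_cst (lebesgue_rV m) mD (g x)) [RHS]integral_mkcond.
    apply: eq_integral => t _; rewrite /F /patch; congr (if _ then _ else _).
    by apply/idP/idP; rewrite !inE => -[] // h1 h2; split => //; case: h2.
  rewrite ge0_integralZl ?lee_fin //; last by apply: measurable_funTS.
  by rewrite EFinM lee_wpmul2l.
have a0 k : 0 < (6 * (2^-1 ^+ k * r)) ^+ m * M by rewrite mulr_gt0 // exprn_gt0 // mulr_gt0.
have V0 : 0 < (2 * (r / n%:R)) ^+ m by rewrite exprn_gt0 // mulr_gt0 // divr_gt0.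
have VA : (((2 * (r / n%:R)) ^+ m)%:E <= lebesgue_rV m A)%E by rewrite cap_base_measure.
have mf k : measurable_fun A (f k) by apply: measurable_funTS; exact: measurable_int_rV.
have f0 k t : (0 <= f k t)%E by apply: integral_ge0.
have [t At ht] := @good_point_seq _ _ R (lebesgue_rV m) A _ th _ f mA V0 VA th01 a0 mf f0 If.
by exists t => // k; rewrite -fE.
Qed.

Let del : R := (s * p - 1) / 2.
Let del_gt0 : 0 < del. Proof. by rewrite divr_gt0 // subr_gt0. Qed.
Let th : R := 2^-1 `^ del.
Let th01 : 0 < th < 1. Proof. exact: powR_half_lt1. Qed.

Definition mass_const : R := 2 * (3 * n%:R) ^+ m / (1 - th).

Lemma mass_const_ge1 : 1 <= mass_const.
Proof.
have /andP[t0 t1] := th01.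
rewrite /mass_const ler_pdivlMr ?subr_gt0 // mul1r.
have h : 1 <= (3 * n%:R) ^+ m :> R.
  rewrite exprn_ege1 //; have : 1 <= n%:R :> R by rewrite ler1n.
  lra.
lra.
Qed.

(** The masses decay like [2^(-k(n-1))], up to the loss [2^(k del)]. *)
Lemma mass_arith (r M : R) k : 0 < r ->
  2 * ((6 * (2^-1 ^+ k * r)) ^+ m * M) / ((1 - th) * th ^+ k * (2 * (r / n%:R)) ^+ m) =
  mass_const * M * (2^-1 ^+ m / th) ^+ k.
Proof.
move=> r0; have /andP[t0 t1] := th01.
rewrite /mass_const !exprMn (exprVn (n%:R : R) m) (exprVn th k).
have -> : ((2^-1 ^+ k) ^+ m : R) = (2^-1 ^+ m) ^+ k by rewrite -!exprM mulnC.
have -> : (6 : R) ^+ m = 2 ^+ m * 3 ^+ m by rewrite -exprMn; congr (_ ^+ _); ring.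
have N0 : (n%:R : R) ^+ m != 0 by rewrite expf_neq0 // gt_eqF.
have r1 : r ^+ m != 0 by rewrite expf_neq0 // gt_eqF.
have T0 : th ^+ k != 0 by rewrite expf_neq0 // gt_eqF.
have W0 : (2 : R) ^+ m != 0 by rewrite expf_neq0.
have U0 : 1 - th != 0 by rewrite gt_eqF // subr_gt0.
move: (n%:R ^+ m : R) (r ^+ m) (th ^+ k) ((2 : R) ^+ m) (1 - th) ((2^-1 ^+ m) ^+ k : R) N0 r1 T0 W0 U0.
by move=> N P T W U V N0 P0 T0 W0 U0; field; rewrite N0 P0 T0 W0 U0.
Qed.

Definition hardy_const : R :=
  (chain_const (n := n) s p * mass_const) `^ p^-1 / (1 - 2^-1 `^ (del / p)).

Lemma hardy_const_gt0 : 0 < hardy_const.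
Proof.
have /andP[_ h] := powR_half_lt1 (divr_gt0 del_gt0 p_gt0).
rewrite divr_gt0 ?subr_gt0 // powR_gt0 // mulr_gt0 ?chain_const_gt0 //.
by apply: lt_le_trans mass_const_ge1.
Qed.

(** The exponent of [2^-j] is [(n - 1 - del) + (s p - n) = del], divided by [p]. *)
Lemma hardy_jump (r M : R) j : 0 < r -> 0 < M ->
  jump (n := n) s p r (fun k => mass_const * M * (2^-1 ^+ m / th) ^+ k) j =
  (chain_const (n := n) s p * mass_const) `^ p^-1 * (r `^ (s - n%:R / p) * M `^ p^-1) *
    (2^-1 `^ (del / p)) ^+ j.
Proof.
move=> r0 M0; have /andP[t0 t1] := th01.
have cc := @chain_const_gt0 R n s p n_gt0.
have mc : 0 < mass_const by apply: lt_le_trans mass_const_ge1.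
have h0 : 0 <= 2^-1 :> R by rewrite invr_ge0.
have hn0 : (2^-1 : R) != 0 by rewrite invr_eq0.
have half_pow e : (2^-1 ^+ j) `^ e = (2^-1 `^ e) ^+ j :> R.
  by rewrite -(powR_mulrn j h0) powRAC powR_mulrn // powR_ge0.
have j0 : 0 < (2^-1 : R) ^+ j by rewrite exprn_gt0 // invr_gt0.
have E1 : (2^-1 ^+ m / th) ^+ j = (2^-1 ^+ j) `^ (m%:R - del) :> R.
  rewrite half_pow; congr (_ ^+ _).
  by rewrite powRB ?hn0 ?implybT // powR_mulrn.
have E2 : (2^-1 ^+ m / th) ^+ j * (2^-1 ^+ j * r) `^ (s * p - n%:R) =
    (2^-1 ^+ j) `^ del * r `^ (s * p - n%:R).
  rewrite E1 powRM ?(ltW r0) ?(ltW j0) // mulrA -powRD ?(gt_eqF j0) ?implybT //.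
  by congr (_ `^ _ * _); rewrite -natr1 /del; field.
rewrite /jump.
have -> : chain_const (n := n) s p * (mass_const * M * (2^-1 ^+ m / th) ^+ j) *
    (2^-1 ^+ j * r) `^ (s * p - n%:R) =
  (chain_const (n := n) s p * mass_const) * (M * ((2^-1 ^+ j) `^ del * r `^ (s * p - n%:R))).
  by rewrite -E2; ring.
rewrite powRM; last 2 first.
- by rewrite mulr_ge0 // ltW.
- by rewrite !mulr_ge0 ?powR_ge0 // ltW.
rewrite -[RHS]mulrA; congr (_ * _).
rewrite powRM ?mulr_ge0 ?powR_ge0 ?(ltW M0) // powRM ?powR_ge0 //.
rewrite -!powRrM half_pow (_ : (s * p - n%:R) / p = s - n%:R / p); last by field.
ring.
Qed.

Section test.
Variables (v : 'rV[R]_n -> R) (z : 'rV[R]_n) (r M : R).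
Hypotheses (tv : test_function (eball z r) v) (r_gt0 : 0 < r) (M_gt0 : 0 < M).
Local Notation B := (eball z r).
Hypothesis vM : (gagliardo s p B v <= M%:E)%E.

Let cv : continuous v. Proof. by case: tv => /smooth_continuous. Qed.

(** The chain from [y0] towards a good point of the sphere ends where [v] vanishes, so
[v y0] is at most the sum of the jumps. *)
Lemma hardy_point y0 : B y0 -> (gint B v y0 <= (4 * M / vol (n := n) r 0)%:E)%E ->
  `|v y0| <= hardy_const * (r `^ (s - n%:R / p) * M `^ p^-1).
Proof.
move=> By0 gy0.
have mg : measurable_fun setT (gint B v) by apply: measurable_gint => //; exact: measurable_eball.
have [t At ht] := good_direction mg (gint_ge0 s p B v) vM M_gt0 r_gt0 th01.
have /andP[t0 t1] := th01.
have bz : enorm (cap_point z r t - z) <= r by rewrite enorm_cap_point.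
pose Ak k := mass_const * M * (2^-1 ^+ m / th) ^+ k.
have Ak0 k : 0 < Ak k.
  rewrite mulr_gt0 ?exprn_gt0 // ?divr_gt0 ?exprn_gt0 ?invr_gt0 //.
  by rewrite mulr_gt0 //; apply: lt_le_trans mass_const_ge1.
have intA k : (\int[mu]_(y in hball z r (cap_point z r t) k) gint B v y <= (Ak k)%:E)%E.
  by rewrite /Ak -(mass_arith M k r_gt0).
have gy0' : (gint B v y0 <= (4 * Ak 0%N / vol (n := n) r 0)%:E)%E.
  apply: le_trans gy0 _; rewrite lee_fin /Ak expr0 mulr1.
  rewrite ler_wpM2r ?invr_ge0 ?(ltW (vol_gt0 _ _ _)) // ler_pM2l //.
  by rewrite ler_peMl ?mass_const_ge1 // ltW.
have [N hN] := test_vanish r_gt0 tv.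
have hy0 : hball z r (cap_point z r t) 0 y0 by rewrite hball0.
have [y hy [_ ]] := chain_points n_gt0 s_gt0 p_gt1 cv r_gt0 bz Ak0 intA N hy0 gy0'.
have -> : v y = 0.
  apply: hN; have := hball_dist bz hy; have := enormB_le (cap_point z r t) y z.
  rewrite enorm_cap_point //; lra.
rewrite sub0r normrN => /le_trans; apply.
set q := 2^-1 `^ (del / p); have q01 : 0 < q < 1 by apply: powR_half_lt1; exact: divr_gt0.
have /andP[q0 q1] := q01.
apply: (@le_trans _ _ (\sum_(0 <= j < N) (chain_const (n := n) s p * mass_const) `^ p^-1 *
   (r `^ (s - n%:R / p) * M `^ p^-1) * q ^+ j)).
  by apply: ler_sum => j _; rewrite hardy_jump.
rewrite -mulr_sumr /hardy_const -/q [leRHS]mulrAC; apply: ler_wpM2l.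
  by rewrite mulr_ge0 ?mulr_ge0 ?powR_ge0.
by apply: geometric_partial; rewrite (ltW q0).
Qed.
End test.

End hardy.

(** * Capacity of balls *)

(** The estimates are proved for every positive finite bound [M] of the energy; this
covers an energy that is zero or infinite. *)
Lemma ereal_scale_le (R : realType) (K c : R) (G : \bar R) : 0 < c -> (0 <= G)%E ->
  (forall M, 0 < M -> (G <= M%:E)%E -> K <= c * M) -> ((K / c)%:E <= G)%E.
Proof.
move=> c0; case: G => [F| |] //= F0 h; last by rewrite leey.
rewrite lee_fin ler_pdivrMr // mulrC; apply/ler_addgt0Pr => e e0.
have Fe : 0 < F + e / c by rewrite ltr_wpDl // divr_gt0.
have := h _ Fe; rewrite lee_fin lerDl divr_ge0 ?(ltW e0) ?(ltW c0) // => /(_ isT).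
by rewrite mulrDr mulrCA divff ?mulr1 // gt_eqF.
Qed.

Section capacity_bounds.
Context {R : realType} {m : nat}.
Local Notation n := m.+1.
Variables (s p : R).
Hypotheses (s_gt0 : 0 < s) (s_lt1 : s < 1) (p_gt1 : 1 < p) (sp_gt1 : 1 < s * p).
Implicit Types (u v w : 'rV[R]_n -> R) (x y z : 'rV[R]_n).
Local Notation mu := (@lebesgue_rV R n).

Let a : R := n%:R + s * p.
Let p_gt0 : 0 < p. Proof. by apply: lt_trans p_gt1. Qed.
Let p_ge0 : 0 <= p. Proof. exact: ltW. Qed.
Let pn0 : p != 0. Proof. by rewrite gt_eqF. Qed.
Let n_gt0 : (0 < n)%N. Proof. by []. Qed.

Lemma poincare_arith (r M : R) : 0 < r ->
  4 * M / vol (n := n) r 0 * (2 * r) `^ a = 4 * n%:R ^+ n * 2 `^ a * M * r `^ (s * p).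
Proof.
move=> r0; rewrite /vol expr0 mul1r powRM ?(ltW r0) // [r `^ a](_ : _ = r ^+ n * r `^ (s * p)).
  have r1 : r ^+ n != 0 by rewrite expf_neq0 // gt_eqF.
  have N0 : (n%:R : R) ^+ n != 0 by rewrite expf_neq0 // gt_eqF.
  rewrite expr_div_n; move: (r ^+ n) (n%:R ^+ n : R) r1 N0 => P N P0 N0.
  by field; rewrite P0 N0.
by rewrite /a powRD ?(gt_eqF r0) ?implybT // powR_mulrn // ltW.
Qed.

Definition hardy_ball_const : R :=
  2 `^ p * (4 * n%:R ^+ n * 2 `^ a + hardy_const (m := m) s p `^ p * 2 ^+ n).

Lemma hardy_ball_const_gt0 : 0 < hardy_ball_const.
Proof.
rewrite mulr_gt0 ?powR_gt0 // addr_gt0 // mulr_gt0 ?powR_gt0 ?exprn_gt0 ?hardy_const_gt0 //.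
Qed.

(** [poincare_point] controls [v - v y0] and [hardy_point] controls [v y0]. *)
Lemma hardy_ball v z r M : test_function (eball z r) v -> 0 < r -> 0 < M ->
  (gagliardo s p (eball z r) v <= M%:E)%E ->
  (\int[mu]_(x in eball z r) (`|v x| `^ p)%:E <= (hardy_ball_const * r `^ (s * p) * M)%:E)%E.
Proof.
move=> tv r0 M0 vM.
have cv : continuous v by case: tv => /smooth_continuous.
have mB : measurable (eball z r) by exact: measurable_eball.
have [y0 By0 gy0] := base_point n_gt0 cv r0 M0 vM.
have hp := hardy_point s_gt0 p_gt1 sp_gt1 tv r0 M0 vM By0 gy0.
have pp := poincare_point s_gt0 p_gt1 cv By0 gy0.
have mv : measurable_fun (eball z r) (fun x => (`|v x - v y0| `^ p)%:E).
  apply: measurable_funTS; apply/measurable_EFinP.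
  apply: (measurableT_comp (@measurable_powR R _)).
  apply: (measurableT_comp (@normr_measurable R setT)).
  by apply: measurable_funB; [exact: measurable_cont|exact: measurable_cst].
apply: (@le_trans _ _ (\int[mu]_(x in eball z r)
   ((2 `^ p)%:E * ((`|v x - v y0| `^ p)%:E + (`|v y0| `^ p)%:E)))%E).
  apply: ge0_le_integralW => x _; first by rewrite lee_fin powR_ge0.
  rewrite -EFinM lee_fin; apply: (@le_trans _ _ ((`|v x - v y0| + `|v y0|) `^ p)).
    by apply: powR_le => //; rewrite -{1}[v x](subrK (v y0)) ler_normD.
  by apply: powR_add_le.
rewrite ge0_integralZl ?lee_fin ?powR_ge0 //; last 2 first.
- by apply: emeasurable_funD => //; exact: measurable_cst.
- by move=> x _; rewrite -EFinD lee_fin addr_ge0 ?powR_ge0.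
rewrite ge0_integralD //.
rewrite (integral_cst mu mB (`|v y0| `^ p)%:E).
have E : hardy_ball_const * r `^ (s * p) * M = 2 `^ p *
    (4 * n%:R ^+ n * 2 `^ a * M * r `^ (s * p) +
     hardy_const (m := m) s p `^ p * (r `^ (s * p) / r ^+ n * M) * (2 * r) ^+ n).
  have r1 : r ^+ n != 0 by rewrite expf_neq0 // gt_eqF.
  rewrite /hardy_ball_const exprMn; move: (r ^+ n) r1 => P P0; by field.
rewrite E [X in (_ <= X)%E]EFinM lee_wpmul2l ?lee_fin ?powR_ge0 // EFinD leeD //.
  by rewrite -poincare_arith.
rewrite EFinM; apply: le_trans (lee_wpmul2l _ (lebesgue_eball_le z (ltW r0))) _.
  by rewrite lee_fin powR_ge0.
rewrite lee_wpmul2r ?lee_fin ?exprn_ge0 ?mulr_ge0 ?(ltW r0) //.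
apply: le_trans (powR_le p_ge0 (normr_ge0 _) hp) _.
rewrite powRM; last 2 first.
- by apply: ltW; exact: hardy_const_gt0.
- by rewrite mulr_ge0 ?powR_ge0.
rewrite ler_wpM2l ?powR_ge0 // powRM ?powR_ge0 // powRVK ?(ltW M0) //.
rewrite -powRrM (_ : (s - n%:R / p) * p = s * p - n%:R); last by field.
by rewrite powRB ?(gt_eqF r0) ?implybT // powR_mulrn // ltW.
Qed.

(** The Hardy inequality turned into a lower bound for the energy of competitors; it serves
for the capacity of a ball and for one of the two cases of [competitor_bound]. *)
Lemma seminorm_lower v z r (D : set 'rV[R]_n) (c w : R) :
  test_function (eball z r) v -> 0 < r -> 0 <= c -> 0 <= w ->
  measurable D -> D `<=` eball z r -> (forall x, D x -> c <= v x) -> (w%:E <= mu D)%E ->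
  ((c `^ p * w / (hardy_ball_const * r `^ (s * p)))%:E <= gagliardo s p (eball z r) v)%E.
Proof.
move=> tv r0 c0 w0 mD DB Dc wD.
apply: ereal_scale_le; first by rewrite mulr_gt0 ?powR_gt0 // hardy_ball_const_gt0.
  exact: gagliardo_ge0.
move=> M M0 vM; rewrite -lee_fin; apply: le_trans (hardy_ball tv r0 M0 vM).
apply: (@le_trans _ _ (\int[mu]_(x in D) (`|v x| `^ p)%:E)%E).
  rewrite EFinM; apply: (@le_trans _ _ ((c `^ p)%:E * mu D)%E).
    by rewrite lee_wpmul2l // lee_fin powR_ge0.
  apply: integral_ge_cst; rewrite ?powR_ge0 // => x Dx; rewrite lee_fin.
  by apply: powR_le => //; apply: le_trans (Dc _ Dx) _; exact: ler_norm.
by apply: ge0_subset_integralW => // x _; rewrite lee_fin powR_ge0.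
Qed.

Definition cap_lower_const : R := (n%:R ^+ n * hardy_ball_const * 2 `^ (s * p))^-1.

Lemma cap_lower_const_gt0 : 0 < cap_lower_const.
Proof. by rewrite invr_gt0 mulr_gt0 ?powR_gt0 // mulr_gt0 ?exprn_gt0 ?hardy_ball_const_gt0. Qed.

Lemma cap_lower z r : 0 < r ->
  ((cap_lower_const * r `^ (n%:R - s * p))%:E <=
   Cap s p (closure (eball z r)) (eball z (2 * r)))%E.
Proof.
move=> r0; apply: le_ereal_inf_tmp => _ [v [tv v1] <-].
have r20 : 0 < 2 * r by rewrite mulr_gt0.
have sub : eball z r `<=` eball z (2 * r) by apply: sub_eball; rewrite subrr enorm0; lra.
have wD : (((r / n%:R) ^+ n)%:E <= mu (eball z r))%E by exact: lebesgue_eball_ge.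
have w0 : 0 <= (r / n%:R) ^+ n by rewrite exprn_ge0 // divr_ge0 // ltW.
have v1' x : eball z r x -> 1 <= v x by move=> Bx; apply: v1; exact: subset_closure.
apply: le_trans (seminorm_lower tv r20 ler01 w0 (measurable_eball z r) sub v1' wD).
rewrite lee_fin le_eqVlt; apply/orP; left; apply/eqP.
rewrite powR1 mul1r /cap_lower_const powRM ?(ltW r0) // expr_div_n.
rewrite powRB ?(gt_eqF r0) ?implybT // powR_mulrn ?(ltW r0) //.
have h0 := hardy_ball_const_gt0.
have N0 : (n%:R : R) ^+ n != 0 by rewrite expf_neq0 // gt_eqF.
have r1 : r `^ (s * p) != 0 by rewrite gt_eqF // powR_gt0.
have t1 : 2 `^ (s * p) != 0 :> R by rewrite gt_eqF // powR_gt0.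
move: (n%:R ^+ n : R) (r `^ (s * p)) (2 `^ (s * p) : R) N0 r1 t1 => N P T N0 P0 T0.
by field; rewrite N0 P0 T0 gt_eqF.
Qed.

Lemma cutoff_lip_ball (w : 'rV[R]_n) z d r x y : 0 < d -> eball z r x -> eball z r y ->
  `|cutoff w d x - cutoff w d y| <=
   step_lip * (d ^+ 2)^-1 * (2 * (r + enorm (z - w))) * enorm (x - y).
Proof.
move=> d0 Bx By; apply: le_trans (cutoff_lip w x y d0) _.
apply: ler_wpM2r; first exact: enorm_ge0.
apply: ler_wpM2l.
  by rewrite mulr_ge0 ?invr_ge0 ?exprn_ge0 ?(ltW d0) // ltW // step_lip_gt0.
have := enormB_le x z w; have := enormB_le y z w; move: Bx By; rewrite /eball /=; lra.
Qed.

Lemma test_cutoff (w : 'rV[R]_n) d : 0 < d -> test_function (eball w d) (cutoff w d).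
Proof.
move=> d0; have E : cutoff w d = cutoff w d \* (fun=> 1) by apply/funext => x /=; rewrite mulr1.
rewrite E; apply: test_cutoff_mul => //; first exact: smooth_cst.
exact: supp_cutoff_mul.
Qed.

Definition cap_upper_const : R :=
  step_lip `^ p * (ker_const (n := n) s p * 4 `^ (p - s * p)) * 4 ^+ n.

Lemma cap_upper_const_gt0 : 0 < cap_upper_const.
Proof.
rewrite mulr_gt0 ?exprn_gt0 // mulr_gt0 ?powR_gt0 ?step_lip_gt0 //.
by rewrite mulr_gt0 ?powR_gt0 // ker_const_gt0.
Qed.

(** The competitor is the cutoff of radius [2 r]: a Lipschitz constant of order [1/r] on a
ball of radius [2 r]. *)
Lemma cap_upper z r : 0 < r ->
  (Cap s p (closure (eball z r)) (eball z (2 * r)) <=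
   (cap_upper_const * r `^ (n%:R - s * p))%:E)%E.
Proof.
move=> r0; have r20 : 0 < 2 * r by rewrite mulr_gt0.
apply: (@le_trans _ _ (gagliardo s p (eball z (2 * r)) (cutoff z (2 * r)))).
  apply: ereal_inf_lbound; exists (cutoff z (2 * r)) => //; split; first exact: test_cutoff.
  move=> x /closure_eball_le xz; rewrite cutoff_eq1 //; apply: le_trans xz _; lra.
have L0 : 0 <= step_lip / r :> R by rewrite divr_ge0 ?(ltW r0) // ltW // step_lip_gt0.
apply: le_trans (gagliardo_lip s_gt0 s_lt1 p_gt1 r20 L0 _) _.
  move=> x y Bx By; apply: le_trans (cutoff_lip_ball z r20 Bx By) _.
  rewrite subrr enorm0 addr0 le_eqVlt; apply/orP; left; apply/eqP.
  by field; rewrite gt_eqF.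
rewrite lee_fin le_eqVlt; apply/orP; left; apply/eqP.
rewrite /cap_upper_const (_ : 2 * (2 * r) = 4 * r); last by ring.
have sl := @step_lip_gt0 R.
have E1 : (step_lip / r) `^ p = step_lip `^ p / r `^ p.
  rewrite powRM ?invr_ge0 ?(ltW r0) ?(ltW sl) //; congr (_ * _).
  by rewrite -(powR_inv1 (ltW r0)) powRAC powR_inv1 // powR_ge0.
have E2 : (4 * r) `^ (p - s * p) = 4 `^ (p - s * p) * (r `^ p / r `^ (s * p)).
  by rewrite powRM ?(ltW r0) // [r `^ (p - _)]powRB ?(gt_eqF r0) ?implybT.
have E3 : r `^ (n%:R - s * p) = r ^+ n / r `^ (s * p).
  by rewrite powRB ?(gt_eqF r0) ?implybT // powR_mulrn // ltW.
rewrite E1 E2 E3 exprMn.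
have r1 : r `^ (s * p) != 0 by rewrite gt_eqF // powR_gt0.
have r2 : r `^ p != 0 by rewrite gt_eqF // powR_gt0.
move: (r `^ (s * p)) (r `^ p) r1 r2 => P Q P0 Q0.
by field; rewrite P0 Q0.
Qed.
End capacity_bounds.

(** * From fatness to the Poincaré inequality *)

(** The counterpart of [ereal_scale_le] for upper bounds of order [M^(1/p)]. *)
Lemma ereal_powR_limit (R : realType) (K p : R) (X G : \bar R) : 0 < K -> 0 < p -> (0 <= G)%E ->
  (forall M, 0 < M -> (G <= M%:E)%E -> (X <= (K * M `^ p^-1)%:E)%E) ->
  (X <= K%:E * G `^ p^-1)%E.
Proof.
move=> K0 p0; have pi0 : p^-1 != 0 by rewrite gt_eqF // invr_gt0.
case: G => [F| |] // F0 h; last by rewrite poweRyr // gt0_muley ?lte_fin // leey.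
rewrite poweR_EFin -EFinM; move: F0 h; rewrite lee_fin le_eqVlt => /predU1P[<-|F0] h.
  rewrite powR0 // mulr0; apply/lee_addgt0Pr => e e0; rewrite add0e.
  have M0 : 0 < (e / K) `^ p by rewrite powR_gt0 // divr_gt0.
  have hM : (0%:E <= ((e / K) `^ p)%:E)%E by rewrite lee_fin ltW.
  have := h _ M0 hM.
  rewrite powRK ?(ltW (divr_gt0 e0 K0)) ?gt_eqF // mulrC divfK // gt_eqF //.
by apply: h.
Qed.

Section fat_to_poincare.
Context {R : realType} {m : nat}.
Local Notation n := m.+1.
Variables (s p q tau : R).
Hypotheses (s_gt0 : 0 < s) (s_lt1 : s < 1) (p_gt1 : 1 < p) (sp_gt1 : 1 < s * p).
Hypotheses (q_ge1 : 1 <= q) (tau_gt0 : 0 < tau) (tau_ge : n%:R / p - s <= tau)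
  (tau_q : q * tau <= p * (tau + s)).
Implicit Types (u v w : 'rV[R]_n -> R) (x y z : 'rV[R]_n).
Local Notation mu := (@lebesgue_rV R n).

Let a : R := n%:R + s * p.
Let p_gt0 : 0 < p. Proof. by apply: lt_trans p_gt1. Qed.
Let p_ge0 : 0 <= p. Proof. exact: ltW. Qed.
Let pn0 : p != 0. Proof. by rewrite gt_eqF. Qed.
Let q_gt0 : 0 < q. Proof. by apply: lt_le_trans q_ge1. Qed.
Let n_gt0 : (0 < n)%N. Proof. by []. Qed.

Lemma Cap_sub (K K' U : set 'rV[R]_n) : K `<=` K' -> (Cap s p K U <= Cap s p K' U)%E.
Proof.
move=> KK'; apply: ereal_inf_le_tmp => _ [v [tv v1] <-].
by exists v => //; split => // x /KK'; exact: v1.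
Qed.

(** Capacity is monotone in the compact set, and the capacity of a closed ball is positive
and finite. *)
Lemma fat_le1 (E : set 'rV[R]_n) gamma x : E x -> uniformly_fat s p E gamma -> gamma <= 1.
Proof.
move=> Ex [_ g0 /(_ x 1 Ex ltr01)] h.
have low := cap_lower s_gt0 p_gt1 sp_gt1 x (@ltr01 R).
have := le_trans h (Cap_sub (eball x (2 * 1)) (@subIsetr _ E (closure (eball x 1)))).
have := cap_upper s_gt0 s_lt1 p_gt1 x (@ltr01 R).
move: low; case: (Cap _ _ _ _) => [c| |] //; rewrite !lee_fin powR1 !mulr1 => hc _.
have c0 : 0 < c by apply: lt_le_trans hc; exact: cap_lower_const_gt0.
by rewrite ger_pMl.
Qed.

Definition cutoff_mul_const : R :=
  (2 * step_lip) `^ p * ker_const (n := n) s p * 2 `^ (p - s * p) * (4 * n%:R ^+ n * 2 `^ a).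

Lemma cutoff_mul_const_gt0 : 0 < cutoff_mul_const.
Proof.
have k0 := @ker_const_gt0 R n s p s_lt1 p_gt1.
apply: mulr_gt0; last by rewrite !mulr_gt0 ?powR_gt0 ?exprn_gt0.
by apply: mulr_gt0; rewrite ?powR_gt0 // mulr_gt0 // powR_gt0 // mulr_gt0 // step_lip_gt0.
Qed.

Definition level_const : R :=
  2 `^ p * (1 + cutoff_mul_const) * 2 `^ (n%:R - s * p) / cap_lower_const (m := m) s p.

Lemma level_const_gt0 : 0 < level_const.
Proof.
have k0 := cutoff_mul_const_gt0.
have c0 := @cap_lower_const_gt0 R m s p p_gt1 sp_gt1.
apply: divr_gt0 => //; apply: mulr_gt0; last by rewrite powR_gt0.
by apply: mulr_gt0; [rewrite powR_gt0|rewrite addr_gt0].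
Qed.

Section level.
Variables (Omega : set 'rV[R]_n) (gamma : R) (u : 'rV[R]_n -> R) (z : 'rV[R]_n) (r M : R).
Hypotheses (fat : uniformly_fat s p (~` Omega) gamma) (zO : ~ Omega z)
  (tu : test_function Omega u) (r_gt0 : 0 < r) (M_gt0 : 0 < M).
Local Notation B := (eball z r).
Hypothesis uM : (gagliardo s p B u <= M%:E)%E.
Variable y0 : 'rV[R]_n.
Hypotheses (By0 : B y0) (gy0 : (gint s p B u y0 <= (4 * M / vol (n := n) r 0)%:E)%E).

Let su : smooth u. Proof. by case: tu. Qed.
Let cu : continuous u. Proof. exact: smooth_continuous. Qed.

Lemma vanish_outside x : ~ Omega x -> u x = 0.
Proof.
move=> nO; apply/eqP; apply: contrapT => /negP ux; apply: nO.
by have [_ _ sO] := tu; apply: sO; exact: subset_closure.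
Qed.

(** The competitor is [w = eta (1 - u / u y0)], equal to 1 on the part of the half ball
outside [Omega], since [u] vanishes there.  The factor [1 - u / u y0] has mean size controlled by
[poincare_point], which pays for the gradient of the cutoff [eta]. *)
Lemma level_bound : `|u y0| `^ p * gamma <= level_const * M * r `^ (s * p - n%:R).
Proof.
have [_ g0 hfat] := fat.
have K0 := level_const_gt0.
have [->|u0] := eqVneq (u y0) 0.
  by rewrite normr0 powR0 // mul0r mulr_ge0 ?powR_ge0 // mulr_ge0 ?(ltW K0) ?(ltW M_gt0).
have nu0 : 0 < `|u y0| by rewrite normr_gt0.
(* [w1] is a Lipschitz function of [u], with constant [lam]. *)
pose lam := `|u y0|^-1; have lam0 : 0 <= lam by rewrite invr_ge0.
pose w1 := (fun t => 1 - t / u y0) \o u.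
pose w := cutoff z r \* w1.
have sw1 : smooth w1.
  have h := smooth_D (smooth_cst 1) (smooth_M su (smooth_cst (- (u y0)^-1))).
  by move=> k; apply: eq_Ck (h k) => x /=; rewrite mulrN.
have cw1 : continuous w1 by exact: smooth_continuous.
have mB : measurable B by exact: measurable_eball.
have tw : test_function B w by apply: test_cutoff_mul => //; exact: supp_cutoff_mul.
have r2 : 2 * (r / 2) = r by field.
have r20 : 0 < r / 2 by rewrite divr_gt0.
have capw : (Cap s p (~` Omega `&` closure (eball z (r / 2))) (eball z (2 * (r / 2))) <=
    gagliardo s p B w)%E.
  rewrite r2; apply: ereal_inf_lbound; exists w => //; split => // x [Ox /closure_eball_le xz].
  by rewrite /w /w1 /= vanish_outside // mul0r subr0 mulr1 cutoff_eq1.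
have gw1 : (gagliardo s p B w1 <= (lam `^ p * M)%:E)%E.
  have hphi t t' : `|(1 - t / u y0) - (1 - t' / u y0)| <= lam * `|t - t'|.
    by rewrite opprB addrC addrA subrK -mulrBl normrM normfV mulrC distrC.
  apply: le_trans (gagliardo_comp s p_gt1 mB cu lam0 hphi) _.
  by rewrite EFinM lee_wpmul2l // lee_fin powR_ge0.
have iw1 : (\int[mu]_(x in B) (`|w1 x| `^ p)%:E <=
    (lam `^ p * (4 * n%:R ^+ n * 2 `^ a * M * r `^ (s * p)))%:E)%E.
  have -> : (\int[mu]_(x in B) (`|w1 x| `^ p)%:E =
      \int[mu]_(x in B) ((lam `^ p)%:E * (`|u x - u y0| `^ p)%:E))%E.
    apply: eq_integral => x _; rewrite -EFinM -powRM //; congr ((_ `^ _)%:E).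
    have -> : w1 x = - ((u x - u y0) / u y0) by rewrite /w1 /=; field.
    by rewrite normrN normrM normfV mulrC.
  rewrite ge0_integralZl ?lee_fin ?powR_ge0 //.
    rewrite EFinM lee_wpmul2l ?lee_fin ?powR_ge0 //.
    by rewrite -poincare_arith //; exact: (poincare_point s_gt0 p_gt1 cu By0 gy0).
  apply: measurable_funTS; apply/measurable_EFinP.
  apply: (measurableT_comp (@measurable_powR R _)).
  apply: (measurableT_comp (@normr_measurable R setT)).
  by apply: measurable_funB; [exact: measurable_cont|exact: measurable_cst].
have L0 : 0 <= 2 * step_lip / r :> R.
  by rewrite divr_ge0 ?(ltW r_gt0) // mulr_ge0 // ltW // step_lip_gt0.
have gw : (gagliardo s p B w <= (2 `^ p * (1 + cutoff_mul_const) * (lam `^ p * M))%:E)%E.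
  have cc : continuous (cutoff z r) by exact: smooth_continuous (smooth_cutoff z r).
  have c1 x : `|cutoff z r x| <= 1 by rewrite ger0_norm ?cutoff_ge0 // cutoff_le1.
  have cL x y : B x -> B y ->
      `|cutoff z r x - cutoff z r y| <= 2 * step_lip / r * enorm (x - y).
    move=> Bx By; apply: le_trans (cutoff_lip_ball z r_gt0 Bx By) _.
    rewrite subrr enorm0 addr0 le_eqVlt; apply/orP; left; apply/eqP.
    by field; rewrite gt_eqF.
  have := gagliardo_mul s_gt0 s_lt1 p_gt1 r_gt0 L0 cc cw1 c1 cL.
  move=> /le_trans; apply.
  set C := (2 * step_lip / r) `^ p * _.
  have C0 : 0 <= C.
    by rewrite mulr_ge0 ?powR_ge0 // mulr_ge0 ?powR_ge0 // ltW // ker_const_gt0.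
  rewrite -mulrA [X in (_ <= X)%E]EFinM lee_wpmul2l ?lee_fin ?powR_ge0 //.
  rewrite mulrDl mul1r EFinD leeD //.
  apply: le_trans (lee_wpmul2l _ iw1) _; first by rewrite lee_fin.
  rewrite -EFinM lee_fin le_eqVlt; apply/orP; left; apply/eqP.
  have sl := @step_lip_gt0 R.
  have E1 : (2 * step_lip / r) `^ p = (2 * step_lip) `^ p / r `^ p.
    have sl2 : 0 <= 2 * step_lip :> R by rewrite mulr_ge0 // ltW.
    have ri : 0 <= r^-1 by rewrite invr_ge0 ltW.
    rewrite (powRM _ sl2 ri); congr (_ * _).
    by rewrite -(powR_inv1 (ltW r_gt0)) powRAC powR_inv1 // powR_ge0.
  have E2 : (2 * r) `^ (p - s * p) = 2 `^ (p - s * p) * (r `^ p / r `^ (s * p)).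
    by rewrite powRM ?(ltW r_gt0) // [r `^ (p - _)]powRB ?(gt_eqF r_gt0) ?implybT.
  rewrite /C E1 E2 /cutoff_mul_const.
  have r1 : r `^ (s * p) != 0 by rewrite gt_eqF // powR_gt0.
  have r3 : r `^ p != 0 by rewrite gt_eqF // powR_gt0.
  move: (r `^ (s * p)) (r `^ p) r1 r3 => P Q P0 Q0.
  by field; rewrite P0 Q0.
have c0 := @cap_lower_const_gt0 R m s p p_gt1 sp_gt1.
have main : gamma * (cap_lower_const (m := m) s p * (r / 2) `^ (n%:R - s * p)) <=
    2 `^ p * (1 + cutoff_mul_const) * (lam `^ p * M).
  rewrite -lee_fin; apply: le_trans gw; apply: le_trans capw.
  apply: le_trans (hfat z (r / 2) zO r20).
  rewrite EFinM lee_wpmul2l ?lee_fin ?(ltW g0) //.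
  exact: cap_lower.
have lamE : lam `^ p = (`|u y0| `^ p)^-1.
  by rewrite /lam -(powR_inv1 (normr_ge0 _)) powRAC powR_inv1 // powR_ge0.
have E3 : (r / 2) `^ (n%:R - s * p) = (r `^ (s * p - n%:R))^-1 / 2 `^ (n%:R - s * p).
  rewrite powRM ?invr_ge0 ?(ltW r_gt0) //; congr (_ * _).
    by rewrite -powRN opprB.
  by rewrite -(powR_inv1 (ler0n R 2)) powRAC powR_inv1 // powR_ge0.
move: main; rewrite lamE E3 /level_const.
have U0 : 0 < `|u y0| `^ p by rewrite powR_gt0.
have P0 : 0 < r `^ (s * p - n%:R) by rewrite powR_gt0.
have T0 : 0 < 2 `^ (n%:R - s * p) :> R by rewrite powR_gt0.
move: (`|u y0| `^ p) (r `^ _) (2 `^ (n%:R - s * p)) (2 `^ p * _) (cap_lower_const s p) U0 P0 T0 c0.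
move=> U P T K c U0 P0 T0 c0 h.
have := ler_wpM2r (ltW (mulr_gt0 U0 (divr_gt0 (mulr_gt0 P0 T0) c0))) h.
have -> : gamma * (c * (P^-1 / T)) * (U * (P * T / c)) = U * gamma.
  by field; rewrite !gt_eqF.
have -> : K * (U^-1 * M) * (U * (P * T / c)) = K * T / c * M * P.
  by field; rewrite !gt_eqF.
by [].
Qed.

Definition fat_poincare_const0 : R :=
  2 `^ q * ((2 * sob_const (n := n) s p tau) `^ q * (2 `^ tau) `^ q * (2 * 2 ^+ n + 1) +
    (level_const `^ p^-1) `^ q * 2 ^+ n).

(** [u = (u - u y0) + u y0]; the Sobolev inequality bounds the first part without
[gamma], and [gamma <= 1] absorbs this in the factor [gamma^(-1/p)]. *)
Lemma fat_integral_bound : gamma <= 1 ->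
  (\int[mu]_(x in B) (`|u x| `^ q)%:E <=
   (fat_poincare_const0 * r ^+ n *
     (gamma `^ (- p^-1) * (r `^ (s - n%:R / p) * M `^ p^-1)) `^ q)%:E)%E.
Proof.
move=> g1; have [_ g0 _] := fat.
have mB : measurable B by exact: measurable_eball.
set scal := r `^ (s - n%:R / p) * M `^ p^-1.
have scal0 : 0 <= scal by rewrite mulr_ge0 ?powR_ge0.
set X := gamma `^ (- p^-1) * scal.
have gp1 : 1 <= gamma `^ (- p^-1).
  rewrite powRN invf_ge1 ?powR_gt0 //.
  have pi0 : 0 <= p^-1 by rewrite invr_ge0.
  by have := powR_le pi0 (ltW g0) g1; rewrite powR1.
have sX : scal <= X by rewrite ler_peMl.
have X0 : 0 <= X by apply: le_trans sX.
have lev : `|u y0| <= level_const `^ p^-1 * X.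
  have h : `|u y0| `^ p <= level_const * (gamma^-1 * (r `^ (s * p - n%:R) * M)).
    have := level_bound; rewrite -ler_pdivlMr // => /le_trans; apply.
    by rewrite le_eqVlt; apply/orP; left; apply/eqP; field; rewrite gt_eqF.
  rewrite -[leLHS](powRK _ pn0) //.
  apply: le_trans (powR_le _ (powR_ge0 _ _) h) _; first by rewrite invr_ge0.
  have l0 := level_const_gt0; have ig0 : 0 <= gamma^-1 by rewrite invr_ge0 ltW.
  rewrite powRM ?(ltW l0) ?mulr_ge0 ?powR_ge0 ?(ltW M_gt0) // ler_wpM2l ?powR_ge0 //.
  rewrite powRM ?mulr_ge0 ?powR_ge0 ?(ltW M_gt0) //.
  rewrite powRM ?powR_ge0 ?(ltW M_gt0) // -powRrM (_ : (s * p - n%:R) / p = s - n%:R / p);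
    last by field.
  rewrite -/scal /X ler_wpM2r // -(powR_inv1 (ltW g0)) -powRrM mulN1r //.
have sob := sobolev_ball n_gt0 s_gt0 p_gt1 q_gt0 tau_gt0 tau_ge tau_q cu r_gt0 M_gt0 uM By0 gy0.
have mq : measurable_fun B (fun x => (`|u x - u y0| `^ q)%:E).
  apply: measurable_funTS; apply/measurable_EFinP.
  apply: (measurableT_comp (@measurable_powR R _)).
  apply: (measurableT_comp (@normr_measurable R setT)).
  by apply: measurable_funB; [exact: measurable_cont|exact: measurable_cst].
apply: (@le_trans _ _ (\int[mu]_(x in B)
   ((2 `^ q)%:E * ((`|u x - u y0| `^ q)%:E + (`|u y0| `^ q)%:E)))%E).
  apply: ge0_le_integralW => x _; first by rewrite lee_fin powR_ge0.
  rewrite -EFinM lee_fin; apply: (@le_trans _ _ ((`|u x - u y0| + `|u y0|) `^ q)).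
    by apply: powR_le => //; [exact: ltW|rewrite -{1}[u x](subrK (u y0)) ler_normD].
  by apply: powR_add_le => //; exact: ltW.
rewrite ge0_integralZl ?lee_fin ?powR_ge0 //; last 2 first.
- by apply: emeasurable_funD => //; exact: measurable_cst.
- by move=> x _; rewrite -EFinD lee_fin addr_ge0 ?powR_ge0.
rewrite ge0_integralD // (integral_cst mu mB (`|u y0| `^ q)%:E).
rewrite /fat_poincare_const0.
set S1 := (2 * sob_const s p tau) `^ q * (2 `^ tau) `^ q * (2 * 2 ^+ n + 1).
set S2 := (level_const `^ p^-1) `^ q * 2 ^+ n.
have -> : 2 `^ q * (S1 + S2) * r ^+ n * X `^ q =
  2 `^ q * (S1 * r ^+ n * X `^ q + S2 * r ^+ n * X `^ q) by ring.
rewrite [X in (_ <= X)%E]EFinM lee_wpmul2l ?lee_fin ?powR_ge0 // EFinD leeD //.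
  apply: le_trans sob _; rewrite lee_fin -/scal.
  have sc0 : 0 <= 2 * sob_const (n := n) s p tau.
    by apply: mulr_ge0 => //; apply: ltW; exact: sob_const_gt0.
  rewrite (powRM q sc0 scal0) /S1.
  have A0 : 0 <= (2 * sob_const (n := n) s p tau) `^ q by exact: powR_ge0.
  have T0 : 0 <= (2 `^ tau) `^ q :> R by exact: powR_ge0.
  have N0 : 0 <= 2 * 2 ^+ n + 1 :> R by rewrite addr_ge0 // mulr_ge0 // exprn_ge0.
  have P0 : 0 <= r ^+ n by rewrite exprn_ge0 // ltW.
  have SX : scal `^ q <= X `^ q by apply: powR_le => //; exact: ltW.
  move: (_ `^ q) ((2 `^ tau) `^ q) (2 * 2 ^+ n + 1) (r ^+ n) (scal `^ q) (X `^ q) A0 T0 N0 P0 SX.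
  move=> A1 T N P S Y A0 T0 N0 P0 SY.
  have -> : A1 * S * T * N * P = A1 * T * N * P * S by ring.
  by rewrite ler_wpM2l // mulr_ge0 // mulr_ge0 // mulr_ge0.
apply: le_trans (lee_wpmul2l _ (lebesgue_eball_le z (ltW r_gt0))) _.
  by rewrite lee_fin powR_ge0.
rewrite -EFinM lee_fin exprMn /S2.
have -> : (level_const `^ p^-1) `^ q * 2 ^+ n * r ^+ n * X `^ q =
  (level_const `^ p^-1 * X) `^ q * (2 ^+ n * r ^+ n).
  by rewrite powRM ?powR_ge0 //; ring.
rewrite ler_wpM2r ?mulr_ge0 ?exprn_ge0 ?(ltW r_gt0) //.
by apply: powR_le => //; exact: ltW.
Qed.
End level.

Definition fat_poincare_const : R := (fat_poincare_const0 * n%:R ^+ n) `^ q^-1.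

Lemma fat_poincare_const0_gt0 : 0 < fat_poincare_const0.
Proof.
have l0 := level_const_gt0; have s0 := @sob_const_gt0 R n s p tau n_gt0 tau_gt0.
apply: mulr_gt0; first by rewrite powR_gt0.
apply: addr_gt0; last by rewrite mulr_gt0 ?powR_gt0 ?exprn_gt0.
rewrite mulr_gt0 ?mulr_gt0 ?powR_gt0 ?mulr_gt0 // addr_gt0 // mulr_gt0 // exprn_gt0 //.
Qed.

Lemma fat_poincare_const_gt0 : 0 < fat_poincare_const.
Proof. by rewrite powR_gt0 // mulr_gt0 ?exprn_gt0 ?fat_poincare_const0_gt0. Qed.

Lemma fat_to_poincare (Omega : set 'rV[R]_n) gamma :
  uniformly_fat s p (~` Omega) gamma ->
  local_poincare s p Omega q (fat_poincare_const * gamma `^ (- p^-1)).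
Proof.
move=> fat z r zO r0 u tu; have [_ g0 _] := fat.
have g1 : gamma <= 1 by exact: (@fat_le1 _ gamma z zO fat).
have cu : continuous u by case: tu => /smooth_continuous.
have C0 := fat_poincare_const_gt0.
apply: ereal_powR_limit => //.
- by apply: mulr_gt0; [apply: mulr_gt0 => //|]; apply: powR_gt0.
- exact: gagliardo_ge0.
move=> M M0 uM; have [y0 By0 gy0] := base_point n_gt0 cu r0 M0 uM.
have := fat_integral_bound fat zO tu r0 M0 uM By0 gy0 g1.
set X := gamma `^ (- p^-1) * _.
have X0 : 0 <= X by rewrite mulr_ge0 ?powR_ge0 // mulr_ge0 ?powR_ge0.
have : (0 <= \int[mu]_(x in eball z r) (`|u x| `^ q)%:E)%E.
  by apply: integral_ge0 => x _; rewrite lee_fin powR_ge0.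
case: (integral _ _ _) => [i| |] //; rewrite !lee_fin => i0 hi.
have := lebesgue_eball_ge z n_gt0 r0; have := lebesgue_eball_le z (ltW r0).
case: (lebesgue_rV n (eball z r)) => [b| |] //; rewrite !lee_fin => _ hb.
have rn0 : 0 < (r / n%:R) ^+ n by rewrite exprn_gt0 // divr_gt0.
have b0 : 0 < b by apply: lt_le_trans hb.
rewrite inver gt_eqF // -EFinM poweR_EFin lee_fin.
have -> : fat_poincare_const * gamma `^ (- p^-1) * r `^ (s - n%:R / p) * M `^ p^-1 =
  fat_poincare_const * X by rewrite /X; ring.
have -> : X = (X `^ q) `^ q^-1 by rewrite powRK // gt_eqF.
have c0 := fat_poincare_const0_gt0.
rewrite /fat_poincare_const -powRM ?powR_ge0 //; last by rewrite mulr_ge0 ?exprn_ge0 ?ltW.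
apply: powR_le; rewrite ?invr_ge0 ?(ltW q_gt0) //; first by rewrite divr_ge0 // ltW.
rewrite ler_pdivrMr //; apply: le_trans hi _.
have -> : fat_poincare_const0 * r ^+ n * X `^ q =
   fat_poincare_const0 * n%:R ^+ n * X `^ q * (r / n%:R) ^+ n.
  by rewrite expr_div_n; field; rewrite expf_neq0 // gt_eqF.
rewrite ler_wpM2l // mulr_ge0 ?powR_ge0 // mulr_ge0 ?exprn_ge0 // ltW //.
Qed.
End fat_to_poincare.

(** * From the Poincaré inequality to fatness *)

Section poincare_to_fat.
Context {R : realType} {m : nat}.
Local Notation n := m.+1.
Variables (s p q : R).
Hypotheses (s_gt0 : 0 < s) (s_lt1 : s < 1) (p_gt1 : 1 < p) (sp_gt1 : 1 < s * p).
Hypotheses (q_ge1 : 1 <= q).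
Implicit Types (u v w : 'rV[R]_n -> R) (x y z : 'rV[R]_n).
Local Notation mu := (@lebesgue_rV R n).

Let p_gt0 : 0 < p. Proof. by apply: lt_trans p_gt1. Qed.
Let p_ge0 : 0 <= p. Proof. exact: ltW. Qed.
Let pn0 : p != 0. Proof. by rewrite gt_eqF. Qed.
Let q_gt0 : 0 < q. Proof. by apply: lt_le_trans q_ge1. Qed.
Let n_gt0 : (0 < n)%N. Proof. by []. Qed.

(** The Poincaré inequality is tested below with functions equal to 1 on a proportion [w]
of the ball. *)
Lemma mean_ge (D B : set 'rV[R]_n) u (b0 c w : R) : measurable D -> D `<=` B ->
  (forall x, D x -> u x = 1) -> 0 < b0 -> 0 < c -> 0 <= w ->
  (b0%:E <= mu B)%E -> (mu B <= c%:E)%E -> (w%:E * mu B <= mu D)%E ->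
  ((w `^ q^-1)%:E <= ((\int[mu]_(x in B) (`|u x| `^ q)%:E) / mu B) `^ q^-1)%E.
Proof.
move=> mD DB u1 b00 c0 w0.
have : (mu D <= \int[mu]_(x in B) (`|u x| `^ q)%:E)%E.
  apply: (@le_trans _ _ (\int[mu]_(x in D) (`|u x| `^ q)%:E)%E); last first.
    by apply: ge0_subset_integralW => // x _; rewrite lee_fin powR_ge0.
  rewrite -[leLHS]mul1e; apply: integral_ge_cst => // x Dx.
  by rewrite u1 // normr1 powR1.
case: (mu B) => [b| |] //; rewrite !lee_fin => h1 bb _ h2.
have b_gt0 : 0 < b by apply: lt_le_trans bb.
have := le_trans h2 h1; have : (0 <= \int[mu]_(x in B) (`|u x| `^ q)%:E)%E.
  by apply: integral_ge0 => x _; rewrite lee_fin powR_ge0.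
case: (integral _ _ _) => [i| |] //; rewrite inver gt_eqF //.
  rewrite -!EFinM poweR_EFin !lee_fin => i0 wi.
  apply: powR_le => //; first by rewrite invr_ge0 ltW.
  by rewrite ler_pdivlMr.
by rewrite gt0_mulye ?lte_fin ?invr_gt0 // poweRyr ?leey // invr_eq0 gt_eqF.
Qed.

Definition bump_seminorm_const : R :=
  (10 * step_lip) `^ p * (ker_const (n := n) s p * 6 `^ (p - s * p)) * 6 ^+ n.

Lemma bump_seminorm_const_gt0 : 0 < bump_seminorm_const.
Proof.
apply: mulr_gt0; last by rewrite exprn_gt0.
apply: mulr_gt0; first by apply: powR_gt0; rewrite mulr_gt0 // step_lip_gt0.
by apply: mulr_gt0; [exact: ker_const_gt0|apply: powR_gt0].
Qed.

(** A lower bound for the constants of all Poincaré inequalities, independent of [Omega];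
see [poincare_lowerP]. *)
Definition poincare_lower : R :=
  ((12 * n%:R) ^- n) `^ q^-1 / (3 `^ (s - n%:R / p) * bump_seminorm_const `^ p^-1).

Lemma poincare_lower_gt0 : 0 < poincare_lower.
Proof.
have b0 := bump_seminorm_const_gt0.
apply: divr_gt0; last by apply: mulr_gt0; apply: powR_gt0.
by apply: powR_gt0; rewrite invr_gt0 exprn_gt0 // mulr_gt0.
Qed.

Lemma bump_seminorm (w z : 'rV[R]_n) (d : R) : 0 < d -> enorm (z - w) <= 2 * d ->
  (gagliardo s p (eball z (3 * d)) (cutoff w d) <=
   (bump_seminorm_const * d `^ (n%:R - s * p))%:E)%E.
Proof.
move=> d0 zw; have d30 : 0 < 3 * d by rewrite mulr_gt0.
have sl := @step_lip_gt0 R.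
have L0 : 0 <= 10 * step_lip / d :> R by rewrite divr_ge0 ?(ltW d0) // mulr_ge0 // ltW.
(* Both points are at distance at most [3 d + 2 d] from [w]; hence the factor [2 * 5]. *)
have hL x y : eball z (3 * d) x -> eball z (3 * d) y ->
    `|cutoff w d x - cutoff w d y| <= 10 * step_lip / d * enorm (x - y).
  move=> Bx By; apply: le_trans (cutoff_lip_ball w d0 Bx By) _.
  apply: ler_wpM2r; first exact: enorm_ge0.
  have -> : 10 * step_lip / d = step_lip * (d ^+ 2)^-1 * (10 * d) by field; rewrite gt_eqF.
  apply: ler_wpM2l; last by lra.
  by rewrite mulr_ge0 ?invr_ge0 ?exprn_ge0 ?(ltW d0) // ltW.
have := gagliardo_lip s_gt0 s_lt1 p_gt1 d30 L0 hL.
move=> /le_trans; apply; rewrite lee_fin le_eqVlt; apply/orP; left; apply/eqP.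
rewrite /bump_seminorm_const (_ : 2 * (3 * d) = 6 * d); last by ring.
have E1 : (10 * step_lip / d) `^ p = (10 * step_lip) `^ p / d `^ p.
  have sl2 : 0 <= 10 * step_lip :> R by rewrite mulr_ge0 // ltW.
  have ri : 0 <= d^-1 by rewrite invr_ge0 ltW.
  rewrite (powRM _ sl2 ri); congr (_ * _).
  by rewrite -(powR_inv1 (ltW d0)) powRAC powR_inv1 // powR_ge0.
have E2 : (6 * d) `^ (p - s * p) = 6 `^ (p - s * p) * (d `^ p / d `^ (s * p)).
  by rewrite powRM ?(ltW d0) // [d `^ (p - _)]powRB ?(gt_eqF d0) ?implybT.
have E3 : d `^ (n%:R - s * p) = d ^+ n / d `^ (s * p).
  by rewrite powRB ?(gt_eqF d0) ?implybT // powR_mulrn // ltW.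
rewrite E1 E2 E3 exprMn.
have r1 : d `^ (s * p) != 0 by rewrite gt_eqF // powR_gt0.
have r2 : d `^ p != 0 by rewrite gt_eqF // powR_gt0.
move: (d `^ (s * p)) (d `^ p) r1 r2 => P Q P0 Q0.
by field; rewrite P0 Q0.
Qed.

(** [w] is any point of [Omega], [d] its distance to the complement, and [z] realises this
distance up to a factor 2. *)
Lemma nearly_nearest_point (Omega : set 'rV[R]_n) : open Omega -> Omega !=set0 -> Omega <> setT ->
  exists (w z : 'rV[R]_n) (d : R), [/\ 0 < d, eball w d `<=` Omega, ~ Omega z & enorm (z - w) <= 2 * d].
Proof.
move=> oO [w Ow] OT.
have [e0 nOe] : exists e, ~ Omega e.
  by apply: contrapT => h; apply: OT; apply/seteqP; split => // x _; apply: contrapT => nx; apply: h; exists x.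
pose D : set R := [set enorm (z - w) | z in ~` Omega].
have [e /= e_gt0 eO] : nbhs_ball w Omega by apply/nbhs_ballP; exact: open_nbhs_nbhs.
have lbD : lbound D e.
  move=> _ [z nz <-]; rewrite leNgt; apply/negP => h; apply: nz; apply: eO.
  split => // i j; rewrite ord1 /ball /=.
  by have := le_lt_trans (coord_le_enorm (w - z) j) _; rewrite !mxE; apply; rewrite enormBC.
have infD : has_inf D by split; [exists (enorm (e0 - w)), e0|exists e].
have d0 : 0 < inf D by apply: lt_le_trans e_gt0 _; apply: lb_le_inf; case: infD.
have [_ [z nz <-] hz] := inf_adherent d0 infD.
exists w, z, (inf D); split => //; last by apply: ltW; apply: lt_le_trans hz _; lra.
move=> x xw; apply: contrapT => nx; move: xw; rewrite /eball /= ltNge => /negP; apply.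
by apply: ge_inf; [case: infD|exists x].
Qed.

(** The cutoff of radius [d] around [w] is a test function of [Omega]; on the ball of
radius [3 d] around [z] it has a mean bounded below and an energy of order
[d^(n - s p)]. *)
Lemma poincare_lowerP (Omega : set 'rV[R]_n) (A : R) :
  open Omega -> Omega !=set0 -> Omega <> setT -> 0 < A ->
  local_poincare s p Omega q A -> poincare_lower <= A.
Proof.
move=> oO O0 OT A0 lp.
have [w [z [d [d0 wO zO zw]]]] := nearly_nearest_point oO O0 OT.
have d30 : 0 < 3 * d by rewrite mulr_gt0.
have tu : test_function Omega (cutoff w d).
  by have [h1 h2 h3] := test_cutoff w d0; split => // x /h3 /wO.
have d20 : 0 < d / 2 by rewrite divr_gt0.
pose D := eball w (d / 2).
have DB : D `<=` eball z (3 * d).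
  by apply: sub_eball; rewrite enormBC; lra.
have mD : measurable D by exact: measurable_eball.
have u1 x : D x -> cutoff w d x = 1 by move=> Dx; rewrite cutoff_eq1 // ltW.
have b1 := lebesgue_eball_ge z n_gt0 d30; have b2 := lebesgue_eball_le z (ltW d30).
have B1 : 0 < (3 * d / n%:R) ^+ n by rewrite exprn_gt0 // divr_gt0.
have B2 : 0 < (2 * (3 * d)) ^+ n by rewrite exprn_gt0 // mulr_gt0.
have w0 : 0 <= (12 * n%:R) ^- n :> R by rewrite invr_ge0 exprn_ge0 // mulr_ge0.
(* A cube of side [d / (2 n)] fits into the ball of radius [d / 2], and the ball of radius [3 d] into one
   of side [6 d]. *)
have wD : (((12 * n%:R) ^- n)%:E * mu (eball z (3 * d)) <= mu D)%E.
  apply: le_trans (lebesgue_eball_ge w n_gt0 d20).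
  apply: le_trans (lee_wpmul2l _ b2) _; first by rewrite lee_fin.
  rewrite -EFinM lee_fin -exprVn -exprMn le_eqVlt; apply/orP; left; apply/eqP.
  by congr (_ ^+ _); field; rewrite gt_eqF.
have := le_trans (mean_ge mD DB u1 B1 B2 w0 b1 b2 wD) (lp z (3 * d) zO d30 _ tu).
have := bump_seminorm d0 zw; have := gagliardo_ge0 s p (eball z (3 * d)) (cutoff w d).
case: (gagliardo _ _ _ _) => [F| |] //.
rewrite poweR_EFin -EFinM !lee_fin => F0 hF h.
rewrite /poincare_lower ler_pdivrMr; last first.
  by apply: mulr_gt0; apply: powR_gt0 => //; exact: bump_seminorm_const_gt0.
apply: le_trans h _; rewrite -[leLHS]mulrA; apply: ler_wpM2l; first exact: ltW.
have b0 := bump_seminorm_const_gt0.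
have pi0 : 0 <= p^-1 by rewrite invr_ge0.
have := powR_le pi0 F0 hF; rewrite powRM ?powR_ge0 ?(ltW b0) // -powRrM => h.
apply: le_trans (ler_wpM2l (powR_ge0 _ _) h) _.
rewrite powRM ?(ltW d0) // le_eqVlt; apply/orP; left; apply/eqP.
have E : d `^ (s - n%:R / p) * d `^ ((n%:R - s * p) / p) = 1.
  rewrite -powRD ?(gt_eqF d0) ?implybT // (_ : s - n%:R / p + (n%:R - s * p) / p = 0) ?powRr0 //.
  by field.
rewrite [X in X = _](_ : _ = 3 `^ (s - n%:R / p) * bump_seminorm_const `^ p^-1 *
  (d `^ (s - n%:R / p) * d `^ ((n%:R - s * p) / p))); last by ring.
by rewrite E mulr1.
Qed.

(** The lower bound when the competitor is large on a big part of the half ball. *)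
Definition mass_case_const : R :=
  4^-1 `^ p * ((2 * n%:R) ^- n / 2) / (hardy_ball_const (m := m) s p * 2 `^ (s * p)).

Lemma mass_case_const_gt0 : 0 < mass_case_const.
Proof.
have h0 := @hardy_ball_const_gt0 R m s p p_gt1 sp_gt1.
apply: divr_gt0; last by apply: mulr_gt0 => //; apply: powR_gt0.
apply: mulr_gt0; first by apply: powR_gt0; rewrite invr_gt0.
by rewrite divr_gt0 // invr_gt0 exprn_gt0 // mulr_gt0.
Qed.

(** The lower bound, up to [A^-p], when the competitor is small on half of the half
ball. *)
Definition level_case_const : R :=
  (2^-1 `^ q^-1) `^ p * step_lip `^ (- p) * 2 `^ (s * p - n%:R).

Lemma level_case_const_gt0 : 0 < level_case_const.
Proof.
apply: mulr_gt0; last by apply: powR_gt0.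
apply: mulr_gt0; apply: powR_gt0; last exact: step_lip_gt0.
by apply: powR_gt0; rewrite invr_gt0.
Qed.

(** Either [v >= 1/4] on a set [D] whose measure is at least half of the lower bound for
that of the half ball, and [seminorm_lower] applies; or [u = eta step(v)], with [step]
killing the set where [v] is near 1, is a test function of [Omega] equal to 1 on more
than half of the half ball. *)
Lemma competitor_bound (Omega : set 'rV[R]_n) (A : R) v x (r : R) :
  local_poincare s p Omega q A -> 0 < A -> ~ Omega x -> 0 < r ->
  test_function (eball x (2 * r)) v ->
  (forall y, (~` Omega `&` closure (eball x r)) y -> 1 <= v y) ->
  ((Num.min mass_case_const (level_case_const * A `^ (- p)) * r `^ (n%:R - s * p))%:E <=
   gagliardo s p (eball x (2 * r)) v)%E.
Proof.
move=> lp A0 xO r0 tv v1.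
have sv : smooth v by case: tv.
have cv : continuous v by exact: smooth_continuous.
have r20 : 0 < 2 * r by rewrite mulr_gt0.
have rh0 : 0 < r / 2 by rewrite divr_gt0.
set B := eball x (r / 2).
have mB : measurable B by exact: measurable_eball.
have BB : B `<=` eball x (2 * r) by apply: sub_eball; rewrite subrr enorm0; lra.
have P0 : 0 <= r `^ (n%:R - s * p) by exact: powR_ge0.
pose b0 : R := (r / 2 / n%:R) ^+ n.
have b00 : 0 < b0 by rewrite exprn_gt0 // divr_gt0.
have b1 : (b0%:E <= mu B)%E by exact: lebesgue_eball_ge.
have b2 : (mu B <= ((2 * (r / 2)) ^+ n)%:E)%E by apply: lebesgue_eball_le; exact: ltW.
have B2 : 0 < (2 * (r / 2)) ^+ n by rewrite exprn_gt0 // mulr_gt0.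
have mset : measurable [set y | v y < 4^-1].
  apply: open_measurable_rV; rewrite (_ : [set y | _] = v @^-1` [set t | t < 4^-1]) //.
  by apply: open_comp => [y _|]; [exact: cv|exact: open_lt].
pose D := B `\` [set y | v y < 4^-1]; pose D' := B `&` [set y | v y < 4^-1].
have mD : measurable D by exact: measurableD.
have mD' : measurable D' by exact: measurableI.
have muD : mu B = (mu D + mu D')%E by rewrite -measureDI.
have [hD|hD] := leP (b0 / 2)%:E (mu D).
  have c4 : 0 <= 4^-1 :> R by rewrite invr_ge0.
  have w0 : 0 <= b0 / 2 by rewrite divr_ge0 // ltW.
  have vD y : D y -> 4^-1 <= v y by move=> [_ /= /negP]; rewrite -leNgt.
  have := seminorm_lower s_gt0 p_gt1 sp_gt1 tv r20 c4 w0 mD (fun y Dy => BB y Dy.1) vD hD.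
  apply: le_trans; rewrite lee_fin.
  apply: (@le_trans _ _ (mass_case_const * r `^ (n%:R - s * p))).
    by rewrite ler_wpM2r // ge_min lexx.
  rewrite le_eqVlt; apply/orP; left; apply/eqP.
  have h0 := @hardy_ball_const_gt0 R m s p p_gt1 sp_gt1.
  rewrite /mass_case_const /b0 powRB ?(gt_eqF r0) ?implybT // powR_mulrn ?(ltW r0) //.
  rewrite [(2 * r) `^ _]powRM ?(ltW r0) //.
  have -> : (r / 2 / n%:R) ^+ n = r ^+ n * (2 * n%:R) ^- n.
    by rewrite -exprVn -exprMn; congr (_ ^+ _); field; rewrite gt_eqF.
  have r1 : r `^ (s * p) != 0 by rewrite gt_eqF // powR_gt0.
  have t1 : 2 `^ (s * p) != 0 :> R by rewrite gt_eqF // powR_gt0.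
  move: (r `^ (s * p)) (2 `^ (s * p) : R) (4^-1 `^ p : R) ((2 * n%:R) ^- n : R) r1 t1.
  move=> P T S N r1 t1; field; by rewrite r1 t1 gt_eqF.
(* Outside [Omega] and within the support of the cutoff, [v >= 1], so that
    [step \o v] vanishes nearby. *)
pose u := cutoff x r \* (step \o v).
have su : smooth (step \o v) by exact: smooth_step.
have tu : test_function Omega u.
  apply: test_cutoff_mul => // y sy; apply: contrapT => nOy.
  have yB := supp_cutoff_mul r0 sy.
  have : v y <= 3 / 4.
    move: sy; apply: (@closure_sub_closed _ _ [set y | v y <= 3 / 4]).
      by apply: (@preimage_closed _ _ v [set t | t <= 3 / 4]);
        [move=> t _; exact: cv|exact: closed_le].
    move=> t /= ut; rewrite leNgt; apply/negP => h; move: ut; rewrite step_eq0 ?mulr0 ?eqxx //.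
    exact: ltW.
  have : 1 <= v y by apply: v1; split => //; exact: subset_closure.
  lra.
have uB y : B y -> u y = (step \o v) y.
  by move=> By; rewrite /u /= cutoff_eq1 ?mul1r // ltW.
have uD' y : D' y -> u y = 1.
  by move=> [By /= vy]; rewrite uB //= step_eq1 // ltW.
have hD' : ((2^-1)%:E * mu B <= mu D')%E.
  move: muD b1 b2 hD; case: (mu B) => [b| |] //; case: (mu D) => [c| |] //; case: (mu D') => [c'| |] //.
  by rewrite -EFinD => -[->]; rewrite !lee_fin lte_fin => ? _ ?; lra.
have half0 : 0 <= 2^-1 :> R by rewrite invr_ge0.
have := le_trans (mean_ge mD' (@subIsetl _ _ _) uD' b00 B2 half0 b1 b2 hD') (lp x (r / 2) xO rh0 _ tu).
rewrite (eq_gagliardo _ _ uB).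
have sl := @step_lip_gt0 R.
have g1 : (gagliardo s p B (step \o v) <= (step_lip `^ p)%:E * gagliardo s p (eball x (2 * r)) v)%E.
  apply: le_trans (gagliardo_comp s p_gt1 mB cv (ltW sl) (@step_lipP R)) _.
  by apply: lee_wpmul2l; [rewrite lee_fin powR_ge0|exact: gagliardo_sub].
have := gagliardo_ge0 s p (eball x (2 * r)) v; move: g1.
have := gagliardo_ge0 s p B (step \o v).
case: (gagliardo s p (eball x (2 * r)) v) => [F| |] //; last by move=> *; exact: leey.
case: (gagliardo s p B (step \o v)) => [G| |] //.
rewrite poweR_EFin -!EFinM !lee_fin => G0 GF F0 h.
apply: (@le_trans _ _ (level_case_const * A `^ (- p) * r `^ (n%:R - s * p))).
  by rewrite ler_wpM2r // ge_min lexx orbT.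
have pi0 : 0 <= p^-1 by rewrite invr_ge0.
have h' : 2^-1 `^ q^-1 <= A * (r / 2) `^ (s - n%:R / p) * (step_lip * F `^ p^-1).
  apply: le_trans h _; apply: ler_wpM2l; first by rewrite mulr_ge0 ?powR_ge0 // ltW.
  apply: le_trans (powR_le pi0 G0 GF) _.
  by rewrite powRM ?powR_ge0 // powRK // ltW.
(* The inequality [h'] is raised to the power [p] and solved for [F]. *)
have := powR_le p_ge0 (powR_ge0 _ _) h'.
have Ar0 : 0 <= A * (r / 2) `^ (s - n%:R / p) by rewrite mulr_ge0 ?powR_ge0 // ltW.
have sF0 : 0 <= step_lip * F `^ p^-1 by rewrite (mulr_ge0 (ltW sl)) ?powR_ge0.
rewrite (powRM _ Ar0 sF0).
rewrite [(step_lip * _) `^ p]powRM ?powR_ge0 ?(ltW sl) // powRVK //.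
rewrite [(A * _) `^ p]powRM ?powR_ge0 ?(ltW A0) // -[((r / 2) `^ _) `^ p]powRrM.
rewrite (_ : (s - n%:R / p) * p = - (n%:R - s * p)); last by field.
rewrite [(r / 2) `^ _]powRN [(r / 2) `^ _]powRM ?invr_ge0 ?(ltW r0) // /level_case_const.
have -> : 2^-1 `^ (n%:R - s * p) = 2 `^ (s * p - n%:R) :> R.
  by rewrite -(powR_inv1 (ler0n R 2)) -powRrM mulN1r opprB.
rewrite !powRN.
have A1 : 0 < A `^ p by exact: powR_gt0.
have S1 : 0 < step_lip `^ p :> R by exact: powR_gt0.
have R1 : 0 < r `^ (n%:R - s * p) by exact: powR_gt0.
have T1 : 0 < 2 `^ (s * p - n%:R) :> R by exact: powR_gt0.
move: ((2^-1 `^ q^-1) `^ p) (A `^ p) (step_lip `^ p) (r `^ _) (2 `^ _) A1 S1 R1 T1.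
move=> H Ap Sp Rp Tp A1 S1 R1 T1 hh.
have Si : 0 < Sp^-1 by rewrite invr_gt0.
have := ler_wpM2r (ltW (mulr_gt0 (divr_gt0 (mulr_gt0 R1 T1) A1) Si)) hh.
have -> : Ap * (Rp * Tp)^-1 * (Sp * F) * (Rp * Tp / Ap * Sp^-1) = F.
  by field; rewrite !gt_eqF.
move=> hF; apply: le_trans hF; rewrite le_eqVlt; apply/orP; left; apply/eqP.
by field; rewrite !gt_eqF.
Qed.

(** The power [p] of this constant, divided by [gamma], is the [p]-th power of the Poincaré
constant [A].  The first entry of the minimum makes the bound [level_case_const A^-p]
at least [gamma] times the capacity of the ball.  The second one, with
[A >= poincare_lower], bounds [gamma] so that the same holds for [mass_case_const]. *)
Definition poincare_fat_const : R :=
  (Num.min level_case_const (mass_case_const * poincare_lower `^ p) /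
     cap_upper_const (m := m) s p) `^ p^-1.

Lemma poincare_fat_const_gt0 : 0 < poincare_fat_const.
Proof.
apply: powR_gt0; apply: divr_gt0; last exact: cap_upper_const_gt0.
rewrite lt_min level_case_const_gt0 /=; apply: mulr_gt0; first exact: mass_case_const_gt0.
by apply: powR_gt0; exact: poincare_lower_gt0.
Qed.

Lemma poincare_to_fat (Omega : set 'rV[R]_n) gamma :
  open Omega -> Omega <> setT -> 0 < gamma -> (Omega = set0 -> gamma <= 1) ->
  local_poincare s p Omega q (poincare_fat_const * gamma `^ (- p^-1)) ->
  uniformly_fat s p (~` Omega) gamma.
Proof.
move=> oO OT g0 gO lp; split => //; first exact: open_closedC.
move=> x r xO r0.
have [oe|oe] := pselect (Omega = set0).
  have -> : ~` Omega `&` closure (eball x r) = closure (eball x r).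
    by rewrite oe setC0 setTI.
  rewrite -[leRHS]mul1e lee_wpmul2r ?lee_fin ?gO //.
  by apply: le_ereal_inf_tmp => _ [v _ <-]; exact: gagliardo_ge0.
have On0 : Omega !=set0 by apply/set0P; apply/eqP.
set A := poincare_fat_const * gamma `^ (- p^-1).
have A0 : 0 < A by apply: mulr_gt0; [exact: poincare_fat_const_gt0|apply: powR_gt0].
have Alow := poincare_lowerP oO On0 OT A0 lp.
have k0 := @cap_upper_const_gt0 R m s p s_lt1 p_gt1.
have l0 := poincare_lower_gt0.
set K := Num.min level_case_const (mass_case_const * poincare_lower `^ p).
have K0 : 0 < K.
  rewrite lt_min level_case_const_gt0 /=; apply: mulr_gt0; first exact: mass_case_const_gt0.
  exact: powR_gt0.
(* The normalisation for which [poincare_fat_const] was chosen. *)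
have Ap : A `^ p = K / cap_upper_const (m := m) s p / gamma.
  rewrite /A powRM ?powR_ge0 // ?(ltW poincare_fat_const_gt0) //.
  rewrite /poincare_fat_const -/K powRVK ?divr_ge0 ?(ltW K0) ?(ltW k0) //.
  by rewrite -powRrM mulNr mulVf // powR_inv1 // ltW.
apply: le_ereal_inf_tmp => _ [v [tv v1] <-].
apply: le_trans (competitor_bound lp A0 xO r0 tv v1).
apply: le_trans (lee_wpmul2l _ (cap_upper s_gt0 s_lt1 p_gt1 x r0)) _; first by rewrite lee_fin ltW.
rewrite -EFinM lee_fin mulrA ler_wpM2r ?powR_ge0 // le_min; apply/andP; split.
  have h : poincare_lower `^ p <= A `^ p by apply: powR_le => //; exact: ltW.
  have : K <= mass_case_const * poincare_lower `^ p by rewrite ge_min lexx orbT.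
  have m0 := mass_case_const_gt0; have L0 : 0 < poincare_lower `^ p by exact: powR_gt0.
  move: h; rewrite Ap => h hK.
  have : K / cap_upper_const (m := m) s p / gamma <=
      mass_case_const * poincare_lower `^ p / cap_upper_const (m := m) s p / gamma.
    by rewrite ler_pM2r ?invr_gt0 // ler_pM2r ?invr_gt0.
  move=> /(le_trans h); rewrite ler_pdivlMr // ler_pdivlMr //.
  move: (poincare_lower `^ p) L0 => L L0 hL.
  have : L * (gamma * cap_upper_const (m := m) s p) <= L * mass_case_const by lra.
  by rewrite ler_pM2l.
rewrite powRN Ap; have : K <= level_case_const by rewrite ge_min lexx.
move=> hK; have -> : (K / cap_upper_const (m := m) s p / gamma)^-1 =
  gamma * cap_upper_const (m := m) s p / K by field; rewrite !gt_eqF.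
rewrite [leRHS]mulrA ler_pdivlMr // mulrC; apply: ler_wpM2r => //.
by apply: mulr_ge0; exact: ltW.
Qed.
End poincare_to_fat.

(** * The equivalence *)

(** For [s p < N] the choice [tau = N/p - s] turns the second inequality into
[q <= N p / (N - s p)]; otherwise [tau = p s / q] is small enough for any [q]. *)
Lemma exponent_choice (R : realType) (N s p q : R) : 0 < N -> 0 < s -> 1 < p -> 1 <= q ->
  (s * p < N -> q <= N * p / (N - s * p)) ->
  exists tau, [/\ 0 < tau, N / p - s <= tau & q * tau <= p * (tau + s)].
Proof.
move=> N0 s0 p1 q1 hq; have p0 : 0 < p by lra.
have q0 : 0 < q by lra.
have [spN|Nsp] := ltP (s * p) N.
  exists (N / p - s); split; [|by []|].
    by rewrite subr_gt0 ltr_pdivlMr.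
  have d0 : 0 < N - s * p by rewrite subr_gt0.
  have := hq spN; rewrite ler_pdivlMr // => h.
  rewrite subrK mulrCA divff ?gt_eqF // mulr1.
  have -> : q * (N / p - s) = q * (N - s * p) / p by field; rewrite gt_eqF.
  by rewrite ler_pdivrMr.
exists (p * s / q); split.
- by rewrite divr_gt0 // mulr_gt0.
- apply: (@le_trans _ _ 0); last by rewrite divr_ge0 ?mulr_ge0 // ltW.
  by rewrite subr_le0 ler_pdivrMr.
rewrite mulrCA divff ?gt_eqF // mulr1 mulrDr lerDr.
by rewrite !mulr_ge0 ?invr_ge0 // ltW.
Qed.

Theorem theorem1p9 (R : realType) (n : nat) (s p q : R)
  (n_gt0 : (0 < n)%N) (s_gt0 : 0 < s) (s_lt1 : s < 1) (p_gt1 : 1 < p)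
  (sp_gt1 : 1 < s * p) (q_ge1 : 1 <= q)
  (q_le : s * p < n%:R -> q <= n%:R * p / (n%:R - s * p)) :
  exists C1 C2 : R, [/\ 0 < C1, 0 < C2 &
    forall (Omega : set 'rV[R]_n) (gamma : R),
      open Omega -> Omega <> setT -> 0 < gamma ->
      (uniformly_fat s p (~` Omega) gamma ->
         local_poincare s p Omega q (C1 * gamma `^ (- p^-1))) /\
      ((Omega = set0 -> gamma <= 1) ->
       local_poincare s p Omega q (C2 * gamma `^ (- p^-1)) ->
         uniformly_fat s p (~` Omega) gamma)].
Proof.
case: n n_gt0 q_le => // m _ q_le.
have N0 : 0 < (m.+1)%:R :> R by rewrite ltr0n.
have [tau [t0 t1 t2]] := exponent_choice N0 s_gt0 p_gt1 q_ge1 q_le.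
exists (fat_poincare_const (m := m) s p q tau), (poincare_fat_const (m := m) s p q); split.
- exact: fat_poincare_const_gt0.
- exact: poincare_fat_const_gt0.
move=> Omega gamma oO OT g0; split; first exact: fat_to_poincare.
exact: poincare_to_fat.
Qed.
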